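(* Let $t\ge 1$ be an integer and $d>0$, and let $G$ be a graph with no $K_t$-minor such that every minor of $G$ has average degree at most $d$. Then for every ball hypergraph $\mathcal{H}$ of $G$, $$\tau(\mathcal{H})\le 2\mathrm{e}(t-1)\,d\cdot \nu(\mathcal{H})\cdot \log\bigl(11\mathrm{e}\,d\cdot \nu(\mathcal{H})\bigr).$$ In particular, there is an absolute constant $c>0$ such that for every graph $G$ with no $K_t$-minor and every ball hypergraph $\mathcal{H}$ of $G$, $\tau(\mathcal{H})\le c\,t^2\sqrt{\log t}\cdot \nu(\mathcal{H})\cdot \log(t\cdot \nu(\mathcal{H}))$; and if $G$ is planar then $\tau(\mathcal{H})\le 48\,\mathrm{e}\cdot \nu(\mathcal{H})\cdot \log(66\,\mathrm{e}\cdot \nu(\mathcal{H}))$.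
   Context: Graphs are finite; $\log$ is the natural logarithm and $\mathrm{e}$ its base. The average degree of a graph $(V,E)$ is $2|E|/|V|$. A hypergraph $\mathcal{H}=(V,\mathcal{E})$ has vertex set $V$ and edge set $\mathcal{E}\subseteq 2^V$. A matching is a set of pairwise vertex-disjoint edges; $\nu(\mathcal{H})$ is the maximum number of edges in a matching. A transversal is a set of vertices meeting every edge; $\tau(\mathcal{H})$ is the minimum size of a transversal. For a graph $G$, an integer $r\ge 0$ and a vertex $v$, $B_r(v)=\{u\in V(G): d_G(u,v)\le r\}$, with $d_G$ the shortest-path distance. A ball hypergraph of $G$ is a hypergraph with vertex set $V(G)$ each of whose edges is a ball $B_r(v)$ for some integer $r\ge 0$ and vertex $v$.
   Formalization: In the first bound it is additionally assumed that d ≥ 1 when G is non-empty and has no edge; as printed the bound fails, e.g. for a single vertex, H={{v}}, t=2, d=0.001 (τ=1 but the right side is negative). If G has an edge, d ≥ 1 is automatic. *)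

(* Defs.v *)
From HB Require Import structures.
From mathcomp Require Import all_boot all_order all_algebra.
From mathcomp Require Import all_classical all_reals all_analysis.
Import Order.TTheory GRing.Theory Num.Theory.
Import numFieldNormedType.Exports.

Set Implicit Arguments.
Unset Strict Implicit.
Unset Printing Implicit Defensive.

Local Open Scope ring_scope.

Record graph := Graph {
  vertex :> finType;
  adj : rel vertex;
  adj_sym : symmetric adj;
  adj_irrefl : irreflexive adj }.

Arguments adj {_} _ _.

Definition edges (G : graph) : {set {set G}} :=
  [set e : {set G} | [exists u, exists v, adj u v && (e == [set u; v])]]%SET.

(* The graph with no vertex gets average degree 0, since x / 0 = 0. *)
Definition avg_degree (R : realType) (G : graph) : R :=
  2 * #|edges G|%:R / #|G|%:R.

Definition complete_adj (t : nat) : rel 'I_t := fun i j => i != j.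

Lemma complete_adj_sym t : symmetric (@complete_adj t).
Proof. by move=> i j; rewrite /complete_adj eq_sym. Qed.

Lemma complete_adj_irrefl t : irreflexive (@complete_adj t).
Proof. by move=> i; rewrite /complete_adj eqxx. Qed.

Definition complete_graph (t : nat) : graph :=
  Graph (@complete_adj_sym t) (@complete_adj_irrefl t).

Definition connected_in (G : graph) (A : {set G}) : Prop :=
  forall x y, x \in A -> y \in A ->
    connect (fun a b : G => [&& a \in A, b \in A & adj a b]) x y.

(* H is obtained from a subgraph of G by contracting each branch set
   [branch h] to the vertex h. *)
Definition is_minor (H G : graph) : Prop :=
  exists branch : H -> {set G},
    [/\ forall h, branch h != finset.set0,
        forall h, connected_in (branch h),
        forall h k, h != k -> [disjoint branch h & branch k] &
        forall h k, adj h k ->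
          exists x y, [/\ x \in branch h, y \in branch k & adj x y] ].

Definition path_of_length (G : graph) (k : nat) (u v : G) : bool :=
  [exists p : k.-tuple G,
    [&& path adj u p, uniq (u :: p) & last u p == v]].

Lemma connect_path_of_length (G : graph) (u v : G) :
  connect adj u v -> exists k, path_of_length k u v.
Proof.
case/connectP=> p up ->; case: (shortenP up) => q uq Uq _.
by exists (size q); apply/existsP; exists (in_tuple q); rewrite uq Uq eqxx.
Qed.

(* [None] stands for infinite distance. *)
Definition gdist (G : graph) (u v : G) : option nat :=
  match boolP (connect adj u v) with
  | AltTrue uv => Some (ex_minn (connect_path_of_length uv))
  | AltFalse _ => None
  end.

Definition gball (G : graph) (r : nat) (v : G) : {set G} :=
  [set u | if gdist u v is Some k then (k <= r)%N else false]%SET.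

Definition ball_hypergraph (G : graph) (H : {set {set G}}) : Prop :=
  forall e, e \in H -> exists (r : nat) (v : G), e = gball r v.

Definition matching (V : finType) (H M : {set {set V}}) : bool :=
  (M \subset H) && finset.trivIset M.

Definition nu (V : finType) (H : {set {set V}}) : nat :=
  \max_(M : {set {set V}} | matching H M) #|M|.

Definition meets_all (V : finType) (H : {set {set V}}) (T : {set V}) : bool :=
  [forall e in H, (T :&: e)%SET != finset.set0].

(* If the empty set is an edge there is no transversal and the value is the
   junk #|V|; balls are never empty. *)
Definition tau (V : finType) (H : {set {set V}}) : nat :=
  #|[arg min_(T < finset.setT | meets_all H T) #|T|]%N|.

(* A drawing in the plane: distinct points for the vertices, and for each edge
   a simple arc joining its two ends, whose interior contains no vertex and is
   disjoint from the interior of every other edge. *)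
Definition planar (R : realType) (G : graph) : Prop :=
  exists (pt : G -> R * R) (arc : {set G} -> R -> R * R),
    [/\ injective pt,
        forall e, e \in edges G ->
          [/\ {within `[0, 1], continuous (arc e)}%classic,
              {in `[0, 1] &, injective (arc e)} &
              exists u v,
                [/\ e = [set u; v]%SET, arc e 0 = pt u & arc e 1 = pt v] ],
        forall e s w, e \in edges G -> s \in `]0, 1[ -> arc e s <> pt w &
        forall e f s t, e \in edges G -> f \in edges G -> e != f ->
          s \in `]0, 1[ -> t \in `]0, 1[ -> arc e s <> arc f t ].

(* Main.v *)
(** Let [w] be a fractional matching of a family of pairwise incomparable balls.
    Keep each ball [e] independently with probability [1 - exp (- w e)]: the
    graph joining two kept balls that share a point lying in no other kept ball
    is a minor of [G], by additively weighted Voronoi cells around the centres,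
    so it has average degree at most [d].  Taking expectations bounds the weight
    of intersecting pairs, and a weighted Turan argument then yields a matching
    of size at least [(sum of w) / (e d)].  By duality there is a fractional
    transversal of weight at most [e d nu].  A set shattered by balls is, again
    by Voronoi cells, the vertex set of a clique minor, so the VC-dimension is
    below [t], and an epsilon-net gives the first bound.

    For the absolute constant, average degree at least a large multiple of
    [t sqrt (log t)] forces a [K_t]-minor: a critical minor has a dense neighbourhood
    with no small separator, where branch sets grown from random vertices can be
    chosen greedily.  In the planar case [t = 5] and [d = 6]: a drawing of a
    [K_5]-minor would give closed polylines with an impossible crossing parity,
    and a graph with no [K_5]-minor has at most [3 n] edges by Mader's
    argument. *)

Require Import Defs.
From HB Require Import structures.
From Stdlib Require Import Btauto.
From mathcomp Require Import all_boot all_order all_algebra.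
From mathcomp Require Import all_classical all_reals all_analysis.
From mathcomp Require Import zify ring lra.
From mathcomp Require Import fintype finset.
Import Order.TTheory GRing.Theory Num.Theory.
Import numFieldNormedType.Exports.

Set Implicit Arguments.
Unset Strict Implicit.
Unset Printing Implicit Defensive.

(** * Balls and Voronoi minors *)

Local Open Scope nat_scope.

(** Keeping a ball with probability [1 - exp (- w e)] makes the chance that no further ball through
    a point is kept equal to [exp] of minus their total weight. As the load of a point is at most 1,
    two intersecting balls [a], [b] are in contact with probability at least
    [(exp (w a) - 1) (exp (w b) - 1) / e], hence at least [w a * w b / e]; this is the origin of the
    factor [e]. The diagonal terms [w e ^ 2] of the Turan sum are paid for by the gap between [w e]
    and the keeping probability, which is where [1 <= d] enters. Incomparability puts every centre
    inside its own cell; passing to the inclusion-minimal edges secures it, since a transversal of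
    these meets all edges and [nu] does not grow. For drawings, the only analytic input is that
    disjoint arcs lie at positive distance. Arcs are sampled finely and the sample points moved into
    general position; what remains is a parity statement about signs of determinants. It holds for
    straight segments by enumeration, and replacing segments by polylines changes it by corrections
    that cancel. *)

(* The distance, with [#|G|] in place of infinity. *)
Definition dist (G : graph) (u v : G) : nat := odflt #|G| (gdist u v).

Lemma dist_le_size (G : graph) (u v : G) p :
  path adj u p -> last u p = v -> dist u v <= size p.
Proof.
move=> up <-; have uv : connect adj u (last u p) by apply/connectP; exists p.
rewrite /dist /gdist; case: {-}_ / (boolP (connect adj u _)) => [uv'|]; last by rewrite uv.
case: ex_minnP => m /= _; case: (shortenP up) => q uq Uq qp min_m.
have qk : path_of_length (size q) u (last u q).
  by apply/existsP; exists (in_tuple q); rewrite uq Uq eqxx.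
apply: leq_trans (min_m _ qk) _; move/andP: Uq => [_ Uq].
by apply: uniq_leq_size Uq qp.
Qed.

Lemma dist_pathP (G : graph) (u v : G) : dist u v < #|G| ->
  exists p, [/\ path adj u p, last u p = v & size p = dist u v].
Proof.
rewrite /dist /gdist; case: {-}_ / (boolP (connect adj u v)) => [uv'|]; last by rewrite ltnn.
case: ex_minnP => m /= /existsP[p /and3P[up _ /eqP lp]] _ _.
by exists p; split => //; rewrite size_tuple.
Qed.

Lemma dist_lt_connect (G : graph) (u v : G) : (dist u v < #|G|) = connect adj u v.
Proof.
apply/idP/idP => [/dist_pathP[p [up lp _]]|]; first by apply/connectP; exists p.
move=> uv; rewrite /dist /gdist; case: {-}_ / (boolP (connect adj u _)) => [uv'|]; last by rewrite uv.
case: ex_minnP => m /= /existsP[p /and3P[_ Up _]] _.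
by have := card_uniqP Up; rewrite /= size_tuple => <-; exact: max_card.
Qed.

Lemma dist_le_card (G : graph) (u v : G) : dist u v <= #|G|.
Proof.
case: (boolP (connect adj u v)) => [|/negP h]; first by rewrite -dist_lt_connect; lia.
by rewrite leqNgt; apply/negP; rewrite /dist /gdist; case: {-}_ / (boolP (connect adj u v)) => //= _; rewrite ltnn.
Qed.

Lemma dist_sym (G : graph) (u v : G) : dist u v = dist v u.
Proof.
suff le_d (x y : G) : dist x y <= dist y x by apply/eqP; rewrite eqn_leq !le_d.
have [/dist_pathP[p [yp lp <-]]|] := ltnP (dist y x) #|G|; last first.
  by apply: leq_trans; exact: dist_le_card.
have := rev_path adj y p; rewrite lp => e.
have pr : path adj x (rev (belast y p)).
  by rewrite e; rewrite (eq_path (e' := adj)) // => a b; rewrite adj_sym.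
rewrite -(size_belast y p) -size_rev; apply: dist_le_size pr _.
case: p lp {yp e} => [|z p] //= _.
by rewrite rev_cons last_rcons.
Qed.

(** The cap at [#|G|] is harmless here: an infinite term on the right already equals the largest
    value that [dist] takes. *)
Lemma dist_triangle (G : graph) (u v w : G) : dist u w <= dist u v + dist v w.
Proof.
have [/dist_pathP[p [up lp <-]]|] := ltnP (dist u v) #|G|; last first.
  by move=> h; have := dist_le_card u w; lia.
have [/dist_pathP[q [vq lq <-]]|] := ltnP (dist v w) #|G|; last first.
  by move=> h; have := dist_le_card u w; lia.
rewrite -size_cat; apply: dist_le_size; last by rewrite last_cat lp.
by rewrite cat_path up lp.
Qed.

Lemma distxx (G : graph) (u : G) : dist u u = 0.
Proof. by apply/eqP; rewrite -leqn0; exact: (@dist_le_size _ _ _ [::]). Qed.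

Lemma card_graph_gt0 (G : graph) (u : G) : 0 < #|G|.
Proof. by apply/card_gt0P; exists u. Qed.

Lemma dist_eq0 (G : graph) (u v : G) : dist u v = 0 -> u = v.
Proof.
move=> d0; have : dist u v < #|G| by rewrite d0 (card_graph_gt0 u).
by case/dist_pathP=> -[|x p] [_ // _ /=]; rewrite d0.
Qed.

Lemma dist_adj (G : graph) (u v : G) : adj u v -> dist u v <= 1.
Proof. by move=> uv; apply: (@dist_le_size _ _ _ [:: v]) => //=; rewrite uv. Qed.

Lemma dist_step (G : graph) (u v : G) : dist u v < #|G| -> u != v ->
  exists2 w, adj u w & dist u v = (dist w v).+1.
Proof.
case/dist_pathP=> -[|w p] [/= up lp sp] uv; first by rewrite lp eqxx in uv.
case/andP: up => uw wp; exists w => //.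
have := dist_le_size wp lp; have := dist_triangle u w v; have := dist_adj uw; lia.
Qed.

(** Capping the radius at [#|G|.-1] keeps vertices at infinite distance, where [dist] is [#|G|], out
    of every ball. *)
Lemma mem_gball (G : graph) (r : nat) (v u : G) :
  (u \in gball r v) = (dist u v <= minn r #|G|.-1).
Proof.
have n0 := card_graph_gt0 u.
rewrite inE; case E : (gdist u v) => [k|].
  have : dist u v = k by rewrite /dist E.
  have : dist u v < #|G| ; last by lia.
  rewrite dist_lt_connect; move: E; rewrite /gdist.
  by case: {-}_ / (boolP (connect adj u v)).
have : dist u v = #|G| by rewrite /dist E.
by move: n0; lia.
Qed.

Section Voronoi.
Variables (G : graph) (I : finType) (c : I -> G) (rho : I -> nat).

Definition vordist (i : I) (y : G) := dist y (c i) + rho i.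
Local Notation f := vordist.

(* Additively weighted Voronoi cells; ties are broken by [enum_rank] so that
   the cells are disjoint. *)
Definition vorbeats (y : G) (i k : I) :=
  (f i y < f k y) || ((f i y == f k y) && (enum_rank i <= enum_rank k)).
Definition vorcell (i : I) : {set G} :=
  [set y | [forall k, vorbeats y i k] && (dist y (c i) < #|G|)].

(** Each site strictly wins at its own position, so no cell is empty. *)
Hypothesis site_own : forall i k, i != k -> rho i < dist (c i) (c k) + rho k.

Lemma site_vorcell i : c i \in vorcell i.
Proof.
rewrite inE distxx (card_graph_gt0 (c i)) andbT; apply/forallP=> k.
rewrite /vorbeats /f distxx; case: (eqVneq i k) => [->|/site_own]; last by lia.
by rewrite distxx eqxx leqnn orbT.
Qed.

Lemma vorcell_disjoint i k : i != k -> [disjoint vorcell i & vorcell k].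
Proof.
move=> ik; rewrite disjoint_subset; apply/subsetP=> y; rewrite !inE.
case/andP=> /forallP /(_ k) a _; apply/negP=> /andP[/forallP /(_ i) b _].
suff rk : nat_of_ord (enum_rank i) = nat_of_ord (enum_rank k).
  by case/eqP: ik; exact: enum_rank_inj (val_inj rk).
by move: a b; rewrite /vorbeats; lia.
Qed.

(** A step towards [c i] lowers the weighted distance to [i] by exactly one, and the distance to any
    [k] by at most one, so no comparison won by [i] is lost. *)
Lemma vorbeats_step y y' i k : adj y y' -> dist y (c i) = (dist y' (c i)).+1 ->
  vorbeats y i k -> vorbeats y' i k.
Proof.
move=> yy' st; have := dist_triangle y y' (c k); have := dist_adj yy'.
by rewrite /vorbeats /f st; lia.
Qed.

Lemma vorcell_step y y' i : adj y y' -> dist y (c i) = (dist y' (c i)).+1 ->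
  y \in vorcell i -> y' \in vorcell i.
Proof.
move=> yy' st; rewrite !inE => /andP[/forallP yi h]; apply/andP; split; last by lia.
by apply/forallP=> k; exact: vorbeats_step (yi k).
Qed.

Lemma vorcell_connected i : connected_in (vorcell i).
Proof.
rewrite /connected_in; set e := fun a b : G => [&& a \in vorcell i, b \in _ & adj a b].
have esym : connect_sym e.
  apply: sym_connect_sym => a b; rewrite /e adj_sym.
  by rewrite andbA (andbC (a \in _)) -andbA.
have toc y : y \in vorcell i -> connect e y (c i).
  move: {2}(dist y (c i)) (leqnn (dist y (c i))) => n; elim: n y => [|n IH] y yn yi.
    have /dist_eq0 -> : dist y (c i) = 0 by lia.
    exact: connect0.
  have [->|yc] := eqVneq y (c i); first exact: connect0.
  have yl : dist y (c i) < #|G| by move: yi; rewrite inE => /andP[].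
  have [y' yy' st] := dist_step yl yc.
  have y'i := vorcell_step yy' st yi.
  apply: connect_trans (IH _ _ y'i); last by lia.
  by apply: connect1; rewrite /e yi y'i.
by move=> x y xi yi; apply: connect_trans (toc _ xi) _; rewrite esym; exact: toc.
Qed.

(** The level [h] stands for a ball: [x] is reached at level [h] from [i] and [j] and from no third
    site. *)
Definition vorcontact (i j : I) := i != j /\ exists (x : G) (h : nat),
  [/\ f i x <= h, f j x <= h, dist x (c i) < #|G|, dist x (c j) < #|G| &
      forall k, k != i -> k != j -> h < f k x].

Lemma vorcontact_cell i j y : i != j ->
  dist y (c i) < #|G| -> dist y (c j) < #|G| ->
  (forall k, k != i -> k != j -> f j y < f k y) ->
  (y \in vorcell i) || (y \in vorcell j).
Proof.
move=> ij yi yj kh; rewrite !inE yi yj !andbT.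
have tot : vorbeats y i j || vorbeats y j i by rewrite /vorbeats; lia.
case: (boolP (vorbeats y i j)) => [b|nb].
  apply/orP; left; apply/forallP=> k.
  case: (eqVneq k i) => [->|ki]; first by rewrite /vorbeats eqxx leqnn orbT.
  case: (eqVneq k j) => [->//|kj].
  by have := kh k ki kj; move: b; rewrite /vorbeats; lia.
apply/orP; right; apply/forallP=> k.
rewrite (negbTE nb) /= in tot.
case: (eqVneq k i) => [->//|ki].
case: (eqVneq k j) => [->|kj]; first by rewrite /vorbeats eqxx leqnn orbT.
by have := kh k ki kj; rewrite /vorbeats; lia.
Qed.

(* Walk from a common point towards [c j]: along this walk only the cells of
   [i] and [j] are met, since [f j] decreases at maximal speed. *)
Lemma vorcontact_walk i j y : i != j -> y \in vorcell i -> dist y (c j) < #|G| ->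
  (forall k, k != i -> k != j -> f j y < f k y) ->
  exists a b, [/\ a \in vorcell i, b \in vorcell j & adj a b].
Proof.
move=> ij; move: {2}(dist y (c j)) (leqnn (dist y (c j))) => n.
elim: n y => [|n IH] y yn yi yj kh.
  have yc : y = c j by apply: dist_eq0; lia.
  have := disjointFr (vorcell_disjoint ij) yi.
  by rewrite yc site_vorcell.
have yc : y != c j.
  apply/eqP=> yc; have := disjointFr (vorcell_disjoint ij) yi.
  by rewrite yc site_vorcell.
have [y' yy' st] := dist_step yj yc.
have kh' k : k != i -> k != j -> f j y' < f k y'.
  move=> ki kj; have := kh k ki kj; have := dist_triangle y y' (c k).
  by have := dist_adj yy'; rewrite /f st; lia.
have y'j : dist y' (c j) < #|G| by lia.
have y'i : dist y' (c i) < #|G|.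
  rewrite dist_lt_connect; apply: (@connect_trans _ _ y).
    by apply: connect1; rewrite adj_sym.
  by rewrite -dist_lt_connect; move: yi; rewrite inE => /andP[].
case/orP: (vorcontact_cell ij y'i y'j kh') => h; last by exists y, y'.
by apply: IH h _ kh' => //; lia.
Qed.

Lemma vorcontact_adj i j : vorcontact i j ->
  exists a b, [/\ a \in vorcell i, b \in vorcell j & adj a b].
Proof.
move=> [ij [x [h [ai aj bi bj kh]]]].
have khj k : k != i -> k != j -> f j x < f k x by move=> /kh a /a; lia.
have khi k : k != j -> k != i -> f i x < f k x by move=> kj ki; have := kh k ki kj; lia.
case/orP: (vorcontact_cell ij bi bj khj) => xc.
  exact: (vorcontact_walk ij xc bj khj).
rewrite eq_sym in ij.
have [a [b [aj' bi' ab]]] := vorcontact_walk ij xc bi khi.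
by exists b, a; rewrite adj_sym.
Qed.

Lemma vorcontact_minor (M : graph) (phi : M -> I) : injective phi ->
  (forall a b, adj a b -> vorcontact (phi a) (phi b)) -> is_minor M G.
Proof.
move=> phiI phiC; exists (fun a => vorcell (phi a)); split.
- by move=> a; apply/set0Pn; exists (c (phi a)); exact: site_vorcell.
- by move=> a; exact: vorcell_connected.
- by move=> a b ab; apply: vorcell_disjoint; rewrite (inj_eq phiI).
- by move=> a b /phiC /vorcontact_adj.
Qed.

End Voronoi.

(** * Shattering and epsilon-nets *)

Definition shatters (T : finType) (F : {set {set T}}) (X : {set T}) :=
  [forall Y : {set T}, (Y \subset X) ==> [exists S in F, X :&: S == Y]].

Lemma shattersP (T : finType) (F : {set {set T}}) (X : {set T}) :
  reflect (forall Y : {set T}, Y \subset X -> exists2 S, S \in F & X :&: S = Y)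
          (shatters F X).
Proof.
apply: (iffP forallP) => h Y; last first.
  by apply/implyP=> /h [S SF e]; apply/existsP; exists S; rewrite SF e eqxx.
by move=> YX; have /implyP/(_ YX)/existsP[S /andP[SF /eqP e]] := h Y; exists S.
Qed.

Lemma shattersS (T : finType) (F F' : {set {set T}}) X :
  F \subset F' -> shatters F X -> shatters F' X.
Proof.
move=> /subsetP FF' /shattersP h; apply/shattersP=> Y /h [S /FF' SF e].
by exists S.
Qed.

(* Pajor's form of the Sauer-Shelah lemma. *)
Lemma card_le_shattered (T : finType) (F : {set {set T}}) :
  #|F| <= #|[set X | shatters F X]|.
Proof.
elim: {F}_.+1 {-2}F (ltnSn #|F|) => // n IH F; rewrite ltnS => Fn.
have [F1|] := leqP #|F| 1.
  have [->|/set0Pn[S SF]] := eqVneq F set0; first by rewrite cards0.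
  apply: leq_trans F1 _; apply/card_gt0P; exists set0; rewrite inE.
  by apply/shattersP=> Y; rewrite subset0 => /eqP ->; exists S; rewrite // set0I.
case/card_gt1P=> A [B [AF BF AB]].
have [x xAB] : exists x, (x \in A) != (x \in B).
  apply/existsP; move: AB; apply: contraR; rewrite negb_exists => /forallP h.
  by apply/eqP/setP=> x; apply/eqP; rewrite -[_ == _]negbK.
pose F1 := [set S in F | x \in S]; pose F0 := [set S in F | x \notin S].
have F10 : #|F1| + #|F0| = #|F|.
  by rewrite -(cardsID [set S : {set T} | x \in S] F); congr (_ + _);
    apply: eq_card => S; rewrite !inE // andbC.
have [F1_gt0 F0_gt0] : 0 < #|F1| /\ 0 < #|F0|.
  move: xAB; case xA : (x \in A); case xB : (x \in B) => // _; split; apply/card_gt0P.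
  - by exists A; rewrite inE AF xA.
  - by exists B; rewrite inE BF xB.
  - by exists B; rewrite inE BF xB.
  - by exists A; rewrite inE AF xA.
have h1 : #|F1| <= #|[set X | shatters F1 X]| by apply: IH; lia.
have h0 : #|F0| <= #|[set X | shatters F0 X]| by apply: IH; lia.
pose s1 := [set X | shatters F1 X]; pose s0 := [set X | shatters F0 X].
have xs1 X : X \in s1 -> x \notin X.
  rewrite inE => /shattersP /(_ _ (sub0set _)) [S]; rewrite inE => /andP[_ xS] e.
  by apply/negP=> xX; have := in_set0 x; rewrite -e inE xX xS.
have xs0 X : X \in s0 -> x \notin X.
  rewrite inE => /shattersP /(_ _ (subxx X)) [S]; rewrite inE => /andP[_ xS] e.
  by apply/negP=> xX; move: xX; rewrite -e inE (negbTE xS) andbF.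
(* A set shattered by both halves is counted a second time with [x] added: the traces with [x] come
   from [F1], those without from [F0]. *)
have h : #|s1 :|: s0| + #|[set x |: X | X in s1 :&: s0]| <= #|[set X | shatters F X]|.
  pose s10 := [set x |: X | X in s1 :&: s0].
  rewrite -cardsUI (_ : (s1 :|: s0) :&: s10 = set0) ?cards0 ?addn0; last first.
    apply/setP=> X; rewrite [RHS]inE; apply/negbTE/negP; rewrite in_setI => /andP[a].
    case/imsetP=> Y _ XY; have xX : x \in X by rewrite XY setU11.
    by move: a; rewrite in_setU => /orP[/xs1|/xs0]; rewrite xX.
  apply: subset_leq_card; apply/subsetP=> X; rewrite in_setU => /orP[].
    rewrite in_setU !inE => /orP[]; apply: shattersS; apply/subsetP=> S;
    by rewrite inE => /andP[].
  case/imsetP=> Y; rewrite in_setI => /andP[Y1 Y0] ->; rewrite inE; apply/shattersP=> Z ZY.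
  have ZY' : Z :\ x \subset Y.
    by apply/subsetP=> y; rewrite !inE => /andP[yx /(subsetP ZY)];
       rewrite !inE (negbTE yx).
  case xZ : (x \in Z).
    move: Y1; rewrite inE => /shattersP /(_ _ ZY') [S].
    rewrite inE => /andP[SF xS] e; exists S => //.
    apply/setP=> y; move/setP/(_ y): e; rewrite !inE.
    by case: (eqVneq y x) => [->|_] //=; rewrite xS xZ.
  move: Y0; rewrite inE => /shattersP /(_ _ ZY') [S].
  rewrite inE => /andP[SF xS] e; exists S => //.
  apply/setP=> y; move/setP/(_ y): e; rewrite !inE.
  by case: (eqVneq y x) => [->|_] //=; rewrite (negbTE xS) xZ andbF.
rewrite card_in_imset ?cardsUI in h; last first.
  move=> X Y; rewrite !inE => /andP[_ X0] /andP[_ Y0] e.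
  have xX : x \notin X by apply: xs0; rewrite inE.
  have xY : x \notin Y by apply: xs0; rewrite inE.
  by rewrite -(setU1K xX) -(setU1K xY) e.
by rewrite /s1 /s0 in h; lia.
Qed.

Lemma sauer_shelah (T : finType) (F : {set {set T}}) (D : nat) :
  (forall X, shatters F X -> #|X| <= D) ->
  #|F| <= \sum_(i < D.+1) 'C(#|T|, i).
Proof.
move=> FD; apply: leq_trans (card_le_shattered F) _.
apply: (@leq_trans #|[set X : {set T} | #|X| <= D]|).
  by apply: subset_leq_card; apply/subsetP=> X; rewrite !inE; exact: FD.
rewrite -sum1_card (partition_big (fun X : {set T} => inord #|X| : 'I_D.+1) xpredT) //=.
apply: leq_sum => i _; rewrite sum1_card -(card_draws T i); apply: subset_leq_card.
apply/subsetP=> X; rewrite !inE => /andP[XD /eqP <-].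
by move: XD; rewrite inE => XD; rewrite inordK.
Qed.

(** * Double sampling *)

Section EpsNet.
Variables (R : realFieldType) (V : finType) (H : {set {set V}}) (z : V -> R).
Variables (eps : R) (D m : nat).
Hypotheses (z_ge0 : forall v, (0 <= z v)%R) (z_sum : (\sum_v z v = 1)%R).
Hypotheses (eps_ge0 : (0 <= eps)%R).
Hypothesis z_heavy : forall e, e \in H -> (eps <= \sum_(v in e) z v)%R.
Hypothesis vc_le : forall X, shatters H X -> #|X| <= D.

Local Notation sample := {ffun 'I_m -> V}.
Let Z (u : sample) : R := (\prod_k z (u k))%R.

Let pts (p : sample * sample) (q : 'I_m * bool) : V := if q.2 then p.2 q.1 else p.1 q.1.
Let trace (p : sample * sample) (e : {set V}) := [set q | pts p q \in e].
Let traces p := [set trace p e | e in H].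

(** Positions that are shattered carry distinct points, and these points are shattered by [H]. So
    the traces on the [2 m] positions have VC-dimension at most [D]. *)
Let card_traces p : #|traces p| <= \sum_(i < D.+1) 'C(m * 2, i).
Proof.
rewrite -[m in m * 2]card_ord -card_bool -card_prod; apply: sauer_shelah => X XF.
have ptsI : {in X &, injective (pts p)}.
  move=> q q' qX q'X e; move/shattersP/(_ [set q]): XF; rewrite sub1set => /(_ qX).
  case=> _ /imsetP[E EH ->] /setP e'; have := e' q; have := e' q'; rewrite !inE q'X qX e.
  by rewrite eqxx => -> /eqP.
rewrite -(card_in_imset ptsI); apply: vc_le; apply/shattersP=> Y YX.
move/shattersP/(_ (X :&: pts p @^-1: Y) (subsetIl _ _)): XF => [_ /imsetP[E EH ->]] /setP e.
exists E => //; apply/setP=> v; rewrite inE; apply/andP/idP.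
  by case=> /imsetP[q qX ->] qE; have := e q; rewrite !inE qX qE => /esym.
move=> vY; have /imsetP[q qX vq] := subsetP YX v vY; split.
  by rewrite vq; apply: imset_f.
by have := e q; rewrite !inE qX -vq vY.
Qed.

(** After the swap [b], position [(k, b k)] belongs to the first sample and [(k, ~~ b k)] to the
    ghost sample. The weight vanishes if [S] meets the first sample and otherwise is 2 to the number
    of ghost hits. *)
Let weight (b : {ffun 'I_m -> bool}) (S : {set 'I_m * bool}) : R :=
  (\prod_k (if (k, b k) \in S then 0 else if (k, ~~ b k) \in S then 2 else 1))%R.

Let weight_ge0 b S : (0 <= weight b S)%R.
Proof. by apply: prodr_ge0 => k _; do 2!case: ifP => _ //. Qed.

(** The sum factors over coordinates; a coordinate contributes 0 when both its positions lie in [S]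
    and 2 in all other cases. *)
Let sum_weight S : (\sum_b weight b S <= 2 ^+ m)%R.
Proof.
rewrite /weight -(bigA_distr_bigA (fun k (c : bool) =>
  if (k, c) \in S then 0 else if (k, ~~ c) \in S then 2 else 1)%R) /=.
rewrite -[in leRHS](card_ord m) -prodr_const; apply: ler_prod => k _.
rewrite big_bool /=.
by case: ((k, true) \in S); case: ((k, false) \in S); apply/andP; split => //; lra.
Qed.

Let sumZ : (\sum_u Z u = 1)%R.
Proof.
rewrite /Z -(bigA_distr_bigA (fun _ : 'I_m => z)) /= (eq_bigr (fun=> 1%R)) //.
by rewrite big1_eq.
Qed.

(* Double sampling: a first sample [u] and a ghost sample [v], the latter being
   weighted by [2 ^ (number of hits)]; swapping coordinates of [u] and [v] at
   random shows that every trace contributes at most [1] on average. *)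
Lemma net_counting :
  (forall u : sample, exists2 e, e \in H & forall k, u k \notin e) ->
  ((1 + eps) ^+ m <= (\sum_(i < D.+1) 'C(m * 2, i))%:R :> R)%R.
Proof.
move=> bad.
have /boolp.choice[E EP] : forall u : sample, exists e : {set V},
    e \in H /\ forall k, u k \notin e.
  by move=> u; case: (bad u) => e; exists e.
pose h (p : sample * sample) : R := (\prod_k (if p.2 k \in E p.1 then 2 else 1))%R.
pose sw (b : {ffun 'I_m -> bool}) (p : sample * sample) : sample * sample :=
  ([ffun k => if b k then p.2 k else p.1 k], [ffun k => if b k then p.1 k else p.2 k]).
have swK b : involutive (sw b).
  move=> [u v]; rewrite /sw /=; congr pair; apply/ffunP=> k; rewrite !ffunE;
  by case: (b k).
have Zsw b p : (Z (sw b p).1 * Z (sw b p).2 = Z p.1 * Z p.2)%R.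
  rewrite /Z -!big_split; apply: eq_bigr => k _ /=; rewrite !ffunE.
  by case: (b k) => //; rewrite mulrC.
have hsw b p : (h (sw b p) <= \sum_(S in traces p) weight b S)%R.
  set e := E (sw b p).1; have [eH emiss] := EP (sw b p).1.
  have tH : trace p e \in traces p by apply: imset_f.
  rewrite (bigD1 _ tH) /= -[leLHS]addr0; apply: lerD; last first.
    by apply: sumr_ge0 => S _; exact: weight_ge0.
  rewrite le_eqVlt; apply/orP; left; apply/eqP; apply: eq_bigr => k _.
  have := emiss k; rewrite -/e !inE /pts /= !ffunE.
  by case: (b k) => /= /negbTE ->.
(* Ghost points are independent and each hits [E u] with probability at least [eps], so its factor
   has mean at least [1 + eps]. *)
have low : ((1 + eps) ^+ m <= \sum_(p : sample * sample) Z p.1 * Z p.2 * h p)%R.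
  rewrite -(pair_bigA _ (fun u v => Z u * Z v * h (u, v))%R) /=.
  have -> : ((1 + eps) ^+ m = \sum_u Z u * (1 + eps) ^+ m)%R.
    by rewrite -mulr_suml sumZ mul1r.
  apply: ler_sum => u _.
  have -> : (\sum_v Z u * Z v * h (u, v) =
     Z u * \prod_(k < m) \sum_v z v * (if v \in E u then 2 else 1))%R.
    rewrite bigA_distr_bigA mulr_sumr; apply: eq_bigr => v _.
    by rewrite -mulrA; congr (_ * _)%R; rewrite [RHS]big_split.
  apply: ler_wpM2l; first by apply: prodr_ge0 => k _; exact: z_ge0.
  rewrite -[in leLHS](card_ord m) -prodr_const; apply: ler_prod => k _.
  rewrite addr_ge0 //=; have [eH _] := EP u.
  have -> : (\sum_v z v * (if v \in E u then 2 else 1) = 1 + \sum_(v in E u) z v)%R.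
    rewrite -[in RHS]z_sum [X in (_ + X)%R]big_mkcond -big_split /=; apply: eq_bigr => v _.
    by case: ifP => _; lra.
  by rewrite lerD2l; exact: z_heavy.
apply: le_trans low _.
(* Swaps preserve the product measure, so [h] may be averaged over all [2 ^ m] of them. *)
have avg : (2 ^+ m * (\sum_(p : sample * sample) Z p.1 * Z p.2 * h p) =
  \sum_(p : sample * sample) Z p.1 * Z p.2 * \sum_b h (sw b p))%R.
  under [RHS]eq_bigr do rewrite mulr_sumr.
  rewrite exchange_big /= [RHS](eq_bigr (fun=> \sum_p Z p.1 * Z p.2 * h p)%R).
    have cb : #|{: {ffun 'I_m -> bool}}| = 2 ^ m by rewrite card_ffun card_bool card_ord.
    rewrite sumr_const -[RHS]mulr_natl -natrX -cb; congr (_%:R * _)%R.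
  move=> b _; rewrite [RHS](reindex_inj (inv_inj (swK b))) /=.
  by apply: eq_bigr => p _; rewrite Zsw.
have p2 : (0 < 2 ^+ m :> R)%R by rewrite exprn_gt0.
have sumZZ : (\sum_(p : sample * sample) Z p.1 * Z p.2 = 1)%R.
  by rewrite -(pair_bigA _ (fun u v => Z u * Z v)%R) -big_distrlr /= sumZ mulr1.
rewrite -(ler_pM2l p2) avg -[leRHS]mul1r -[X in (X * _)%R]sumZZ mulr_suml.
apply: ler_sum => p _; apply: ler_wpM2l.
  by apply: mulr_ge0; apply: prodr_ge0 => k _; exact: z_ge0.
apply: (@le_trans _ _ (\sum_b \sum_(S in traces p) weight b S)%R).
  by apply: ler_sum => b _; exact: hsw.
rewrite exchange_big /=; apply: (@le_trans _ _ (\sum_(S in traces p) 2 ^+ m)%R).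
  by apply: ler_sum => S _; exact: sum_weight.
rewrite sumr_const -[leLHS]mulr_natr; apply: ler_wpM2l; first exact: ltW.
by rewrite ler_nat; exact: card_traces.
Qed.

End EpsNet.

(** * A theorem of the alternative *)

Local Open Scope ring_scope.

Lemma continuous_sumr (R : realType) (T : topologicalType) (I : Type) (r : seq I)
    (F : I -> T -> R) : (forall i, continuous (F i)) ->
  continuous (fun x => \sum_(i <- r) F i x).
Proof.
move=> Fc x; elim: r => [|i r IH].
  under eq_fun do rewrite big_nil.
  exact: cvg_cst.
under eq_fun do rewrite big_cons.
by apply: cvgD => //; exact: Fc.
Qed.

Definition negp (R : realType) (x : R) : R := (`|x| - x) / 2.

Lemma negp_ge0 (R : realType) (x : R) : 0 <= negp x.
Proof. by rewrite divr_ge0 // subr_ge0 ler_norm. Qed.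

(** [negp x] is the distance from [x] to the nonnegative half-line, so no nonnegative [p] is
    closer. *)
Lemma negp_sqr_le (R : realType) (x p : R) : 0 <= p -> negp x ^+ 2 <= (x - p) ^+ 2.
Proof.
rewrite /negp => p0; have [x0|x0] := ler0P x; last by rewrite subrr mul0r expr0n sqr_ge0.
nra.
Qed.

(* Among the combinations of the rows of [A] take one whose negative part has
   minimal Euclidean norm; if this part is not zero it is the vector [w]. *)
Lemma ville_alternative_ord (R : realType) n (I : finType) (A : 'I_n.+1 -> I -> R) :
  (exists z : 'I_n.+1 -> R, [/\ forall v, 0 <= z v, \sum_v z v = 1 &
      forall i, 0 <= \sum_v z v * A v i]) \/
  (exists w : I -> R, (forall i, 0 <= w i) /\ forall v, \sum_i w i * A v i < 0).
Proof.
pose S := [set M : 'rV[R]_n.+1 | (forall i, `[0, 1]%classic (M ord0 i)) /\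
                               \sum_i M ord0 i = 1]%classic.
pose k (M : 'rV[R]_n.+1) i := \sum_v M ord0 v * A v i.
pose phi (M : 'rV[R]_n.+1) : R := \sum_i negp (k M i) ^+ 2.
have coordc v : continuous (fun M : 'rV[R]_n.+1 => M ord0 v) by exact: coord_continuous.
have kc i : continuous (k ^~ i).
  apply: continuous_sumr => v M.
  by apply: continuousM; [exact: coordc | exact: cst_continuous].
have phic : continuous phi.
  have nc : continuous (fun x : R => negp x ^+ 2).
    move=> x; apply: (@continuous_comp _ _ _ (@negp R) (fun y => y ^+ 2)).
      apply: continuousM; last exact: cst_continuous.
      by apply: continuousB; [exact: norm_continuous | exact: cvg_id].
    exact: exprn_continuous.
  apply: continuous_sumr => j M.
  by apply: (@continuous_comp _ _ _ (k ^~ j) (fun x : R => negp x ^+ 2)); [exact: kc|exact: nc].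
have S0 : (S !=set0)%classic.
  exists (delta_mx ord0 ord0); split=> [i|].
    by rewrite /= mxE eqxx in_itv /=; case: (i == ord0); rewrite ?ler01 ?lexx.
  rewrite (bigD1 ord0) //= mxE !eqxx big1 ?addr0 // => i /negbTE i0.
  by rewrite mxE i0 andbF.
have Sc : compact S.
  apply: compact_closedI.
    by apply: (@rV_compact R n.+1 (fun=> `[0, 1]%classic)) => i; exact: segment_compact.
  have h : continuous (fun M : 'rV[R]_n.+1 => \sum_i M ord0 i).
    by apply: continuous_sumr.
  move/continuous_closedP: h => /(_ [set 1]%classic); apply.
  exact: closed_eq.
have [M /set_mem[M01 M1] Mmin] := compact_EVT_min S0 Sc (continuous_subspaceT phic).
pose w i := negp (k M i).
have [w0|] := boolP [forall i, w i == 0].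
  left; exists (fun v => M ord0 v); split => // [v|i].
    by have := M01 v; rewrite /= in_itv /= => /andP[].
  have /eqP := forallP w0 i; rewrite /w /negp => h.
  have : `|k M i| = k M i by lra.
  by rewrite -/(k M i) => <-.
rewrite negb_forall => /existsP[i0 wi0]; right; exists w; split=> [i|v].
  exact: negp_ge0.
have w2 : 0 < \sum_i w i ^+ 2.
  rewrite (bigD1 i0) //=; apply: ltr_wpDr; first by apply: sumr_ge0 => i _; exact: sqr_ge0.
  by rewrite exprn_even_gt0.
pose dl i := A v i - k M i.
(* First-order condition: [M] is compared with the points of the segment from [M] to the vertex [v]
   of the simplex. *)
have key t : 0 < t -> t <= 1 -> 2 * \sum_i w i * dl i <= t * \sum_i dl i ^+ 2.
  move=> t0 t1; pose N := (1 - t) *: M + t *: (delta_mx ord0 v : 'rV[R]_n.+1).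
  have NE u : N ord0 u = (1 - t) * M ord0 u + t * (u == v)%:R.
    by rewrite !mxE eqxx.
  have dsum (f : 'I_n.+1 -> R) : \sum_u (u == v)%:R * f u = f v.
    rewrite (bigD1 v) //= eqxx mul1r big1 ?addr0 // => u /negbTE ->.
    by rewrite mul0r.
  have NS : S N.
    have Ns : \sum_u N ord0 u = 1.
      under eq_bigr do rewrite NE.
      rewrite big_split /= -!mulr_sumr M1.
      have := dsum (fun=> 1); under eq_bigr do rewrite mulr1.
      by move=> ->; lra.
    have N0 u : 0 <= N ord0 u.
      have := M01 u; rewrite /= in_itv /= NE => /andP[a _].
      by apply: addr_ge0; apply: mulr_ge0 => //; lra.
    split => // u; rewrite /= in_itv /= N0 /= -Ns (bigD1 u) //=.
    by rewrite lerDl; apply: sumr_ge0.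
  have kN i : k N i = k M i + t * dl i.
    rewrite /k; under eq_bigr do rewrite NE mulrDl -!mulrA.
    by rewrite big_split /= -!mulr_sumr dsum /dl /k; lra.
  have := Mmin N (mem_set NS); rewrite /phi.
  have up : \sum_i negp (k N i) ^+ 2 <= \sum_i (w i ^+ 2 - 2 * t * (w i * dl i) + t ^+ 2 * dl i ^+ 2).
    (* The comparison point is the positive part [k M i + w i] of [k M i], at distance
       [|t * dl i - w i|] from [k N i]. *)
    apply: ler_sum => i _; have p0 : 0 <= k M i + w i.
      by rewrite /w /negp; have := ler_norm (- k M i); rewrite normrN; lra.
    apply: le_trans (negp_sqr_le _ p0) _; rewrite kN; lra.
  move=> /le_trans /(_ up); rewrite !big_split /= sumrN -!mulr_sumr.
  rewrite -/w => h; have : t * (2 * \sum_i w i * dl i) <= t * (t * \sum_i dl i ^+ 2) by lra.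
  by rewrite ler_pM2l.
have D0 : 0 <= \sum_i dl i ^+ 2 by apply: sumr_ge0 => i _; exact: sqr_ge0.
have wd : \sum_i w i * dl i <= 0.
  rewrite leNgt; apply/negP => pos; set P := \sum_i w i * dl i in pos key.
  set Q := \sum_i dl i ^+ 2 in D0 key.
  (* For this [t] one has [t Q <= P], so [key] would give [2 P <= P]. *)
  have h : 0 < P / (P + Q + 1) <= 1.
    by rewrite divr_gt0 ?ltr_pdivrMr ?ler_pdivrMr /=; lra.
  have := key (P / (P + Q + 1)); case/andP: h => h1 h2 /(_ h1 h2).
  have : P / (P + Q + 1) * Q <= P.
    by rewrite mulrAC ler_pdivrMr; nra.
  lra.
have wk : \sum_i w i * k M i = - \sum_i w i ^+ 2.
  rewrite -sumrN; apply: eq_bigr => i _; rewrite /w /negp.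
  by case: (ler0P (k M i)) => _; lra.
have : \sum_i w i * dl i = \sum_i w i * A v i - \sum_i w i * k M i.
  by rewrite -sumrB; apply: eq_bigr => i _; rewrite mulrBr.
by rewrite wk; lra.
Qed.

Lemma ville_alternative (R : realType) (V I : finType) (A : V -> I -> R) :
  (0 < #|V|)%N ->
  (exists z : V -> R, [/\ forall v, 0 <= z v, \sum_v z v = 1 &
      forall i, 0 <= \sum_v z v * A v i]) \/
  (exists w : I -> R, (forall i, 0 <= w i) /\ forall v, \sum_i w i * A v i < 0).
Proof.
move: (@enum_val V V) (@enum_rank V) (@enum_rankK V) (@enum_valK V).
move: #|V| => [//|n] ev er erK evK _.
have bij : bijective ev by exists er.
case: (ville_alternative_ord (fun v => A (ev v))) => [[z [z0 z1 zA]]|[w [w0 wA]]]; [left|right].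
  exists (fun v => z (er v)); split => [//||i].
    by rewrite (reindex ev) /=; [under eq_bigr do rewrite evK|exact: onW_bij].
  by rewrite (reindex ev) /=; [under eq_bigr do rewrite evK|exact: onW_bij].
by exists w; split => // v; have := wA (er v); under eq_bigr do rewrite erK.
Qed.

(** * Numerical estimates *)

Section ExpBounds.
Variable R : realType.
Implicit Types (a w x : R).

Lemma derive_le0_le (F F' : R -> R) a : 0 <= a ->
  (forall x, is_derive x 1 F (F' x)) -> (forall x, 0 <= x -> F' x <= 0) ->
  F a <= F 0.
Proof.
rewrite le_eqVlt => /predU1P[<- //|a0] dF F'0.
have Fc : continuous F.
  by move=> x; apply/differentiable_continuous/derivable1_diffP; have [] := dF x.
have [c] := MVT a0 (fun x _ => dF x) (continuous_subspaceT Fc).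
rewrite in_itv /= subr0 => /andP[c0 _]; have := F'0 c (ltW c0); nra.
Qed.

(** The polynomial is the cubic Taylor polynomial of [exp (- a)]; in the derivative of the product
    all terms cancel but [- exp a * a ^ 3 / 6]. *)
Lemma expR_mul_poly3_le1 a : 0 <= a ->
  expR a * (1 - a + a ^+ 2 / 2 - a ^+ 3 / 6) <= 1.
Proof.
move=> a0; pose F x := expR x * (1 - x + x ^+ 2 * 2^-1 - x ^+ 3 * 6^-1) : R.
pose F' x := expR x * (- x ^+ 3 / 6) : R.
have := @derive_le0_le F F' a a0; rewrite /F /F' expR0 !expr0n /=.
rewrite !mul0r !subr0 addr0 mulr1; apply.
  by move=> x; apply: is_derive_eq; rewrite /GRing.scale /=; field.
move=> x x0; apply: mulr_ge0_le0; first exact: expR_ge0.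
by rewrite mulNr oppr_le0 divr_ge0 // exprn_ge0.
Qed.

Lemma expR_ge_poly2 a : 0 <= a -> 1 + a + a ^+ 2 / 2 <= expR a.
Proof.
move=> a0; pose F x := expR (- x) * (1 + x + x ^+ 2 * 2^-1) : R.
pose F' x := expR (- x) * (- x ^+ 2 / 2) : R.
have := @derive_le0_le F F' a a0; rewrite /F /F' oppr0 expR0 !expr0n /=.
rewrite !mul0r !addr0 mulr1 expRN => h.
have -> : 1 + a + a ^+ 2 / 2 = expR a * ((expR a)^-1 * (1 + a + a ^+ 2 / 2)).
  by rewrite mulVKf // expR_eq0.
rewrite ler_piMr ?expR_ge0 //; apply: h.
  by move=> x; apply: is_derive_eq; rewrite /GRing.scale /=; field.
move=> x x0; apply: mulr_ge0_le0; first exact: expR_ge0.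
by rewrite mulNr oppr_le0 divr_ge0 // exprn_ge0.
Qed.

Lemma expR1_bounds : (5 / 2 : R) <= expR (1 : R) <= 11 / 4.
Proof.
apply/andP; split.
  by have := @expR_ge_poly2 1 ler01; rewrite expr1n; lra.
(* The cubic bound at 1 would only give [e <= 3]; at [1 / 4], followed by a fourth power, it is
   sharp enough. *)
have q : expR (1 / 4) <= 9 / 7 :> R.
  have := @expR_mul_poly3_le1 (1 / 4) ltac:(lra).
  have := expR_gt0 (1 / 4 : R); set y := expR _ => y0.
  have -> : (1 / 4) ^+ 2 = 1 / 16 :> R by field.
  have -> : (1 / 4) ^+ 3 = 1 / 64 :> R by field.
  nra.
have -> : (1 : R) = 4%:R * (1 / 4) by field.
rewrite expRM_natl.
have : expR (1/4) ^+ 4 <= (9 / 7) ^+ 4 :> R.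
  by rewrite lerXn2r ?nnegrE ?expR_ge0 //; lra.
move=> /le_trans; apply; lra.
Qed.

(** Equality holds at both ends 0 and 1, so two expansions are needed: [exp (- w)] to third order at
    0 below [11 / 20], and [exp (1 - w)] to second order at [w = 1] above. *)
Lemma sqr_le_expR w : 0 <= w <= 1 -> w ^+ 2 <= expR 1 * (w - 1 + expR (- w)).
Proof.
case/andP=> w0 w1; have /andP[e1 e2] := expR1_bounds.
have [w7|w7] := lerP w (11 / 20).
  have h : 1 - w + w ^+ 2 / 2 - w ^+ 3 / 6 <= expR (- w).
    have := expR_mul_poly3_le1 w0; have := expR_gt0 w; rewrite expRN => ew.
    by rewrite mulrC -ler_pdivlMr // div1r.
  apply: (@le_trans _ _ (expR 1 * (w ^+ 2 * (1 / 2 - w / 6)))); last first.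
    by rewrite ler_pM2l ?expR_gt0 //; nra.
  have : 0 <= w ^+ 2 by exact: sqr_ge0.
  have : 1 <= expR 1 * (1 / 2 - w / 6) by nra.
  nra.
have h : 1 + (1 - w) + (1 - w) ^+ 2 / 2 <= expR 1 * expR (- w).
  by rewrite -expRD; apply: expR_ge_poly2; lra.
nra.
Qed.

(* By the binomial theorem the sum is at most [(N/D)^D (1 + D/N)^N]. *)
Lemma sum_bin_le (N D : nat) : (0 < D)%N -> (D <= N)%N ->
  (\sum_(i < D.+1) 'C(N, i))%:R <= (expR 1 * N%:R / D%:R) ^+ D :> R.
Proof.
move=> D0 DN; have N0 : (0 < N)%N by exact: leq_trans DN.
have D0r : 0 < D%:R :> R by rewrite ltr0n.
have N0r : 0 < N%:R :> R by rewrite ltr0n.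
have r1 : 1 <= N%:R / D%:R :> R by rewrite ler_pdivlMr // mul1r ler_nat.
rewrite natr_sum; apply: (@le_trans _ _ ((N%:R / D%:R) ^+ D * (1 + D%:R / N%:R) ^+ N)).
  rewrite exprDn mulr_sumr.
  apply: (@le_trans _ _ (\sum_(i < D.+1) (N%:R / D%:R) ^+ D *
             (1 ^+ (N - i) * (D%:R / N%:R) ^+ i *+ 'C(N, i)))); last first.
    rewrite -!(big_mkord xpredT (fun i => (N%:R / D%:R) ^+ D *
             (1 ^+ (N - i) * (D%:R / N%:R) ^+ i *+ 'C(N, i)))).
    rewrite [leRHS](big_cat_nat _ (n := D.+1)) //= lerDl.
    apply: sumr_ge0 => i _; rewrite expr1n mul1r; apply: mulr_ge0.
      by rewrite exprn_ge0 // divr_ge0 ?ler0n.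
    by rewrite mulrn_wge0 // exprn_ge0 // divr_ge0 ?ler0n.
  apply: ler_sum => i _; rewrite expr1n mul1r mulrnAr -[leRHS]mulr_natr ler_peMl ?ler0n //.
  have iD : (i <= D)%N by rewrite -ltnS.
  have -> : (N%:R / D%:R) ^+ D = (N%:R / D%:R) ^+ (D - i) * (N%:R / D%:R) ^+ i :> R.
    by rewrite -exprD subnK.
  have e1 : N%:R / D%:R * (D%:R / N%:R) = 1 :> R by field; rewrite !gt_eqF.
  by rewrite -mulrA -exprMn e1 expr1n mulr1 exprn_ege1.
rewrite -[expR 1 * _ / _]mulrA [leRHS]exprMn mulrC ler_wpM2r ?exprn_ge0 ?divr_ge0 //.
rewrite -expRM_natl mulr1 [X in expR X](_ : D%:R = N%:R * (D%:R / N%:R)); last first.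
  by rewrite mulrCA divff ?mulr1 // gt_eqF.
rewrite expRM_natl lerXn2r ?nnegrE ?expR_ge0 //; last exact: expR_ge1Dx.
Qed.

(** With [m] the integer part of [2 D x ln (11 x)], this contradicts the double sampling inequality.
    For [L = ln (11 x)], the binomial sum is at most [(4 e x L) ^ D], while
    [1 + 1 / x >= exp (4 / (5 x))] makes [(1 + 1 / x) ^ m.+1] exceed [exp (8 L / 5) ^ D]. *)
Lemma net_size_bound (x : R) (D m : nat) : expR 1 <= x -> (0 < D)%N ->
  2 * D%:R * x * ln (11 * x) < m.+1%:R -> m%:R <= 2 * D%:R * x * ln (11 * x) ->
  (\sum_(i < D.+1) 'C(m * 2, i))%:R < (1 + x^-1) ^+ m.
Proof.
move=> ex D0 m1 m2; have /andP[e1 e2] := expR1_bounds.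
set L := ln (11 * x) in m1 m2.
have x52 : 5 / 2 <= x by lra.
have x0 : 0 < x by lra.
have eL : expR L = 11 * x by rewrite lnK // posrE; lra.
have L1 : 1 <= L by rewrite -ler_expR eL; lra.
have D1 : 1 <= D%:R :> R by rewrite ler1n.
have Dm : (D <= m * 2)%N.
  rewrite -(ler_nat R) natrM; move: m1; rewrite -natr1 => m1.
  have h : D%:R * 5 <= 2 * D%:R * x :> R by nra.
  have : D%:R * 5 <= 2 * D%:R * x * L :> R.
    by apply: le_trans h _; rewrite ler_peMr //; nra.
  by lra.
pose u := x^-1; have xu : x * u = 1 by rewrite mulfV // gt_eqF.
have u0 : 0 < u by rewrite invr_gt0.
have u1 : u <= 2 / 5 by nra.
have key : expR (4 / 5 * u) <= 1 + u.
  have := @expR_mul_poly3_le1 (4 / 5 * u) ltac:(nra).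
  set y := expR _; have y0 : 0 < y by exact: expR_gt0.
  set p := (1 - _ + _ - _) => yp.
  have p1 : 1 <= (1 + u) * p.
    have -> : (1 + u) * p = 1 + u * (1 / 5 - 12 / 25 * u + 88 / 375 * u ^+ 2 - 32 / 375 * u ^+ 3) by rewrite /p; field.
    have h : 0 <= 88 / 375 * u ^+ 2 - 32 / 375 * u ^+ 3 by nra.
    nra.
  have p0 : 0 < p by nra.
  by nra.
rewrite -/u -(ltr_pM2r (_ : 0 < 1 + u)) -?exprSr; last by lra.
apply: (@le_lt_trans _ _ ((expR (8 / 5 * L)) ^+ D)); last first.
  rewrite -expRM_natl; apply: (@lt_le_trans _ _ (expR (m.+1%:R * (4 / 5 * u)))).
    rewrite ltr_expR.
    have -> : D%:R * (8 / 5 * L) = (2 * D%:R * x * L) * (4 / 5 * u).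
      have -> : (2 * D%:R * x * L) * (4 / 5 * u) = D%:R * (8 / 5 * L) * (x * u) by field.
      by rewrite xu mulr1.
    by rewrite ltr_pM2r //; lra.
  by rewrite expRM_natl lerXn2r ?nnegrE ?expR_ge0 //; lra.
(* The factor [1 + u <= 7 / 5] pays for having [m.+1] instead of [m] in the exponent. *)
apply: (@le_trans _ _ ((expR 1 * (m * 2)%:R / D%:R) ^+ D * (7 / 5) ^+ D)).
  apply: ler_pM; [exact: ler0n|by lra|exact: sum_bin_le|].
  by apply: (@le_trans _ _ (7 / 5)); [lra|rewrite -[leLHS]expr1 ler_weXn2l //; lra].
rewrite -exprMn lerXn2r ?nnegrE ?expR_ge0 //.
have h : expR 1 * (m * 2)%:R / D%:R <= 4 * expR 1 * x * L.
  rewrite ler_pdivrMr ?natrM; last by lra.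
  have : expR 1 * m%:R <= expR 1 * (2 * D%:R * x * L) by rewrite ler_pM2l ?expR_gt0.
  by lra.
apply: (@le_trans _ _ (4 * expR 1 * x * L * (7 / 5))); first by rewrite ler_pM2r //; lra.
have -> : 8 / 5 * L = L + (1 + (3 / 5 * L - 1)) by field.
rewrite !expRD eL.
have h2 : 3 / 5 * L <= expR (3 / 5 * L - 1) by have := expR_ge1Dx (3 / 5 * L - 1); lra.
(* Here the constant 11 is used: [11 * 3 / 5] has to be at least [4 * 7 / 5]. *)
have h3 : 11 * x * (expR 1 * (3 / 5 * L)) <= 11 * x * (expR 1 * expR (3 / 5 * L - 1)).
  by rewrite ler_pM2l ?ler_pM2l ?expR_gt0 //; lra.
rewrite -[expR (3 / 5 * L) * _]expRD; apply: le_trans _ h3.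
have : 0 <= expR 1 * x * L by rewrite !mulr_ge0 ?expR_ge0 //; lra.
by lra.
Qed.

End ExpBounds.

(** * Fractional packings of balls *)

Local Open Scope nat_scope.

Definition arcs (G : graph) : {set G * G} := [set p | adj p.1 p.2].

Lemma card_arcs (G : graph) : #|arcs G| = 2 * #|edges G|.
Proof.
rewrite mulnC -sum_nat_const -sum1_card.
rewrite (partition_big (fun p : G * G => [set p.1; p.2]) (mem (edges G))) /=; last first.
  move=> [u v]; rewrite inE /= => uv; rewrite inE; apply/existsP; exists u.
  by apply/existsP; exists v; rewrite uv eqxx.
apply: eq_bigr => e; rewrite inE => /existsP[u /existsP[v /andP[uv /eqP ->]]].
have nuv : u != v by apply/eqP=> e'; move: uv; rewrite e' adj_irrefl.
rewrite sum1_card -(_ : #|[set (u, v); (v, u)]| = 2); last first.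
  by rewrite cards2 xpair_eqE negb_and nuv.
apply: eq_card => -[x y]; rewrite !inE /=; apply/andP/orP.
  case=> xy /eqP/setP e'; have nxy : x != y by apply/eqP=> e0; move: xy; rewrite e0 inE adj_irrefl.
  have := e' x; have := e' y; rewrite !inE !eqxx /= orbT !xpair_eqE.
  move/esym/orP=> [] /eqP yE /esym/orP[] /eqP xE; rewrite xE yE ?eqxx in nxy *; auto.
case=> /eqP[-> ->]; rewrite inE /= ?uv ?eqxx //; split; first by rewrite adj_sym.
by rewrite finset.setUC.
Qed.

Lemma arcs_avg_degree (R : realType) (G : graph) (d : R) :
  (avg_degree R G <= d)%R -> ((#|arcs G|)%:R <= d * #|G|%:R)%R.
Proof.
rewrite /avg_degree card_arcs natrM => h; have [G0|G0] := posnP #|G|; last first.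
  by rewrite -ler_pdivrMr // ltr0n.
suff -> : #|edges G| = 0 by rewrite G0 !mulr0.
apply: eq_card0 => e; rewrite !inE; apply/negbTE/negP=> /existsP[u _].
by have := card_graph_gt0 u; rewrite G0.
Qed.

(** * A weighted Turan theorem *)

Section WeightedTuran.
Variables (R : realFieldType) (I : finType) (E : rel I) (w : I -> R).
Hypotheses (Esym : symmetric E) (Erefl : reflexive E) (w_ge0 : forall i, (0 <= w i)%R).

(* Greedy: take the vertex [i] of smallest weighted degree [s], discard its
   neighbours; they contribute at least [s ^ 2] to the right-hand sum. *)
Lemma weighted_turan (A : {set I}) : exists J : {set I},
  [/\ J \subset A, {in J &, forall i j, i != j -> ~~ E i j} &
  ((\sum_(i in A) w i) ^+ 2 <=
     #|J|%:R * \sum_(i in A) \sum_(j in A | E i j) w i * w j)%R].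
Proof.
elim: {A}_.+1 {-2}A (ltnSn #|A|) => // n IH A; rewrite ltnS => An.
have [->|/set0Pn[i0 i0A]] := eqVneq A set0.
  exists set0; rewrite sub0set; split => //; first by move=> i j; rewrite inE.
  by rewrite !big_set0 expr0n mulr0.
pose s i := (\sum_(j in A | E i j) w j)%R.
have [i iA imin] : exists2 i, i \in A & forall j, j \in A -> (s i <= s j)%R.
  by case: (@Order.TotalTheory.arg_minP _ R I i0 (mem A) s i0A) => i iA h; exists i.
pose A' := [set j in A | ~~ E i j].
have A'A : A' \subset A by apply/subsetP=> j; rewrite inE => /andP[].
have A'n : #|A'| < n.
  apply: leq_trans An; apply: proper_card; apply/properP; split => //.
  by exists i; rewrite // inE Erefl andbF.
have [J [JA' Jind JW]] := IH A' A'n.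
have iJ : i \notin J by apply/negP=> /(subsetP JA'); rewrite inE Erefl andbF.
exists (i |: J); split.
- by apply/subsetP=> j; rewrite !inE => /predU1P[->//|/(subsetP JA')/(subsetP A'A)].
- move=> j k; rewrite !inE => /predU1P[->|jJ] /predU1P[->|kJ]; rewrite ?eqxx //.
  + by have := subsetP JA' k kJ; rewrite inE => /andP[].
  + by have := subsetP JA' j jJ; rewrite inE Esym => /andP[].
  + exact: Jind.
rewrite cardsU1 iJ natrD.
have split_sum (f : I -> R) : (\sum_(j in A) f j =
    \sum_(j in A | E i j) f j + \sum_(j in A') f j)%R.
  rewrite (bigID (E i)) /=; congr (_ + _)%R; apply: eq_bigl => j.
  by rewrite [in RHS]inE.
rewrite split_sum -/(s i) (split_sum (fun k => _)).
set W' := (\sum_(j in A') w j)%R in JW *.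
set Q' := (\sum_(k in A') _)%R in JW.
have Q1 : (s i ^+ 2 <= \sum_(k in A | E i k) \sum_(j in A | E k j) w k * w j)%R.
  rewrite expr2 {1}/s mulr_suml; apply: ler_sum => k /andP[kA _].
  by rewrite -mulr_sumr; apply: ler_wpM2l; [exact: w_ge0|exact: imin].
have Q2 : (Q' <= \sum_(k in A') \sum_(j in A | E k j) w k * w j)%R.
  apply: ler_sum => k kA'; rewrite [leRHS](bigID (mem A')) /=.
  rewrite [X in (_ <= X + _)%R](eq_bigl (fun j => (j \in A') && E k j)); last first.
    move=> j /=; case jA' : (j \in A'); rewrite ?andbF //= andbT.
    by rewrite (subsetP A'A).
  by rewrite lerDl; apply: sumr_ge0 => j _; apply: mulr_ge0.
have Q'0 : (0 <= Q')%R.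
  by apply: sumr_ge0 => k _; apply: sumr_ge0 => j _; apply: mulr_ge0.
have s0 : (0 <= s i)%R by apply: sumr_ge0.
have W0 : (0 <= W')%R by apply: sumr_ge0.
apply: (@le_trans _ _ ((1 + #|J|%:R) * (s i ^+ 2 + Q'))%R); last first.
  by apply: ler_wpM2l; [rewrite addr_ge0|exact: lerD].
have [J0|Jpos] := posnP #|J|.
  by move: JW; rewrite J0 !mul0r => JW; nra.
have J1 : (1 <= #|J|%:R :> R)%R by rewrite ler1n.
move: JW J1; set a := (#|J|%:R : R)%R => JW J1.
(* From [(a s - W') ^ 2 >= 0] and [W' ^ 2 <= a Q'] follows [2 s W' <= a s ^ 2 + Q'], which turns
   [(s + W') ^ 2] into [(1 + a) (s ^ 2 + Q')]. *)
have h : (a * (2 * s i * W') <= a * (a * s i ^+ 2 + Q'))%R.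
  have := sqr_ge0 (a * s i - W')%R; nra.
rewrite ler_pM2l in h; last by lra.
nra.
Qed.

End WeightedTuran.

(** * Contact graphs of incomparable balls *)

Section Contact.
Variables (G : graph) (H : {set {set G}}).
Hypothesis Hball : ball_hypergraph H.
Hypothesis Hanti : {in H &, forall e f : {set G}, e \subset f -> e = f}.

Definition contact (S : {set {set G}}) (a b : {set G}) :=
  (a != b) && [exists x in a :&: b,
    [forall k in S, (x \in k) ==> (k == a) || (k == b)]].

Lemma contact_sym S : symmetric (contact S).
Proof.
move=> a b; rewrite /contact eq_sym finset.setIC; congr (_ && _).
apply: eq_existsb => x; congr (_ && _); apply: eq_forallb => k.
by rewrite [(k == a) || _]orbC.
Qed.

Section ContactGraph.
Variable S : {set {set G}}.

Definition contact_adj : rel {e : {set G} | e \in S} :=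
  fun a b => contact S (val a) (val b).

Lemma contact_adj_sym : symmetric contact_adj.
Proof. by move=> a b; exact: contact_sym. Qed.

Lemma contact_adj_irrefl : irreflexive contact_adj.
Proof. by move=> a; rewrite /contact_adj /contact eqxx. Qed.

Definition contact_graph : graph := Graph contact_adj_sym contact_adj_irrefl.

(** A ball of radius [r] gets the additive weight [#|G| - r], so that it consists of the points at
    weighted distance at most [#|G|] from its centre. All balls then correspond to one common level.
    If a centre were not strictly inside its own cell, one ball would contain another. *)
Lemma contact_graph_minor : S \subset H -> is_minor contact_graph G.
Proof.
move=> /subsetP SH.
have /boolp.choice[c cP] : forall a : contact_graph, exists p : G * nat,
    val a = gball p.2 p.1.
  by move=> a; have [r [v av]] := Hball (SH _ (valP a)); exists (v, r).
pose r (a : contact_graph) := minn (c a).2 #|G|.-1.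
have memr (a : contact_graph) (u : G) : (u \in val a) = (dist u (c a).1 <= r a) by rewrite cP mem_gball.
have rG a : r a < #|G| by have := card_graph_gt0 (c a).1; rewrite /r; lia.
apply: (@vorcontact_minor G contact_graph (fun a => (c a).1)
  (fun a => #|G| - r a) _ contact_graph id) => //.
  move=> i k ik; rewrite ltnNge; apply/negP=> h; case/eqP: ik.
  apply: val_inj; apply: Hanti; try exact: SH (valP _).
  apply/subsetP=> u; rewrite !memr => ui.
  by have := dist_triangle u (c i).1 (c k).1; have := rG i; have := rG k; lia.
move=> a b /andP[ab /existsP[x /andP[xab /forallP xk]]]; split => //.
move: xab; rewrite inE !memr => /andP[xa xb].
exists x, #|G|; rewrite /vordist; have := rG a; have := rG b; split; try lia.
move=> k ka kb; have := xk (val k).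
rewrite (valP k) memr !(inj_eq val_inj) (negbTE ka) (negbTE kb) /= implybF.
by have := rG k; lia.
Qed.

Lemma card_contact_arcs :
  #|arcs contact_graph| = \sum_(a in S) \sum_(b in S) contact S a b.
Proof.
rewrite (big_sub (mem S)) /=.
under eq_bigr do rewrite (big_sub (mem S)) /=.
rewrite pair_bigA /= -sum1_card big_mkcond /=.
by apply: eq_bigr => -[a b] _; rewrite inE.
Qed.
End ContactGraph.

Section FractionalPacking.
Local Open Scope ring_scope.
Variables (R : realType) (d : R) (w : {set G} -> R).
Hypothesis d_ge1 : 1 <= d.
Hypothesis minor_deg : forall M : graph, is_minor M G -> avg_degree R M <= d.
Hypothesis w_ge0 : forall e, 0 <= w e.
Hypothesis load_le1 : forall x, \sum_(e in H | x \in e) w e <= 1.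

Let q (e : {set G}) : R := if e \in H then 1 - expR (- w e) else 0.
Local Notation sample := {ffun {set G} -> bool}.
Let p (e : {set G}) (c : bool) : R := if c then q e else 1 - q e.
Let P (b : sample) : R := \prod_e p e (b e).
Let S (b : sample) : {set {set G}} := [set e in H | b e].

Let p_ge0 e c : 0 <= p e c.
Proof.
rewrite /p /q; case: ifP => _; case: ifP => _; rewrite ?subr0 ?ler01 ?opprB ?subrr //.
  by rewrite subr_ge0 -[leRHS]expR0 ler_expR oppr_le0.
Qed.

Let sum_p e : p e true + p e false = 1.
Proof. by rewrite /p addrC subrK. Qed.

Let sum_sample (F : {set G} -> bool -> R) :
  \sum_(b : sample) \prod_e F e (b e) = \prod_e (F e true + F e false).
Proof. by rewrite -bigA_distr_bigA /=; apply: eq_bigr => e _; rewrite big_bool. Qed.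

Let mean_size : \sum_b P b * #|S b|%:R = \sum_(e in H) q e.
Proof.
have -> : \sum_b P b * #|S b|%:R = \sum_b \sum_(e in H) P b * (b e)%:R.
  apply: eq_bigr => b _; rewrite -mulr_sumr -natr_sum -sum1_card; congr (_ * _%:R).
  rewrite big_mkcond [RHS]big_mkcond /=; apply: eq_bigr => e _.
  by rewrite inE; case: (e \in H); case: (b e).
rewrite exchange_big; apply: eq_bigr => e eH /=.
pose F e' (c : bool) := p e' c * (if e' == e then c%:R else 1).
rewrite (eq_bigr (fun b : sample => \prod_e' F e' (b e'))); last first.
  move=> b _; rewrite /F big_split /=; congr (_ * _).
  by rewrite (bigD1 e) //= eqxx big1 ?mulr1 // => e' /negbTE ->.
rewrite sum_sample (bigD1 e) //= /F eqxx !mulr1 mulr0 addr0 big1 ?mulr1 //.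
by move=> e' /negbTE ->; rewrite !mulr1 sum_p.
Qed.

(* The probability that [a] and [b] are sampled and that no other sampled edge
   contains [x]. *)
Let contact_prob a b : a \in H -> b \in H -> a != b -> a :&: b != set0 ->
  w a * w b <= expR 1 * \sum_s P s * [&& a \in S s, b \in S s & contact (S s) a b]%:R.
Proof.
move=> aH bH ab /set0Pn[x xab].
(* The event is a product of conditions on single edges, so its probability factors. *)
pose phi e (c : bool) : R :=
  if (e == a) || (e == b) then c%:R else if (e \in H) && (x \in e) then (~~ c)%:R else 1.
have phi_ge0 e c : 0 <= phi e c by rewrite /phi; case: ifP => _; [|case: ifP => _]; rewrite ?ler0n ?ler01.
have phi_le1 e c : phi e c <= 1.
  by rewrite /phi; case: ifP => _; [|case: ifP => _]; case: c; rewrite /= ?ler01 ?lexx.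
have low : \sum_(s : sample) \prod_e (p e (s e) * phi e (s e)) <=
    \sum_s P s * [&& a \in S s, b \in S s & contact (S s) a b]%:R.
  apply: ler_sum => s _; rewrite big_split /=; apply: ler_wpM2l.
    by apply: prodr_ge0 => e _; exact: p_ge0.
  case: (boolP [&& a \in S s, b \in S s & contact (S s) a b]) => [_|].
    by apply: prodr_ile1 => e _; rewrite phi_ge0 phi_le1.
  rewrite !inE aH bH /= /contact ab /= => h.
  suff [e e0] : exists e, phi e (s e) = 0 by rewrite (bigD1 e) //= e0 mul0r.
  move: h; rewrite !negb_and => /or3P[sa|sb|].
  - by exists a; rewrite /phi eqxx (negbTE sa).
  - by exists b; rewrite /phi eqxx orbT (negbTE sb).
  rewrite negb_exists => /forallP /(_ x); rewrite xab /= negb_forall.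
  move=> /existsP[k]; rewrite !negb_imply inE => /and3P[/andP[kH sk] xk kab].
  by exists k; rewrite /phi (negbTE kab) kH xk sk.
rewrite [leRHS]mulrC -ler_pdivrMr ?expR_gt0 //; apply: le_trans low.
rewrite (sum_sample (fun e c => p e c * phi e c)) (bigD1 a) //= (bigD1 b) /=; last by rewrite eq_sym.
rewrite /phi !eqxx orbT /= !mulr1 !mulr0 !addr0.
rewrite (eq_bigr (fun e => expR (if (e \in H) && (x \in e) then - w e else 0))); last first.
  move=> e /andP[/negbTE -> /negbTE ->] /=; case: ifP => [/andP[eH _]|_].
    by rewrite mulr0 add0r mulr1 /p /q eH opprB addrC subrK.
  by rewrite !mulr1 sum_p expR0.
rewrite -expR_sum -big_mkcondr /= sumrN /p /q aH bH.
set W := \sum_(_ | _) _.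
(* The other edges through [x] are all absent with probability [exp (- W)], and the load bound at
   [x] gives [W <= 1 - w a - w b]. *)
have WE : w a + w b + W <= 1.
  apply: le_trans (load_le1 x); move: xab; rewrite inE => /andP[xa xb].
  rewrite (bigD1 a) /= ?aH // (bigD1 b) /= ?bH ?xb 1?eq_sym //= addrA lerD2l.
  rewrite le_eqVlt; apply/orP; left; apply/eqP; apply: eq_bigl => e.
  by case: (e == a); case: (e == b); rewrite ?andbF ?andbT.
have expW : expR (w a + w b - 1) <= expR (- W) by rewrite ler_expR; lra.
apply: (@le_trans _ _ ((1 - expR (- w a)) * ((1 - expR (- w b)) * expR (w a + w b - 1)))); last first.
  do 2 (apply: ler_wpM2l; first by rewrite subr_ge0 -[leRHS]expR0 ler_expR oppr_le0).
  exact: expW.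
rewrite !expRD [expR (- 1)]expRN !expRN.
have ea := expR_ge1Dx (w a); have eb := expR_ge1Dx (w b).
have -> : (1 - (expR (w a))^-1) * ((1 - (expR (w b))^-1) * (expR (w a) * expR (w b) / expR 1))
  = (expR (w a) - 1) * (expR (w b) - 1) / expR 1.
  by field; rewrite !expR_eq0.
rewrite ler_pM2r ?invr_gt0 ?expR_gt0 //.
by apply: ler_pM; rewrite ?w_ge0 //; lra.
Qed.

(** Summing [contact_prob] over pairs bounds the left side by [e] times the mean number of arcs of
    the contact graph. That number is at most [d] times the number of sampled edges, for every
    sample. *)
Let contact_weight :
  \sum_(a in H) \sum_(b in H | (a != b) && (a :&: b != set0)) w a * w b <=
    expR 1 * (d * \sum_(e in H) q e).
Proof.
apply: (@le_trans _ _ (\sum_(a in H) \sum_(b in H) expR 1 *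
    \sum_s P s * [&& a \in S s, b \in S s & contact (S s) a b]%:R)).
  apply: ler_sum => a aH; rewrite big_mkcondr /=; apply: ler_sum => b bH.
  case: ifP => [/andP[ab abI]|_]; first exact: contact_prob.
  rewrite mulr_ge0 ?expR_ge0 // sumr_ge0 // => s _; rewrite mulr_ge0 ?ler0n //.
  by apply: prodr_ge0 => e _; exact: p_ge0.
under eq_bigr do rewrite -mulr_sumr exchange_big /=.
rewrite -mulr_sumr exchange_big /=; apply: ler_wpM2l; first exact: expR_ge0.
rewrite -mean_size mulr_sumr; apply: ler_sum => s _.
under eq_bigr do rewrite -mulr_sumr.
rewrite -mulr_sumr mulrCA; apply: ler_wpM2l.
  by apply: prodr_ge0 => e _; exact: p_ge0.
have SH : S s \subset H by apply/subsetP=> e; rewrite inE => /andP[].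
have := arcs_avg_degree (minor_deg (contact_graph_minor SH)).
rewrite card_contact_arcs card_sig; apply: le_trans.
rewrite natr_sum [leRHS]big_mkcond [leLHS]big_mkcond /=; apply: ler_sum => a _.
case: (boolP (a \in S s)) => aS; last first.
  by case: ifP => // _; rewrite big1.
rewrite (subsetP SH a aS) natr_sum [leRHS]big_mkcond [leLHS]big_mkcond /=; apply: ler_sum => b _.
case: (boolP (b \in S s)) => bS; last by case: ifP.
by rewrite (subsetP SH b bS).
Qed.

(** The Turan sum splits into its diagonal and [contact_weight]. By [sqr_le_expR] and [1 <= d], the
    diagonal term [w e ^ 2] is at most [e d (w e - q e)], so together they stay below [e d] times
    the total weight. *)
Lemma fractional_packing : (forall e, e \in H -> e != set0) ->
  \sum_(e in H) w e <= expR 1 * d * (nu H)%:R.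
Proof.
move=> He; have d1 := d_ge1; pose E (a b : {set G}) := (a == b) || (a :&: b != set0).
have Esym : symmetric E by move=> a b; rewrite /E eq_sym finset.setIC.
have Erefl : reflexive E by move=> a; rewrite /E eqxx.
have [J [JH Jind JW]] := weighted_turan Esym Erefl w_ge0 H.
have Jnu : (#|J| <= nu H)%N.
  apply: (@leq_bigmax_cond _ (matching H) (fun M : {set {set G}} => #|M|) J).
  rewrite /matching JH; apply/trivIsetP=> a b aJ bJ ab.
  by have := Jind a b aJ bJ ab; rewrite /E negb_or negbK -setI_eq0 => /andP[].
have wle1 e : e \in H -> w e <= 1.
  move=> eH; have /set0Pn[x xe] := He e eH; apply: le_trans (load_le1 x).
  by rewrite (bigD1 e) /= ?eH ?xe // lerDl; apply: sumr_ge0.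
have Q : \sum_(a in H) \sum_(b in H | E a b) w a * w b <= expR 1 * d * \sum_(e in H) w e.
  have -> : \sum_(a in H) \sum_(b in H | E a b) w a * w b = \sum_(a in H) w a ^+ 2 +
      \sum_(a in H) \sum_(b in H | (a != b) && (a :&: b != set0)) w a * w b.
    rewrite -big_split; apply: eq_bigr => a aH /=.
    rewrite (bigD1 a) ?aH ?Erefl //= expr2; congr (_ + _); apply: eq_bigl => b.
    by rewrite /E [b == a]eq_sym; case: (a == b); rewrite ?andbT ?andbF.
  apply: (@le_trans _ _ (\sum_(a in H) w a ^+ 2 + expR 1 * (d * \sum_(e in H) q e))).
    by rewrite lerD2l; exact: contact_weight.
  rewrite !mulr_sumr -big_split; apply: ler_sum => e eH; rewrite /q eH /=.
  have := @sqr_le_expR R (w e); rewrite w_ge0 wle1 // => /(_ isT).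
  have := expR_ge1Dx (- w e); have := expR_gt0 (1 : R).
  set x := expR 1; set y := expR _ => x0 y1 h.
  have : 0 <= x * (d - 1) * (w e - 1 + y).
    by rewrite !mulr_ge0 ?subr_ge0 ?(ltW x0) //; lra.
  nra.
set W := \sum_(e in H) w e in JW Q *.
have W0 : 0 <= W by apply: sumr_ge0.
have [->|Wn0] := eqVneq W 0.
  by rewrite !mulr_ge0 ?expR_ge0 //; lra.
have Wp : 0 < W by rewrite lt_neqAle eq_sym Wn0.
rewrite -(ler_pM2r Wp) -expr2; apply: le_trans JW _.
apply: (@le_trans _ _ ((nu H)%:R * (expR 1 * d * W))); last by lra.
apply: ler_pM; rewrite ?ler0n ?ler_nat //.
by apply: sumr_ge0 => a _; apply: sumr_ge0 => b _; apply: mulr_ge0.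
Qed.

End FractionalPacking.
End Contact.

(** * Transversals of ball hypergraphs *)

(** Take unweighted cells around the points of [X]. A ball whose trace on [X] is [{x, y}] has a
    centre that is within its radius of [x] and [y] and of no other point of [X], so these two cells
    are in contact. *)
Lemma ball_shatter_minor (G : graph) (H : {set {set G}}) (X : {set G}) t :
  ball_hypergraph H -> shatters H X -> t <= #|X| -> is_minor (complete_graph t) G.
Proof.
move=> Hball /shattersP XH tX.
pose phi (i : 'I_t) : {x : G | x \in X} :=
  Sub (enum_val (widen_ord tX i)) (enum_valP (widen_ord tX i)).
have phiI : injective phi.
  by move=> i j /(congr1 val) /enum_val_inj /(congr1 val) /= /ord_inj.
apply: (@vorcontact_minor G _ (fun x : {x : G | x \in X} => val x) (fun=> 0) _
   (complete_graph t) phi phiI).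
  move=> i k ik; rewrite addn0 lt0n; apply: contra ik => /eqP/dist_eq0 e.
  by apply/eqP/val_inj.
move=> i j /= ij; split; first by rewrite (inj_eq phiI).
have YX : [set val (phi i); val (phi j)] \subset X.
  by apply/subsetP=> x; rewrite !inE => /orP[] /eqP ->; exact: valP.
have [e eH eX] := XH _ YX; have [r [v ev]] := Hball e eH.
have mem_e x : x \in X -> (x \in e) = (x == val (phi i)) || (x == val (phi j)).
  by move=> xX; move/setP/(_ x): eX; rewrite !inE xX.
have G0 := card_graph_gt0 v.
exists v, (minn r #|G|.-1); rewrite /vordist.
have near x : x \in e -> dist v x <= minn r #|G|.-1 by rewrite ev mem_gball dist_sym.
have ie := near (val (phi i)); have je := near (val (phi j)).
rewrite mem_e ?(valP (phi i)) // eqxx in ie; rewrite mem_e ?(valP (phi j)) // eqxx orbT in je.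
have rG : minn r #|G|.-1 < #|G| by lia.
split; rewrite ?addn0; [exact: ie|exact: je|exact: leq_ltn_trans (ie isT) rG|
  exact: leq_ltn_trans (je isT) rG|].
move=> k ki kj; have := mem_e (val k) (valP k).
rewrite ev mem_gball !(inj_eq val_inj) (negbTE ki) (negbTE kj) dist_sym /=; lia.
Qed.

Lemma tau_le (V : finType) (H : {set {set V}}) (T : {set V}) :
  meets_all H finset.setT -> meets_all H T -> tau H <= #|T|.
Proof. by move=> H1 HT; rewrite /tau; case: arg_minnP => //= S _; exact. Qed.

Lemma ball_neq0 (G : graph) (H : {set {set G}}) : ball_hypergraph H ->
  forall e, e \in H -> e != set0.
Proof.
move=> Hb e /Hb[r [v ->]]; apply/set0Pn; exists v.
by rewrite mem_gball distxx.
Qed.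

Lemma meets_allT (G : graph) (H : {set {set G}}) : ball_hypergraph H ->
  meets_all H finset.setT.
Proof.
by move=> Hb; apply/forall_inP=> e /(ball_neq0 Hb); rewrite finset.setTI.
Qed.

(** Excludes [t = 0] and [t = 1] as soon as there is a vertex, so the dimension bound [t - 1] is
    positive. *)
Lemma K1_minor (G : graph) (v : G) t : t <= 1 -> is_minor (complete_graph t) G.
Proof.
move=> t1; exists (fun=> [set v]); split.
- by move=> _; apply/set0Pn; exists v; rewrite inE.
- by move=> _ a b; rewrite !inE => /eqP -> /eqP ->; exact: connect0.
- by move=> [i i1] [j j1] /eqP[]; apply: val_inj => /=; lia.
- by move=> [i i1] [j j1] /eqP[]; apply: val_inj => /=; lia.
Qed.

Lemma nuS (V : finType) (H H' : {set {set V}}) : H \subset H' -> nu H <= nu H'.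
Proof.
move=> HH'; apply/bigmax_leqP=> M /andP[MH tM].
apply: (@leq_bigmax_cond _ (matching H') (fun M : {set {set V}} => #|M|) M).
by rewrite /matching (fintype.subset_trans MH HH').
Qed.

Lemma nu_gt0 (V : finType) (H : {set {set V}}) e : e \in H -> 0 < nu H.
Proof.
move=> eH; have := @leq_bigmax_cond _ (matching H) (fun M : {set {set V}} => #|M|) [set e].
rewrite cards1; apply; rewrite /matching sub1set eH.
by apply/trivIsetP=> a b; rewrite !inE => /eqP -> /eqP ->; rewrite eqxx.
Qed.

Lemma tau_no_edge (V : finType) (H : {set {set V}}) : H = set0 -> tau H = 0.
Proof.
move=> H0; have HA T : meets_all H T by apply/forall_inP=> e; rewrite H0 inE.
by have := tau_le (HA _) (HA set0); rewrite cards0; lia.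
Qed.

Lemma exists_minimal_edge (V : finType) (H : {set {set V}}) e : e \in H ->
  exists2 f, f \in [set f in H | [forall g in H, (g \subset f) ==> (g == f)]] & f \subset e.
Proof.
elim: {e}_.+1 {-2}e (ltnSn #|e|) => // n IH e; rewrite ltnS => en eH.
case: (boolP [forall g in H, (g \subset e) ==> (g == e)]) => [h|].
  by exists e; rewrite // inE eH.
rewrite negb_forall => /existsP[g]; rewrite !negb_imply => /and3P[gH ge gne].
have [f fH fg] : exists2 f, f \in [set f in H | [forall g in H, (g \subset f) ==> (g == f)]] & f \subset g.
  by apply: IH => //; apply: leq_trans en; apply: proper_card; rewrite finset.properEneq gne.
by exists f => //; exact: fintype.subset_trans fg ge.
Qed.

Section TauBound.
Local Open Scope ring_scope.
Variables (R : realType) (d : R) (G : graph).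
Hypothesis d_ge1 : 1 <= d.
Hypothesis minor_deg : forall M : graph, is_minor M G -> avg_degree R M <= d.
Variable H : {set {set G}}.
Hypotheses (Hball : ball_hypergraph H) (H_neq0 : H != set0).

(** Linear duality: otherwise there are weights [w] of total [W] whose load at every vertex is below
    [W / x], where [x = e d nu]. Divided by the largest load, they form a fractional matching of
    weight above [x], against [fractional_packing]. *)
Lemma fractional_transversal : exists z : G -> R,
  [/\ forall v, 0 <= z v, \sum_v z v = 1 &
      forall e, e \in H -> (expR 1 * d * (nu H)%:R)^-1 <= \sum_(v in e) z v].
Proof.
have d1 := d_ge1; have /set0Pn[e0 e0H] := H_neq0.
pose H' := [set f in H | [forall g in H, (g \subset f) ==> (g == f)]].
have H'H : H' \subset H by apply/subsetP=> e; rewrite inE => /andP[].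
have Hball' : ball_hypergraph H' by move=> e /(subsetP H'H) /Hball.
have Hanti : {in H' &, forall e f : {set G}, e \subset f -> e = f}.
  move=> e f /(subsetP H'H) eH; rewrite inE => /andP[_ /forall_inP /(_ e eH) /implyP h].
  by move=> /h /eqP.
pose x := expR 1 * d * (nu H)%:R.
have nu1 : 1 <= (nu H)%:R :> R by rewrite ler1n (nu_gt0 e0H).
have x0 : 0 < x by rewrite /x !mulr_gt0 ?expR_gt0 //; lra.
have V0 : (0 < #|G|)%N.
  by have /set0Pn[v _] := ball_neq0 Hball e0H; exact: card_graph_gt0 v.
(* Sets outside [H'] get the constant 1: this is trivially satisfied in the first alternative and
   only adds nonnegative terms in the second. *)
pose A (v : G) (e : {set G}) : R := if e \in H' then (v \in e)%:R - x^-1 else 1.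
have [[z [z0 z1 zA]]|[w [w0 wA]]] := ville_alternative A V0.
  exists z; split => // e /exists_minimal_edge[f fH fe].
  have := zA f; rewrite /A fH.
  under eq_bigr do rewrite mulrBr.
  rewrite big_split /= sumrN -mulr_suml z1 mul1r subr_ge0 => /le_trans; apply.
  rewrite [leRHS]big_mkcond; apply: ler_sum => v _.
  case vf : (v \in f); first by rewrite (subsetP fe) // mulr1.
  by rewrite mulr0; case: ifP.
pose W := \sum_(e in H') w e.
pose load v := \sum_(e in H' | v \in e) w e.
have load_lt v : x * load v < W.
  have : \sum_i w i * A v i = load v - W / x + \sum_(e | e \notin H') w e.
    rewrite (bigID (mem H')) /= /load /W big_mkcondr mulr_suml -sumrB; congr (_ + _).
      apply: eq_bigr => e eH; rewrite /A eH mulrBr; congr (_ - _).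
      by case: ifP; rewrite ?mulr1 ?mulr0.
    by apply: eq_bigr => e /negbTE eH; rewrite /A eH mulr1.
  have : 0 <= \sum_(e | e \notin H') w e by apply: sumr_ge0.
  have := wA v => h1 h2 h3; have : load v < W / x by lra.
  by rewrite ltr_pdivlMr // mulrC.
have /set0Pn[v0 _] := ball_neq0 Hball e0H.
have [v _ vmax] := @Order.TotalTheory.arg_maxP _ R G v0 xpredT load isT.
set m := load v in vmax.
have load_ge0 u : 0 <= load u by apply: sumr_ge0.
(* All edges are nonempty, so a zero maximal load would force [W = 0], contradicting the strict
   [load_lt]. *)
have [m0|m0] := eqVneq m 0.
  suff W0 : W = 0 by have := load_lt v; rewrite W0 -/m m0 mulr0 ltxx.
  apply: big1 => e eH; have /set0Pn[u ue] := ball_neq0 Hball' eH.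
  have h : w e <= load u by rewrite /load (bigD1 e) ?eH ?ue //= lerDl; apply: sumr_ge0.
  by apply/le_anti; rewrite w0 andbT -m0; exact: le_trans h (vmax u isT).
have mp : 0 < m by rewrite lt_neqAle eq_sym m0 load_ge0.
have w'0 e : 0 <= w e / m by apply: divr_ge0 => //; exact: ltW.
have w'l u : \sum_(e in H' | u \in e) w e / m <= 1.
  by rewrite -mulr_suml ler_pdivrMr // mul1r; exact: vmax.
have := fractional_packing Hball' Hanti d1 minor_deg w'0 w'l (ball_neq0 Hball').
rewrite -mulr_suml ler_pdivrMr // -/W => h.
have : expR 1 * d * (nu H')%:R * m <= x * m.
  rewrite ler_pM2r // /x ler_wpM2l ?ler_nat ?nuS //.
  by rewrite mulr_ge0 ?expR_ge0 //; lra.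
have := load_lt v; rewrite -/m; lra.
Qed.

(** If [tau H] exceeded the integer part [m] of the bound, no [m] vertices would form a transversal.
    Double sampling with [eps = 1 / x] and dimension [t - 1] then contradicts [net_size_bound]. *)
Lemma tau_le_nu (t : nat) : ~ is_minor (complete_graph t) G ->
  (tau H)%:R <= 2 * expR 1 * (t%:R - 1) * d * (nu H)%:R
                     * ln (11 * expR 1 * d * (nu H)%:R) :> R.
Proof.
move=> noK; have d1 := d_ge1; have /set0Pn[e0 e0H] := H_neq0.
have [v _] := set0Pn _ (ball_neq0 Hball e0H).
have t2 : (1 < t)%N.
  by rewrite ltnNge; apply/negP=> /(K1_minor v).
set x := expR 1 * d * (nu H)%:R.
pose D := t.-1.
have -> : t%:R - 1 = D%:R :> R by rewrite /D -subn1 natrB //; lia.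
have -> : 2 * expR 1 * D%:R * d * (nu H)%:R * ln (11 * expR 1 * d * (nu H)%:R) =
   2 * D%:R * x * ln (11 * x).
  by rewrite /x !mulrA; congr (_ * _); ring.
have nu1 : 1 <= (nu H)%:R :> R by rewrite ler1n (nu_gt0 e0H).
have ex : expR 1 <= x.
  rewrite /x -mulrA -[leLHS]mulr1 ler_pM2l ?expR_gt0 //; nra.
have B0 : 0 <= 2 * D%:R * x * ln (11 * x).
  have /andP[e1 _] := expR1_bounds R.
  by rewrite !mulr_ge0 ?ler0n ?ln_ge0 //; lra.
pose m := Num.truncn (2 * D%:R * x * ln (11 * x)).
have /andP[m1 m2] := Num.Theory.truncn_itv B0.
apply: (le_trans _ m1); rewrite ler_nat leqNgt; apply/negP=> tm.
have [z [z0 z1 zH]] := fractional_transversal.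
have x0 : 0 <= x^-1.
  by rewrite invr_ge0; apply: le_trans ex; exact: expR_ge0.
have vc X : shatters H X -> (#|X| <= D)%N.
  move=> XH; rewrite leqNgt; apply/negP=> h; apply: noK.
  by apply: ball_shatter_minor XH _; rewrite // /D in h *; lia.
have bad (u : {ffun 'I_m -> G}) : exists2 e, e \in H & forall k, u k \notin e.
  have : ~~ meets_all H (u @: finset.setT).
    apply/negP=> /(tau_le (meets_allT Hball)) /(leq_trans tm).
    rewrite ltnNge => /negP; apply; apply: leq_trans (leq_imset_card _ _) _.
    by rewrite cardsT card_ord.
  rewrite negb_forall => /existsP[e]; rewrite negb_imply negbK => /andP[eH /eqP eT].
  exists e => // k; apply/negP=> uke; have := in_set0 (u k).
  by rewrite -eT inE uke imset_f.
have := net_counting z0 z1 x0 zH vc bad.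
by rewrite leNgt net_size_bound // /D; lia.
Qed.

End TauBound.

(** An edge of [G] makes [K_2], of average degree 1, a minor, whence [1 <= d]. In an edgeless graph
    the degree condition would allow [d] near 0, where the logarithm is negative; the first
    hypothesis covers that case. *)
Lemma ball_hypergraph_tau_le (R : realType) (t : nat) (d : R) (G : graph) :
  ((0 < #|G|)%N -> edges G = finset.set0 -> (1 <= d)%R) ->
  ~ is_minor (complete_graph t) G ->
  (forall M : graph, is_minor M G -> (avg_degree R M <= d)%R) ->
  forall H : {set {set G}}, ball_hypergraph H ->
    ((tau H)%:R <= 2 * expR 1 * (t%:R - 1) * d * (nu H)%:R
                   * ln (11 * expR 1 * d * (nu H)%:R))%R.
Proof.
move=> d1 noK Md H Hb; have [H0|H0] := eqVneq H set0.
  have -> : nu H = 0.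
    apply/eqP; rewrite -leqn0; apply/bigmax_leqP=> M /andP[].
    by rewrite H0 subset0 => /eqP ->; rewrite cards0.
  by rewrite (tau_no_edge H0) mulr0 mul0r.
apply: tau_le_nu => //; have /set0Pn[e eH] := H0.
have /set0Pn[v0 _] := ball_neq0 Hb eH; have G0 := card_graph_gt0 v0.
have [E0|/set0Pn[f]] := eqVneq (edges G) set0; first exact: d1.
rewrite inE => /existsP[u /existsP[v /andP[uv _]]].
have nuv : u != v by apply/eqP=> e'; move: uv; rewrite e' adj_irrefl.
have K2 : is_minor (complete_graph 2) G.
  exists (fun i : 'I_2 => if val i == 0 then [set u] else [set v]); split.
  - by move=> i; apply/set0Pn; case: ifP => _; [exists u|exists v]; rewrite inE.
  - by move=> i a b; case: ifP => _; rewrite !inE => /eqP -> /eqP ->; exact: connect0.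
  - move=> [[|[|//]] i] [[|[|//]] j]; rewrite -(inj_eq val_inj) //= => _;
    rewrite -setI_eq0; apply/eqP/setP=> y;
    by rewrite !inE; apply/negbTE/negP=> /andP[/eqP -> /eqP e']; rewrite e' eqxx in nuv.
  - move=> [[|[|//]] i] [[|[|//]] j]; rewrite /= /complete_adj -(inj_eq val_inj) //= => _;
    [exists u, v|exists v, u];
    by split; rewrite ?inE // adj_sym.
have := arcs_avg_degree (Md _ K2); rewrite card_ord.
suff -> : #|arcs (complete_graph 2)| = 2.
  have : (0 < 2%:R :> R)%R by [].
  by rewrite -[X in (X <= _)%R]mul1r => p; rewrite ler_pM2r.
rewrite -[RHS](_ : #|[set ((ord0 : 'I_2), (ord_max : 'I_2)); (ord_max, ord0)]| = 2).
  apply: eq_card => -[[[|[|//]] i] [[|[|//]] j]]; rewrite !inE //=.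
by rewrite cards2.
Qed.

(** * Minors on subsets and critical minors *)

Section RelOnSet.
Variable V : finType.
Implicit Types (S A : {set V}) (e : rel V).

Definition rel_in e A : rel V := fun a b => [&& a \in A, b \in A & e a b].

Definition conn_in e A := forall x y, x \in A -> y \in A -> connect (rel_in e A) x y.

Definition nbhd S e x : {set V} := [set y in S | e x y].

Definition arcs_on S e := \sum_(x in S) #|nbhd S e x|.

(** Merges [v] into [u]; the name [v] survives in the type and is to be removed from the vertex
    set. *)
Definition contract u v e : rel V := fun x y =>
  (x != y) && [|| e x y, (x == u) && e v y | (y == u) && e x v].

Definition del_edge u v e : rel V := fun x y =>
  e x y && ~~ (((x == u) && (y == v)) || ((x == v) && (y == u))).

Lemma contract_sym u v e : symmetric e -> symmetric (contract u v e).
Proof.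
move=> es x y; rewrite /contract eq_sym es (es v x) (es y v).
by congr (_ && _); rewrite (orbC (_ && _)).
Qed.

Lemma contract_irrefl u v e : irreflexive (contract u v e).
Proof. by move=> x; rewrite /contract eqxx. Qed.

Lemma del_edge_sym u v e : symmetric e -> symmetric (del_edge u v e).
Proof.
by move=> es x y; rewrite /del_edge es orbC [(y == u) && _]andbC [(y == v) && _]andbC.
Qed.

Lemma del_edge_irrefl u v e : irreflexive e -> irreflexive (del_edge u v e).
Proof. by move=> ei x; rewrite /del_edge ei. Qed.

(** Contraction loses the edge [u v] and one of two parallel edges per common neighbour; each edge
    counts as two arcs. *)
Lemma arcs_on_contract S e u v : symmetric e -> irreflexive e ->
  u \in S -> v \in S -> e u v ->
  arcs_on S e <= arcs_on (S :\ v) (contract u v e) + 2 + 2 * #|nbhd S e u :&: nbhd S e v|.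
Proof.
move=> es ei uS vS uv; have nuv : u != v by apply/eqP=> h; rewrite h ei in uv.
rewrite /arcs_on (bigD1 v) //= (bigD1 u) ?uS ?nuv //=.
under eq_bigl do rewrite -andbA.
have -> : \sum_(x in S :\ v) #|nbhd (S :\ v) (contract u v e) x| =
    #|nbhd (S :\ v) (contract u v e) u| +
    \sum_(x in S | (x != v) && (x != u)) #|nbhd (S :\ v) (contract u v e) x|.
  rewrite (bigD1 u) /=; last by rewrite !inE nuv uS.
  by congr (_ + _); apply: eq_bigl => x; rewrite !inE; case: (x \in S); rewrite ?andbF ?andbT //=.
set c := #|_ :&: _|.
have hu : #|nbhd S e v| + #|nbhd S e u| <= #|nbhd (S :\ v) (contract u v e) u| + 2 + c.
  rewrite addnC -cardsUI -/c leq_add2r.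
  apply: (@leq_trans #|nbhd (S :\ v) (contract u v e) u :|: [set u; v]|).
    apply: subset_leq_card; apply/subsetP=> y; rewrite !inE /contract eqxx /=.
    case: (eqVneq y u) => [->|yu]; first by rewrite orbT.
    case: (eqVneq y v) => [->|yv]; first by rewrite orbT.
    by rewrite /= orbF => /orP[/andP[-> ->]|/andP[-> ->]]; rewrite ?orbT.
  by rewrite cardsU cards2 nuv; lia.
have hx : \sum_(x in S | (x != v) && (x != u)) #|nbhd S e x| <=
    \sum_(x in S | (x != v) && (x != u)) #|nbhd (S :\ v) (contract u v e) x| + c.
  have -> : c = \sum_(x in S | (x != v) && (x != u)) (x \in nbhd S e u :&: nbhd S e v).
    rewrite /c -sum1_card big_mkcond [RHS]big_mkcond /=; apply: eq_bigr => x _.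
    rewrite !inE; case: (x \in S) => //=.
    case: (eqVneq x v) => [->|_] /=; first by rewrite ei andbF.
    by case: (eqVneq x u) => [->|_] /=; [rewrite ei|case: ifP].
  rewrite -big_split /=; apply: leq_sum => x /and3P[xS xv xu].
  case: (boolP (x \in nbhd S e u :&: nbhd S e v)) => [|xuv].
    rewrite !inE xS /= => /andP[ux vx].
    apply: (@leq_trans #|nbhd (S :\ v) (contract u v e) x :|: [set v]|).
      apply: subset_leq_card; apply/subsetP=> y; rewrite !inE /contract => /andP[yS xy].
      case: (eqVneq y v) => [->|yv]; first by rewrite orbT.
      by rewrite yS xy /= orbF andbT; apply/eqP=> h; move: xy; rewrite h ei.
    by rewrite cardsU cards1; lia.
  (* When [x] is not adjacent to both ends, renaming [v] to [u] is injective on its neighbours. *)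
  rewrite addn0 -(card_in_imset (f := fun y => if y == v then u else y)).
    apply: subset_leq_card; apply/subsetP=> z /imsetP[y]; rewrite inE => /andP[yS xy] ->.
    case: (eqVneq y v) => [yv|yv].
      rewrite !inE nuv uS /= /contract xu eqxx /=.
      by rewrite yv in xy; rewrite xy !orbT.
    rewrite !inE yv yS /contract xy /= andbT.
    by apply/eqP=> h; move: xy; rewrite h ei.
  move=> y z; rewrite !inE => /andP[yS xy] /andP[zS xz].
  case: (eqVneq y v) => [yv|yv]; case: (eqVneq z v) => [zv|zv] //; first by rewrite yv zv.
    by move=> uz; move: xuv; rewrite !inE xS uz (es z) (es v) xz -yv xy.
  by move=> uz; move: xuv; rewrite !inE xS -uz (es y) (es v) xy -zv xz.
lia.
Qed.

Lemma arcs_on_del_edge S e u v : symmetric e -> irreflexive e ->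
  u \in S -> v \in S -> e u v -> arcs_on S e = arcs_on S (del_edge u v e) + 2.
Proof.
move=> es ei uS vS uv; have nuv : u != v by apply/eqP=> h; rewrite h ei in uv.
have -> : 2 = \sum_(x in S) ((x == u) + (x == v)).
  rewrite big_split /= (bigD1 u) //= eqxx big1; last by move=> x /andP[_ /negbTE ->].
  by rewrite (bigD1 v) //= eqxx big1 // => x /andP[_ /negbTE ->].
rewrite /arcs_on -big_split /=; apply: eq_bigr => x xS.
have [-> | xu] := eqVneq x u.
  rewrite (negbTE nuv) addn0 (cardsD1 v) inE vS uv addnC; congr (_ + _).
  apply: eq_card => y; rewrite !inE /del_edge eqxx (negbTE nuv) /= orbF.
  by case: (y == v); rewrite ?andbF ?andbT.
have [-> | xv] := eqVneq x v.
  rewrite add0n (cardsD1 u) inE uS es uv addnC; congr (_ + _).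
  apply: eq_card => y; rewrite !inE /del_edge eqxx [v == u]eq_sym (negbTE nuv) /=.
  by case: (y == u); rewrite ?andbF ?andbT.
rewrite !addn0; apply: eq_card => y; rewrite !inE /del_edge (negbTE xu) (negbTE xv).
by rewrite andbT.
Qed.

Lemma arcs_on_del_vertex S e v : symmetric e -> irreflexive e -> v \in S ->
  arcs_on S e = arcs_on (S :\ v) e + 2 * #|nbhd S e v|.
Proof.
move=> es ei vS; rewrite /arcs_on (bigD1 v) //=.
have -> : \sum_(x in S | x != v) #|nbhd S e x| =
    \sum_(x in S :\ v) #|nbhd (S :\ v) e x| + \sum_(x in S :\ v) (x \in nbhd S e v).
  rewrite -big_split /=; apply: eq_big => x; first by rewrite !inE andbC.
  case/andP=> xS xv; rewrite [LHS](cardsD1 v) !inE vS xS es addnC; congr (_ + _).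
  by apply: eq_card => y; rewrite !inE andbA.
have -> : #|nbhd S e v| = \sum_(x in S :\ v) (x \in nbhd S e v).
  rewrite -sum1_card big_mkcond [RHS]big_mkcond; apply: eq_bigr => x _.
  rewrite !inE; case: (eqVneq x v) => [->|_] /=; rewrite ?ei ?andbF //.
  by case: (x \in S); case: (e v x).
lia.
Qed.

Lemma arcs_on_le S e : irreflexive e -> arcs_on S e <= #|S| * #|S|.-1.
Proof.
move=> ei; rewrite -sum_nat_const; apply: leq_sum => x xS.
rewrite [X in _ <= X.-1](cardsD1 x) xS /=; apply: subset_leq_card.
apply/subsetP=> y; rewrite !inE => /andP[-> xy]; rewrite andbT.
by apply/eqP=> h; move: xy; rewrite h ei.
Qed.

Lemma conn_inU e A B x y : symmetric e -> conn_in e A -> conn_in e B ->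
  x \in A -> y \in B -> e x y -> conn_in e (A :|: B).
Proof.
move=> es cA cB xA yB xy.
have csym : connect_sym (rel_in e (A :|: B)).
  by apply: sym_connect_sym => a b; rewrite /rel_in es andbCA.
have sA : subrel (connect (rel_in e A)) (connect (rel_in e (A :|: B))).
  apply: connect_sub => a b /and3P[aA bA ab]; apply: connect1.
  by rewrite /rel_in !inE aA bA.
have sB : subrel (connect (rel_in e B)) (connect (rel_in e (A :|: B))).
  apply: connect_sub => a b /and3P[aA bA ab]; apply: connect1.
  by rewrite /rel_in !inE aA bA !orbT.
have tox a : a \in A :|: B -> connect (rel_in e (A :|: B)) a x.
  rewrite inE => /orP[aA|aB]; first by apply: sA; exact: cA.
  apply: (@connect_trans _ _ y); first by apply: sB; exact: cB.
  by apply: connect1; rewrite /rel_in !inE xA yB es xy orbT.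
move=> a b aAB bAB; apply: connect_trans (tox a aAB) _; rewrite csym; exact: tox.
Qed.

Lemma conn_in1 e x : conn_in e [set x].
Proof. by move=> a b; rewrite !inE => /eqP -> /eqP ->; exact: connect0. Qed.

End RelOnSet.

(* The ambient type [V] stays fixed, so that deletions and contractions are
   operations on [S] and [e]. *)
Definition minor_on (G : graph) (V : finType) (S : {set V}) (e : rel V) :=
  exists B : V -> {set G},
    [/\ {in S, forall x, B x != set0},
        {in S, forall x, connected_in (B x)},
        {in S &, forall x y, x != y -> [disjoint B x & B y]} &
        {in S &, forall x y, e x y -> exists a b, [/\ a \in B x, b \in B y & adj a b]}].

Section MinorOn.
Variables (G : graph) (V : finType).
Implicit Types (S A : {set V}) (e : rel V).

Lemma minor_on_sub S S' e e' : S' \subset S -> subrel e' e ->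
  minor_on G S e -> minor_on G S' e'.
Proof.
move=> /subsetP SS ee [B [B0 Bc Bd Be]]; exists B; split.
- by move=> x /SS; exact: B0.
- by move=> x /SS; exact: Bc.
- by move=> x y /SS xS /SS; exact: Bd.
- by move=> x y /SS xS /SS yS /ee; exact: Be.
Qed.

Lemma minor_on_contract S e u v : u \in S -> v \in S -> u != v -> e u v ->
  minor_on G S e -> minor_on G (S :\ v) (contract u v e).
Proof.
move=> uS vS nuv uv [B [B0 Bc Bd Be]].
pose B' x := if x == u then B u :|: B v else B x.
have [a [b [au bv ab]]] := Be u v uS vS uv.
exists B'; split.
- move=> x; rewrite !inE /B' => /andP[_ xS]; case: ifP => _; last exact: B0.
  by apply/set0Pn; exists a; rewrite inE au.
- move=> x; rewrite !inE /B' => /andP[_ xS]; case: ifP => _; last exact: Bc.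
  by apply: (conn_inU (@adj_sym G) _ _ au bv ab); exact: Bc.
- move=> x y; rewrite !inE /B' => /andP[xv xS] /andP[yv yS].
  case: (eqVneq x u) => [xu|xu]; case: (eqVneq y u) => [yu|yu] xy.
  + by rewrite xu yu eqxx in xy.
  + by rewrite -setI_eq0 setIUl setU_eq0 !setI_eq0 !Bd // eq_sym.
  + by rewrite -setI_eq0 setIUr setU_eq0 !setI_eq0 !Bd.
  + exact: Bd.
- move=> x y; rewrite !inE => /andP[xv xS] /andP[yv yS] /andP[xy].
  have up z w : z \in B w -> w != v -> z \in B' w.
    by rewrite /B'; case: (eqVneq w u) => [->|//] zu _; rewrite inE zu.
  have upv z : z \in B v -> z \in B' u by rewrite /B' eqxx inE orbC => ->.
  case/or3P=> [exy|/andP[/eqP xu vy]|/andP[/eqP yu xv']].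
  + by have [p [q [px qy pq]]] := Be x y xS yS exy; exists p, q; split=> //; exact: up.
  + have [p [q [px qy pq]]] := Be v y vS yS vy; exists p, q; split=> //; last exact: up.
    by rewrite xu; exact: upv.
  + have [p [q [px qy pq]]] := Be x v xS vS xv'; exists p, q; split=> //; first exact: up.
    by rewrite yu; exact: upv.
Qed.

Lemma minor_on_bigcup S e (B : V -> {set G}) A :
  {in S, forall x, connected_in (B x)} ->
  {in S &, forall x y, e x y -> exists a b, [/\ a \in B x, b \in B y & adj a b]} ->
  A \subset S -> conn_in e A -> connected_in (\bigcup_(x in A) B x).
Proof.
move=> Bc Be AS cA p q /bigcupP[x xA px] /bigcupP[y yA qy].
have sub z : z \in A -> subrel (connect (rel_in (@adj G) (B z)))
      (connect (rel_in (@adj G) (\bigcup_(x in A) B x))).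
  move=> zA; apply: connect_sub => a b /and3P[aB bB ab]; apply: connect1.
  by rewrite /rel_in ab andbT; apply/andP; split; apply/bigcupP; exists z.
have /connectP[s] := cA x y xA yA.
elim: s x xA p px => [|z s IH] x xA p px /=.
  by move=> _ e'; rewrite e' in qy; apply: (sub x xA); apply: Bc; rewrite ?(subsetP AS).
move=> /andP[/and3P[_ zA xz] zs] yl.
have [a [b [ax bz ab]]] := Be x z (subsetP AS x xA) (subsetP AS z zA) xz.
apply: (@connect_trans _ _ a).
  by apply: (sub x xA); apply: Bc; rewrite ?(subsetP AS).
apply: (@connect_trans _ _ b); last exact: IH zs yl.
apply: connect1; apply/and3P; split=> //; apply/bigcupP; [by exists x|by exists z].
Qed.

Definition joinable e (C D : {set V}) :=
  [disjoint C & D] && [exists x in C, exists y in D, e x y].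

Lemma joinable_sym e : symmetric e -> symmetric (joinable e).
Proof.
move=> es C D; rewrite /joinable disjoint_sym; congr (_ && _).
by apply/idP/idP=> /existsP[x /andP[xC /existsP[y /andP[yD xy]]]]; apply/existsP;
  exists y; rewrite yD; apply/existsP; exists x; rewrite xC es.
Qed.

(** Branch sets compose: each class of vertices is replaced by the union of their own branch
    sets. *)
Lemma minor_on_clique S e (Cs : seq {set V}) : symmetric e -> minor_on G S e ->
  (forall C, C \in Cs -> [/\ C \subset S, C != set0 & conn_in e C]) ->
  pairwise (joinable e) Cs -> is_minor (complete_graph (size Cs)) G.
Proof.
move=> es [B [B0 Bc Bd Be]] Cs_ok Cs_pair.
pose C (i : 'I_(size Cs)) := nth set0 Cs i.
have Cok i : [/\ C i \subset S, C i != set0 & conn_in e (C i)].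
  by apply: Cs_ok; exact: mem_nth.
have Cjoin i j : i != j -> joinable e (C i) (C j).
  move=> ij; have {}ij : nat_of_ord i != j by [].
  move/(pairwiseP set0): Cs_pair => P; case: (ltngtP i j) => [h|h|h].
  - by apply: P; rewrite ?inE.
  - by rewrite joinable_sym //; apply: P; rewrite ?inE.
  - by rewrite h eqxx in ij.
exists (fun i => \bigcup_(x in C i) B x); split.
- move=> i; have [CS /set0Pn[x xC] _] := Cok i.
  have /set0Pn[a ax] := B0 x (subsetP CS x xC).
  by apply/set0Pn; exists a; apply/bigcupP; exists x.
- by move=> i; have [CS _ Cc] := Cok i; exact: minor_on_bigcup CS Cc.
- move=> i j /Cjoin/andP[Cd _]; rewrite -setI_eq0; apply/eqP/setP=> a.
  rewrite [RHS]inE; apply/negbTE/negP; rewrite inE => /andP[/bigcupP[x xC ax] /bigcupP[y yC ay]].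
  have [Ci _ _] := Cok i; have [Cj _ _] := Cok j.
  have xy : x != y by apply/eqP=> xy; rewrite -xy in yC; have := disjointFr Cd xC; rewrite yC.
  by have := disjointFr (Bd x y (subsetP Ci x xC) (subsetP Cj y yC) xy) ax; rewrite ay.
- move=> i j /Cjoin/andP[_ /existsP[x /andP[xC /existsP[y /andP[yC xy]]]]].
  have [Ci _ _] := Cok i; have [Cj _ _] := Cok j.
  have [a [b [ax bY ab]]] := Be x y (subsetP Ci x xC) (subsetP Cj y yC) xy.
  by exists a, b; split=> //; apply/bigcupP; [exists x|exists y].
Qed.

End MinorOn.

Lemma is_minor_minor_on (M G : graph) : is_minor M G -> minor_on G [set: M] (@adj M).
Proof.
move=> [B [B0 Bc Bd Be]]; exists B; split => //.
- by move=> x y _ _; exact: Bd.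
- by move=> x y _ _; exact: Be.
Qed.

Lemma arcs_on_setT (G : graph) : arcs_on [set: G] (@adj G) = #|arcs G|.
Proof.
rewrite /arcs_on (eq_bigl xpredT); last by move=> x; rewrite inE.
under eq_bigr do rewrite -sum1_card big_mkcond.
rewrite pair_bigA /= -sum1_card [RHS]big_mkcond.
by apply: eq_bigr => -[x y] _; rewrite !inE.
Qed.

Section Critical.
Variables (G : graph) (V : finType) (k b n0 : nat).
Hypotheses (k_gt0 : 0 < k) (n0_gt0 : 0 < n0) (b_le : b <= 2 * k * n0).

(* A densest minor with as few vertices and edges as possible. *)
Lemma critical_minor (S : {set V}) (e : rel V) : symmetric e -> irreflexive e ->
  minor_on G S e -> 2 * k * #|S| <= arcs_on S e + b -> n0 <= #|S| ->
  exists (S' : {set V}) (e' : rel V),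
   [/\ symmetric e', irreflexive e', minor_on G S' e', n0 <= #|S'| &
    [/\ 2 * k * #|S'| <= arcs_on S' e' + b, arcs_on S' e' + b <= 2 * k * #|S'| + 1,
     (n0 < #|S'| -> forall u v, u \in S' -> v \in S' -> e' u v ->
        k <= #|nbhd S' e' u :&: nbhd S' e' v|) &
     (n0 < #|S'| -> forall v, v \in S' -> k < #|nbhd S' e' v|)]].
Proof.
(* [K] exceeds the number of arcs on any subset, so the measure decreases whenever a vertex
   disappears. *)
pose K := (#|V| * #|V|).+1.
have [n] := ubnP (#|S| * K + arcs_on S e); elim: n S e => // n IH S e.
rewrite ltnS => Sn es ei mS dens Sn0.
case: (leqP (arcs_on S e + b) (2 * k * #|S| + 1)) => up; last first.
  (* An edge to delete exists because [b <= 2 k n0]: the slack alone cannot reach the density. *)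
  have : 0 < arcs_on S e.
    rewrite lt0n; apply/eqP=> h; rewrite h in up.
    by have := leq_mul (leqnn (2 * k)) Sn0; lia.
  rewrite lt0n sum_nat_eq0 => /forall_inPn[u uS]; rewrite -lt0n => /card_gt0P[v].
  rewrite inE => /andP[vS uv]; have E := arcs_on_del_edge es ei uS vS uv.
  apply: (IH S (del_edge u v e)) => //; try lia.
  - exact: del_edge_sym.
  - exact: del_edge_irrefl.
  - by apply: minor_on_sub mS => // x y /andP[].
case: (boolP [forall u in S, forall v in S, e u v ==> (n0 < #|S|) ==>
     (k <= #|nbhd S e u :&: nbhd S e v|)]) => [cn|]; last first.
  case/forall_inPn=> u uS /forall_inPn[v vS]; rewrite !negb_imply -ltnNge => /and3P[uv Sb ck].
  have nuv : u != v by apply/eqP=> h; rewrite h ei in uv.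
  have := arcs_on_contract es ei uS vS uv; have SE : #|S| = #|S :\ v|.+1 by rewrite (cardsD1 v) vS.
  have : 2 * k * #|S| = 2 * k * #|S :\ v| + 2 * k by rewrite SE mulnS addnC.
  move=> SkE cE.
  have IHc := IH (S :\ v) (contract u v e).
  have small : #|S :\ v| * K + arcs_on (S :\ v) (contract u v e) < n.
    apply: leq_trans Sn; rewrite SE mulSn.
    have := arcs_on_le (S :\ v) (@contract_irrefl _ u v e).
    have : #|S :\ v| * #|S :\ v|.-1 <= #|V| * #|V|.
      have h : #|S :\ v| <= #|V| := max_card _.
      by apply: leq_mul => //; apply: leq_trans h; exact: leq_pred.
    rewrite /K; lia.
  apply: IHc => //; try lia.
  - exact: contract_sym.
  - exact: contract_irrefl.
  - exact: minor_on_contract.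
case: (boolP [forall v in S, (n0 < #|S|) ==> (k < #|nbhd S e v|)]) => [dg|]; last first.
  case/forall_inPn=> v vS; rewrite negb_imply -leqNgt => /andP[Sb ck].
  have SE : #|S| = #|S :\ v|.+1 by rewrite (cardsD1 v) vS.
  have SkE : 2 * k * #|S| = 2 * k * #|S :\ v| + 2 * k by rewrite SE mulnS addnC.
  have := arcs_on_del_vertex es ei vS => E.
  apply: (IH (S :\ v) e) => //; try by move: Sn; rewrite SE mulSn /K; lia.
  by apply: minor_on_sub mS => //; apply/subsetP=> x; rewrite inE => /andP[].
exists S, e; split=> //; split=> //.
  move=> Sb u v uS vS uv.
  by move/forall_inP: cn => /(_ u uS)/forall_inP/(_ v vS)/implyP/(_ uv)/implyP/(_ Sb).
by move=> Sb v vS; move/forall_inP: dg => /(_ v vS)/implyP/(_ Sb).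
Qed.

End Critical.

(** * Minors of small cliques *)

Section SmallCliqueMinor.
Variables (V : finType) (e : rel V).
Hypotheses (es : symmetric e) (ei : irreflexive e).

Lemma joinable_intro (C D : {set V}) x y : {in C, forall z, z \notin D} ->
  x \in C -> y \in D -> e x y -> joinable e C D.
Proof.
move=> CD xC yD xy; apply/andP; split.
  by rewrite disjoint_subset; apply/subsetP=> z /CD; rewrite inE.
by apply/existsP; exists x; rewrite xC; apply/existsP; exists y; rewrite yD.
Qed.

Lemma adj_neq x y : e x y -> x != y.
Proof. by apply: contraTneq => ->; rewrite ei. Qed.

Lemma joinable1 x y : e x y -> joinable e [set x] [set y].
Proof.
move=> xy; apply: (joinable_intro (x := x) (y := y)); rewrite ?inE //.
by move=> z; rewrite !inE => /eqP ->; exact: adj_neq.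
Qed.

Definition clique_model (N : {set V}) (Cs : seq {set V}) :=
  (forall C, C \in Cs -> [/\ C \subset N, C != set0 & conn_in e C]) /\
  pairwise (joinable e) Cs.

(** If [x] and [y] are not adjacent, the degrees force five vertices, and both are joined to all of
    the remaining three. Each of these has a neighbour among them, giving a path [q p r];
    contracting [q x] leaves a [K_4]. *)
Lemma mindeg3_K4 (N : {set V}) : 4 <= #|N| <= 5 ->
  {in N, forall x, 3 <= #|[set y in N | e x y]|} ->
  exists2 Cs, size Cs = 4 & clique_model N Cs.
Proof.
move=> /andP[N4 N5] deg3.
case: (boolP [forall x in N, forall y in N, (x != y) ==> e x y]) => [full|].
  pose s := take 4 (enum N).
  have sN x : x \in s -> x \in N by move=> /mem_take; rewrite mem_enum.
  have us : uniq s by apply: take_uniq; exact: enum_uniq.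
  exists [seq [set x] | x <- s]; first by rewrite size_map size_take -cardE; case: ltnP; lia.
  split.
    move=> _ /mapP[x /sN xN ->]; split; first by rewrite sub1set.
      by apply/set0Pn; exists x; rewrite inE.
    exact: conn_in1.
  rewrite pairwise_map; move: us; rewrite uniq_pairwise.
  apply: (@sub_in_pairwise _ (mem s)); last exact/allP.
  move=> x y xs ys /= xy; apply: joinable1.
  by move/forall_inP: full => /(_ x (sN x xs))/forall_inP/(_ y (sN y ys))/implyP; apply.
case/forall_inPn=> x xN /forall_inPn[y yN]; rewrite negb_imply => /andP[xy nxy].
pose T := N :\ x :\ y.
have cT : #|N| = #|T|.+2.
  by rewrite (cardsD1 x N) xN (cardsD1 y (N :\ x)) !inE eq_sym xy yN.
have sxT : [set z in N | e x z] \subset T.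
  apply/subsetP=> z; rewrite !inE => /andP[zN xz]; rewrite zN andbT.
  by apply/andP; split; apply: contraTneq xz => ->; rewrite ?ei // (negbTE nxy).
have syT : [set z in N | e y z] \subset T.
  apply/subsetP=> z; rewrite !inE => /andP[zN yz]; rewrite zN andbT.
  by apply/andP; split; apply: contraTneq yz => ->; rewrite ?ei // es (negbTE nxy).
have T3 : #|T| = 3.
  by have := subset_leq_card sxT; have := deg3 x xN; lia.
have xT z : z \in T -> e x z.
  have /eqP <- : [set z in N | e x z] == T by rewrite eqEcard sxT T3 deg3.
  by rewrite inE => /andP[].
have yT z : z \in T -> e y z.
  have /eqP <- : [set z in N | e y z] == T by rewrite eqEcard syT T3 deg3.
  by rewrite inE => /andP[].
have TN z : z \in T -> [/\ z \in N, z != x & z != y].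
  by rewrite !inE => /and3P[].
have TT z : z \in T -> exists2 u, u \in T & e z u.
  move=> zT; have [zN zx zy] := TN z zT.
  have : 0 < #|[set u in T | e z u]|.
    have : #|[set y in N | e z y]| <= #|[set u in T | e z u] :|: [set x; y]|.
      apply: subset_leq_card; apply/subsetP=> u; rewrite !inE => /andP[-> ->].
      by case: (u == x); case: (u == y).
    rewrite cardsU cards2 xy; have := deg3 z zN; lia.
  by case/card_gt0P=> u; rewrite inE => /andP[uT zu]; exists u.
have [p [q [r [[pT qT rT] [pq pr qr]]]]] : exists p q r,
   [/\ p \in T, q \in T & r \in T] /\ [/\ e p q, e p r & q != r].
  have := enum_uniq T; have := mem_enum T; have := cardE T; rewrite T3.
  case: (enum T) => [|a [|b [|c [|//]]]] // _ m /= /andP[]; rewrite !inE negb_or.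
  move=> /andP[ab ac]; rewrite andbT => bc.
  have aT : a \in T by rewrite -m !inE eqxx.
  have bT : b \in T by rewrite -m !inE eqxx orbT.
  have cT' : c \in T by rewrite -m !inE eqxx !orbT.
  have [a' h1 aa'] := TT a aT; have [b' h2 bb'] := TT b bT; have [c' h3 cc'] := TT c cT'.
  move: h1 h2 h3; rewrite -!m !inE => /or3P h1 /or3P h2 /or3P h3.
  have [ba ca cb] : [/\ e b a = e a b, e c a = e a c & e c b = e b c].
    by split; exact: es.
  move: aa' bb' cc'; move: h1 h2 h3 => [] /eqP -> [] /eqP -> [] /eqP ->;
  rewrite ?ei ?ba ?ca ?cb // => h1 h2 h3;
  solve [by exists a, b, c | by exists b, a, c; rewrite ba | by exists c, a, b; rewrite ca cb].
have [pN px py] := TN p pT; have [qN qx qy] := TN q qT; have [rN rx ry] := TN r rT.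
have qxc : conn_in e [set q; x].
  by apply: (conn_inU es (@conn_in1 _ e q) (@conn_in1 _ e x) (x := q) (y := x)); rewrite ?inE // es xT.
exists [:: [set p]; [set q; x]; [set r]; [set y]] => //; split.
  move=> C; rewrite !inE => /or4P[] /eqP ->; split;
    rewrite ?sub1set -?card_gt0 ?cards1 ?cards2 //; try exact: conn_in1.
  by apply/subsetP=> z; rewrite !inE => /orP[] /eqP ->.
have npq := adj_neq pq; have npr := adj_neq pr.
rewrite /= !andbT; apply/and3P; split; [apply/and3P; split|apply/andP; split|].
- apply: (joinable_intro (x := p) (y := q)); rewrite ?inE ?eqxx //.
  by move=> z; rewrite !inE => /eqP ->; rewrite negb_or npq px.
- exact: joinable1.
- by apply: joinable1; rewrite es yT.
- apply: (joinable_intro (x := x) (y := r)); rewrite ?inE ?eqxx ?orbT ?xT //.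
  by move=> z; rewrite !inE => /orP[] /eqP ->; rewrite // eq_sym.
- apply: (joinable_intro (x := q) (y := y)); rewrite ?inE ?eqxx ?orbT //.
    by move=> z; rewrite !inE => /orP[] /eqP ->.
  by rewrite es yT.
- by apply: joinable1; rewrite es yT.
Qed.

End SmallCliqueMinor.

Section Mader.
Variables (G : graph) (V : finType).

Lemma min_degree_vertex (S : {set V}) (e : rel V) m : 0 < #|S| ->
  arcs_on S e < m.+1 * #|S| -> exists2 v, v \in S & #|nbhd S e v| <= m.
Proof.
move=> S0 h; apply/exists_inP; apply: contraTT h => /exists_inPn h.
rewrite -leqNgt mulnC -sum_nat_const; apply: leq_sum => v /h.
by rewrite -ltnNge.
Qed.

(* Contracting an edge of a minimal counterexample must destroy at least four
   edges, so every edge lies in three triangles; a vertex of degree at most 5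
   then has a neighbourhood of minimum degree 3, which contains a [K_4]-minor. *)
Lemma mader_K5 (S : {set V}) (e : rel V) : symmetric e -> irreflexive e ->
  minor_on G S e -> 2 < #|S| -> 6 * #|S| <= arcs_on S e + 10 ->
  is_minor (complete_graph 5) G.
Proof.
move=> es ei mS S3 dens.
(* The density is [3 n - 5] edges, that is [6 n - 10] arcs, with at least three vertices kept. *)
have := @critical_minor G V 3 10 3 isT isT isT S e es ei mS dens S3.
move=> {S3 dens mS es ei} [S' [e' [es ei mS S3 [lo up cn dg]]]].
have arcs_le := arcs_on_le S' ei.
(* Three vertices carry at most 6 arcs, while [lo] would ask for 8. *)
have S4 : 3 < #|S'|.
  rewrite ltn_neqAle S3 andbT; apply/eqP=> h; move: lo arcs_le; rewrite -h /=; lia.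
have [v vS v5] : exists2 v, v \in S' & #|nbhd S' e' v| <= 5.
  apply: min_degree_vertex; lia.
have deg3 : {in nbhd S' e' v, forall x, 3 <= #|[set y in nbhd S' e' v | e' x y]|}.
  move=> x; rewrite inE => /andP[xS vx].
  apply: leq_trans (cn S4 v x vS xS vx) _; apply: subset_leq_card.
  by apply/subsetP=> y; rewrite !inE => /andP[/andP[-> ->] /andP[_ ->]].
have [|Cs sCs [Cs_ok Cs_pair]] := mindeg3_K4 es ei _ deg3; first by rewrite v5 (dg S4 v vS).
rewrite (_ : 5 = size ([set v] :: Cs)); last by rewrite /= sCs.
apply: (minor_on_clique es mS).
  move=> C; rewrite inE => /predU1P[->|/Cs_ok[CN C0 Cc]]; split => //.
  - by rewrite sub1set.
  - by apply/set0Pn; exists v; rewrite inE.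
  - exact: conn_in1.
  - by apply: fintype.subset_trans CN _; apply/subsetP=> y; rewrite inE => /andP[].
rewrite /= Cs_pair andbT; apply/allP=> C /Cs_ok[/subsetP CN /set0Pn[x xC] _].
have := CN x xC; rewrite inE => /andP[_ vx].
apply: (joinable_intro (x := v) (y := x)); rewrite ?inE //.
move=> z; rewrite inE => /eqP ->; apply/negP=> /CN; rewrite inE => /andP[_].
by rewrite ei.
Qed.

End Mader.

Lemma no_K5_minor_degree (G M : graph) : ~ is_minor (complete_graph 5) G ->
  is_minor M G -> #|arcs M| <= 6 * #|M|.
Proof.
move=> noK MG; rewrite leqNgt; apply/negP=> h; apply: noK.
have ei := @adj_irrefl M; have := arcs_on_le [set: M] ei; rewrite arcs_on_setT cardsT => le.
apply: (@mader_K5 G M [set: M] (@adj M) (@adj_sym M) ei (is_minor_minor_on MG)).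
  rewrite cardsT ltnNge; apply/negP=> M2.
  have : #|M| * #|M|.-1 <= #|M| * 6 by apply: leq_mul; lia.
  lia.
by rewrite cardsT arcs_on_setT; lia.
Qed.

(** * Clique minors in dense graphs *)

Section DenseGraph.
Variables (V : finType) (e : rel V).
Hypotheses (es : symmetric e) (ei : irreflexive e).
Implicit Types (N X A B C : {set V}).

Lemma rel_in_sym A : symmetric (rel_in e A).
Proof. by move=> x y; rewrite /rel_in es andbCA. Qed.

Lemma conn_in_sym A : connect_sym (rel_in e A).
Proof. by apply: sym_connect_sym; exact: rel_in_sym. Qed.

Lemma card_nbhdI A B x : A \subset B -> #|nbhd B e x| <= #|nbhd A e x| + #|B :\: A|.
Proof.
move=> AB; rewrite -(cardsID A (nbhd B e x)); apply: leq_add; apply: subset_leq_card.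
  by apply/subsetP=> y; rewrite !inE => /andP[/andP[_ ->] ->].
by apply/subsetP=> y; rewrite !inE => /and3P[-> ->].
Qed.

Lemma card_setD_sub A B : A \subset B -> #|B :\: A| + #|A| = #|B|.
Proof. by move=> AB; rewrite -(cardsID A B) (setIidPr AB) addnC. Qed.

Lemma common_nbr A x y : #|A| < #|nbhd A e x| + #|nbhd A e y| ->
  exists2 z, z \in A & e x z && e y z.
Proof.
move=> h; have : 0 < #|nbhd A e x :&: nbhd A e y|.
  have := cardsUI (nbhd A e x) (nbhd A e y).
  have : #|nbhd A e x :|: nbhd A e y| <= #|A|.
    by apply: subset_leq_card; apply/subsetP=> z; rewrite !inE => /orP[] /andP[].
  lia.
by case/card_gt0P=> z; rewrite !inE => /andP[/andP[zA xz] /andP[_ yz]]; exists z; rewrite ?xz.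
Qed.

Definition robust N := forall X, X \subset N -> 20 * #|X| <= #|N| -> conn_in e (N :\: X).

(** One step suffices. If a small [X] disconnects [N], the smaller of two components has at most
    half of the vertices but still degrees at least [9 / 20] of [#|N|], hence nine tenths of its own
    size. Any two of its vertices then share a neighbour even after a twentieth is deleted. *)
Lemma robust_subset N : N != set0 -> (forall x, x \in N -> #|N| <= 2 * #|nbhd N e x|) ->
  exists N', [/\ N' \subset N, 9 * #|N| <= 20 * #|N'|, robust N' &
     forall x, x \in N' -> 2 * #|N'| <= 5 * #|nbhd N' e x|].
Proof.
move=> N0 deg; case: (pselect (robust N)) => [rN|].
  by exists N; split => //; [lia|move=> x /deg; lia].
move=> /existsNP[X /not_implyP[XN /not_implyP[Xs]]].
move=> /existsNP[x /existsNP[y /not_implyP[xN /not_implyP[yN /negP xy]]]].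
pose A := N :\: X; pose comp u := [set z | connect (rel_in e A) u z].
have compA u : u \in A -> comp u \subset A.
  move=> uA; apply/subsetP=> z; rewrite inE => /connectP[p + ->].
  elim: p u uA => //= w p IH u uA /andP[/and3P[_ wA _] wp]; exact: IH wp.
have compE u v : connect (rel_in e A) u v -> comp u = comp v.
  by move=> uv; apply/setP=> z; rewrite !inE; exact: (same_connect (conn_in_sym A) uv).
have dis : [disjoint comp x & comp y].
  rewrite disjoint_subset; apply/subsetP=> z; rewrite !inE => xz; apply/negP=> yz.
  by move/negP: xy; apply; apply: connect_trans xz _; rewrite conn_in_sym.
have cN : #|comp x| + #|comp y| <= #|N|.
  rewrite -cardsUI (_ : _ :&: _ = set0) ?cards0 ?addn0; last by apply/eqP; rewrite setI_eq0.
  apply: subset_leq_card; rewrite subUset.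
  by rewrite !(fintype.subset_trans (compA _ _)) ?subsetDl.
have [u uA uN] : exists2 u, u \in A & 2 * #|comp u| <= #|N|.
  by case: (leqP #|comp x| #|comp y|) => h; [exists x|exists y] => //; lia.
pose P := comp u.
have PA : P \subset A := compA u uA.
have PN : P \subset N by apply: fintype.subset_trans PA (subsetDl _ _).
have degP z : z \in P -> 9 * #|N| <= 20 * #|nbhd P e z|.
  move=> zP; have zA := subsetP PA z zP; have zN := subsetP PN z zP.
  have : #|nbhd N e z| <= #|nbhd P e z| + #|X|.
    rewrite -(cardsID X (nbhd N e z)) addnC; apply: leq_add; apply: subset_leq_card.
      apply/subsetP=> w; rewrite !inE => /and3P[wX wN zw]; rewrite zw andbT.
      move: zP; rewrite inE => uz; apply: connect_trans uz _; apply: connect1.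
      by rewrite /rel_in zA /A inE wX wN.
    by apply/subsetP=> w; rewrite !inE => /andP[].
  by have := deg z zN; clear -Xs; lia.
have uP : u \in P by rewrite inE connect0.
have P9 : 9 * #|N| <= 20 * #|P|.
  apply: leq_trans (degP u uP) _; rewrite leq_pmul2l //; apply: subset_leq_card.
  by apply/subsetP=> w; rewrite inE => /andP[].
have N_gt0 : 0 < #|N| by rewrite card_gt0.
have PN2 : 2 * #|P| <= #|N| by [].
exists P; split => //; last by move=> z /degP; clear -PN2; lia.
move=> X' X'P X's a b aP bP.
have [aP' aX] : a \in P /\ a \notin X' by move: aP; rewrite inE => /andP[].
have [bP' bX] : b \in P /\ b \notin X' by move: bP; rewrite inE => /andP[].
have cX' := card_setD_sub X'P.
have nb z : z \in P -> #|nbhd P e z| <= #|nbhd (P :\: X') e z| + #|X'|.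
  move=> _; apply: leq_trans (card_nbhdI z (subsetDl P X')) _; rewrite leq_add2l.
  by apply: subset_leq_card; apply/subsetP=> w; rewrite !in_setD; case: (w \in X') => //=; case: (w \in P).
have [z zA /andP[az bz]] : exists2 z, z \in P :\: X' & e a z && e b z.
  apply: common_nbr.
  have arith (n p u' q a0 b0 a1 b1 : nat) : 0 < n -> 2 * p <= n -> 20 * u' <= p ->
      q + u' = p -> 9 * n <= 20 * a0 -> 9 * n <= 20 * b0 -> a0 <= a1 + u' -> b0 <= b1 + u' ->
      q < a1 + b1 by clear; lia.
  exact: (arith _ _ _ _ _ _ _ _ N_gt0 PN2 X's cX' (degP a aP') (degP b bP') (nb a aP') (nb b bP')).
apply: (@connect_trans _ _ z); apply: connect1; first by rewrite /rel_in aP zA.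
by rewrite /rel_in bP zA es.
Qed.

(* Among three vertices two have a common neighbour, so on a shortest path
   there are no vertices at distances 0, 3 and 6 from the start. *)
Lemma short_connection A x y :
  (forall z, z \in A -> #|A| < 3 * #|nbhd A e z|) -> conn_in e A -> x \in A -> y \in A ->
  exists C, [/\ C \subset A, x \in C, y \in C, #|C| <= 6 & conn_in e C].
Proof.
move=> deg cA xA yA.
have : exists n, [exists p : n.-tuple V, path (rel_in e A) x p && (last x p == y)].
  have /connectP[p xp ->] := cA x y xA yA.
  by exists (size p); apply/existsP; exists (in_tuple p); rewrite xp eqxx.
move=> /ex_minnP[n /existsP[p0 /andP[xp /eqP py]] pmin].
have [p [sp xp' py']] : exists p : seq V, [/\ size p = n, path (rel_in e A) x p & last x p = y].
  by exists p0; rewrite size_tuple; split=> //; exact/eqP.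
have {}pmin q : path (rel_in e A) x q -> last x q = y -> n <= size q.
  by move=> xq qy; apply: pmin; apply/existsP; exists (in_tuple q); rewrite xq qy eqxx.
have pathA u q : u \in A -> path (rel_in e A) u q -> [set z in u :: q] \subset A.
  move=> uA uq; apply/subsetP=> z; rewrite inE.
  elim: q u uA uq => [|w q IH] u uA /=; first by rewrite inE => _ /eqP ->.
  move=> /andP[/and3P[_ wA _] wq]; rewrite inE => /predU1P[-> //|]; exact: IH wq.
have pathC u q : path (rel_in e A) u q -> conn_in e [set z in u :: q].
  elim: q u => [|w q IH] u /=; first by move=> _; rewrite set_cons set_nil setU0; exact: conn_in1.
  move=> /andP[/and3P[_ _ uw] wq]; rewrite set_cons.
  by apply: (conn_inU es (@conn_in1 _ e u) (IH w wq) _ _ uw); rewrite !inE eqxx.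
have [n5|n6] := leqP n 5.
  exists [set z in x :: p]; split; [exact: pathA|by rewrite !inE eqxx| |..|exact: pathC].
    by rewrite inE -py' mem_last.
  by rewrite cardsE; apply: leq_trans (card_size _) _; rewrite /= sp.
case: p sp xp' py' => [|p1 [|p2 [|p3 [|p4 [|p5 [|p6 q]]]]]] /= sp; try by clear -n6 sp; lia.
move=> /andP[r1 /andP[r2 /andP[r3 /andP[r4 /andP[r5 /andP[r6 rq]]]]]] ql.
have [p3A p6A] : p3 \in A /\ p6 \in A by case/and3P: r3; case/and3P: r6.
have no1 w : w \in nbhd A e x -> w \in nbhd A e p3 -> False.
  rewrite !inE => /andP[wA xw] /andP[_ pw].
  have := pmin [:: w, p3, p4, p5, p6 & q]; rewrite /= r4 r5 r6 rq ql.
  by rewrite {1 2}/rel_in xA wA p3A xw es pw => /(_ isT erefl); clear -sp; lia.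
have no2 w : w \in nbhd A e p3 -> w \in nbhd A e p6 -> False.
  rewrite !inE => /andP[wA xw] /andP[_ pw].
  have := pmin [:: p1, p2, p3, w, p6 & q]; rewrite /= r1 r2 r3 rq ql.
  by rewrite {1 2}/rel_in p3A wA p6A xw es pw => /(_ isT erefl); clear -sp; lia.
have no3 w : w \in nbhd A e x -> w \in nbhd A e p6 -> False.
  rewrite !inE => /andP[wA xw] /andP[_ pw].
  have := pmin [:: w, p6 & q]; rewrite /= rq ql.
  by rewrite {1 2}/rel_in xA wA p6A xw es pw => /(_ isT erefl); clear -sp; lia.
have dI (B C : {set V}) : (forall w, w \in B -> w \in C -> False) -> #|B :|: C| = #|B| + #|C|.
  move=> BC; rewrite cardsU (_ : B :&: C = set0) ?cards0 ?subn0 //.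
  by apply/setP=> w; rewrite !inE; apply/negbTE/negP=> /andP[/BC].
have : #|(nbhd A e x :|: nbhd A e p3) :|: nbhd A e p6| <= #|A|.
  by apply: subset_leq_card; apply/subsetP=> w; rewrite !inE => /orP[/orP[]|] /andP[].
rewrite dI; last by move=> w; rewrite in_setU => /orP[/no3|/no2].
rewrite dI; last by move=> w /no1.
by have := deg x xA; have := deg p3 p3A; have := deg p6 p6A; clear; lia.
Qed.

Lemma card_ffun_range (s : nat) (Y : {set V}) :
  #|[set f : {ffun 'I_s -> V} | [forall k, f k \in Y]]| = #|Y| ^ s.
Proof.
rewrite -[in RHS](card_ord s) -card_ffun_on; apply: eq_card => f.
by rewrite inE; apply/forallP/ffun_onP.
Qed.

(** * Random branch sets *)

Section Greedy.
Variables (N : {set V}) (m t : nat).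
Hypotheses (m_gt0 : 2 < m) (t_le : 2 * t <= 2 ^ (2 * m * (m - 2))).
Hypothesis N_big : 120 * (2 * m) * t <= #|N|.
Hypothesis N_robust : robust N.
Hypothesis N_deg : forall x, x \in N -> 2 * #|N| <= 5 * #|nbhd N e x|.
Let s := 2 * m.

Definition undominated B : {set V} := [set v in N | [forall b in B, ~~ e b v]].

(** The size is that of [s] connections of at most six vertices each; by the last clause, all but a
    fraction [2 ^ (1 - m)] of [N] has a neighbour in [B]. *)
Definition good_branch B :=
  [/\ B \subset N, B != set0, conn_in e B, #|B| <= 6 * s & #|undominated B| * 2 ^ m <= 2 * #|N|].

Lemma undominatedS A B : A \subset B -> undominated B \subset undominated A.
Proof.
move=> /subsetP AB; apply/subsetP=> v; rewrite !inE => /andP[-> /forall_inP h] /=.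
by apply/forall_inP=> a /AB; exact: h.
Qed.

(* Averaging: the number of vertices missed by [s] random vertices of [Y]. *)
Lemma sum_undominated (Y : {set V}) : Y \subset N -> 20 * #|N| <= 20 * #|Y| + #|N| ->
  (\sum_(f : {ffun 'I_s -> V} | [forall k, f k \in Y])
      #|undominated [set f k | k : 'I_s]|) * 2 ^ m <= #|N| * #|Y| ^ s.
Proof.
move=> YN Ybig.
have -> : \sum_(f : {ffun 'I_s -> V} | [forall k, f k \in Y]) #|undominated [set f k | k : 'I_s]| =
    \sum_(v in N) #|Y :\: nbhd Y e v| ^ s.
  transitivity (\sum_(f : {ffun 'I_s -> V} | [forall k, f k \in Y])
     \sum_(v in N) [forall k, ~~ e (f k) v]).
    apply: eq_bigr => f _; rewrite -sum1_card big_mkcond [RHS]big_mkcond.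
    apply: eq_bigr => v _; rewrite inE; case: (v \in N) => //=.
    rewrite (_ : [forall b in _, _] = [forall k, ~~ e (f k) v]); first by case: ifP.
    apply/forall_inP/forallP=> h; first by move=> k; apply: h; exact: imset_f.
    by move=> _ /imsetP[k _ ->].
  rewrite exchange_big; apply: eq_bigr => v vN; rewrite -card_ffun_range -sum1_card.
  rewrite big_mkcond [RHS]big_mkcond; apply: eq_bigr => f _; rewrite inE.
  case: ifP => [/forallP fY|nY].
    have -> : [forall k, f k \in Y :\: nbhd Y e v] = [forall k, ~~ e (f k) v].
      by apply: eq_forallb => k; rewrite !inE fY /= andbT es.
    by case: ifP.
  rewrite ifF //; apply/negbTE; move/negbT: nY; apply: contra => /forallP h.
  by apply/forallP=> k; have := h k; rewrite inE => /andP[].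
rewrite big_distrl /= -sum_nat_const; apply: leq_sum => v vN.
(* A vertex has at least [2 / 5 - 1 / 20 = 7 / 20] of [#|N|] as neighbours in [Y]. Since
   [(13 / 20) ^ 2 < 1 / 2], two random points halve the chance of missing it, which explains
   [s = 2 m]. *)
have a_le : 20 * #|Y :\: nbhd Y e v| <= 13 * #|Y|.
  have YNc := card_setD_sub YN.
  have := card_nbhdI v YN; have := N_deg vN; have := subset_leq_card YN.
  have nY : nbhd Y e v \subset Y by apply/subsetP=> z; rewrite inE => /andP[].
  have := card_setD_sub nY; clear -YNc Ybig; lia.
rewrite /s !expnM -expnMn leq_exp2r ?(ltnW (ltnW m_gt0)) //.
rewrite !expnS expn0 !muln1; move: a_le; move: #|_ :\: _| #|Y| => a y h.
have : (20 * a) * (20 * a) <= (13 * y) * (13 * y) by apply: leq_mul.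
clear; lia.
Qed.

Lemma greedy_step (Bs : seq {set V}) : size Bs < t -> {in Bs, forall B, good_branch B} ->
  exists2 B, good_branch B & all (joinable e B) Bs.
Proof.
move=> Bt Bgood; pose U := \bigcup_(B <- Bs) B.
have UN : U \subset N.
  apply/subsetP=> z; rewrite /U big_seq; elim/big_ind: _ => [|A B hA hB|B /Bgood[/subsetP BN _ _ _ _]].
  - by rewrite inE.
  - by rewrite inE => /orP[].
  - exact: BN.
have Ucard : #|U| <= 6 * s * size Bs.
  rewrite /U; elim: (Bs) Bgood => [|B Cs IH] h; first by rewrite big_nil cards0.
  rewrite big_cons; apply: leq_trans (leq_card_setU _ _) _.
  have [_ _ _ Bs6 _] := h B (mem_head _ _).
  rewrite /= mulnS; apply: leq_add Bs6 (IH _) => C CC; apply: h.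
  by rewrite inE CC orbT.
have U20 : 20 * #|U| <= #|N|.
  have sB : s * size Bs <= s * t by rewrite leq_mul2l (ltnW Bt) orbT.
  by move: N_big; rewrite -/s; clear -Ucard sB; lia.
pose Y := N :\: U.
have YN : Y \subset N := subsetDl _ _.
have Ycard : #|Y| + #|U| = #|N| by exact: card_setD_sub.
have Ybig : 20 * #|N| <= 20 * #|Y| + #|N| by clear -Ycard U20; lia.
have sum_le := sum_undominated YN Ybig.
have t_gt0 : 0 < t by exact: leq_ltn_trans Bt.
have N_gt0 : 0 < #|N| by apply: leq_trans N_big; rewrite !muln_gt0 t_gt0 /= (ltnW (ltnW m_gt0)).
have Y_gt0 : 0 < #|Y| by clear -Ybig N_gt0; lia.
pose F := [set f : {ffun 'I_s -> V} | [forall k, f k \in Y]].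
have cF : #|F| = #|Y| ^ s by exact: card_ffun_range.
have Ys_gt0 : 0 < #|Y| ^ s by rewrite expn_gt0 Y_gt0.
pose im (f : {ffun 'I_s -> V}) := [set f k | k : 'I_s].
pose bad1 := [set f in F | 2 * #|N| < #|undominated (im f)| * 2 ^ m].
pose bad2 B := [set f : {ffun 'I_s -> V} | [forall k, f k \in undominated B]].
(* Markov's inequality: the threshold is twice the bound on the mean. *)
have b1 : 2 * #|bad1| <= #|Y| ^ s.
  have : \sum_(f in bad1) 2 * #|N| <= #|N| * #|Y| ^ s.
    apply: leq_trans sum_le; rewrite big_distrl /= big_mkcond [leqRHS]big_mkcond.
    apply: leq_sum => f _; rewrite !inE; case: ifP => [/andP[-> /ltnW //]|_].
    by case: ifP.
  by rewrite sum_nat_const mulnCA [#|bad1| * _]mulnC mulnCA leq_pmul2l.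
(* Missing [B] confines all points to [undominated B], at most a fraction [2 ^ (2 - m)] of [#|Y|];
   the power [2 m] brings this below [1 / (2 t)]. *)
have b2 B : B \in Bs -> 2 * t * #|bad2 B| <= #|Y| ^ s.
  move=> /Bgood[_ _ _ _ und]; rewrite card_ffun_range.
  have h : #|undominated B| * 2 ^ (m - 2) <= #|Y|.
    have m4 : 2 ^ m = 2 ^ (m - 2) * 4 by rewrite -{1}(@subnK 2 m) ?expnD //; exact: ltnW.
    by rewrite m4 in und; clear -und Ybig; lia.
  apply: leq_trans (_ : 2 ^ (2 * m * (m - 2)) * #|undominated B| ^ s <= _).
    by rewrite leq_mul2r t_le orbT.
  rewrite mulnC [2 * m * _]mulnC expnM -/s -expnMn leq_exp2r //.
  by rewrite /s muln_gt0 /= (ltnW (ltnW m_gt0)).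
have [f fF fgood] : exists2 f, f \in F & f \notin bad1 :|: \bigcup_(B <- Bs) bad2 B.
  apply/subsetPn; apply: contraTN (leqnn 1) => sub; rewrite -ltnNge.
  have := subset_leq_card sub; rewrite cF.
  have : 2 * t * #|\bigcup_(B <- Bs) bad2 B| <= size Bs * #|Y| ^ s.
    elim: (Bs) b2 => [|B Cs IH] h; first by rewrite big_nil cards0 muln0.
    rewrite big_cons; apply: leq_trans (leq_mul (leqnn _) (leq_card_setU _ _)) _.
    rewrite mulnDr /= mulSn; apply: leq_add; first by apply: h; rewrite mem_head.
    by apply: IH => C CC; apply: h; rewrite inE CC orbT.
  have : size Bs * #|Y| ^ s < t * #|Y| ^ s by rewrite ltn_pmul2r.
  have := leq_card_setU bad1 (\bigcup_(B <- Bs) bad2 B).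
  have arith (y b u w z : nat) : 2 * b <= y -> u <= b + w -> z < t * y -> 2 * t * w <= z ->
      ~~ (y <= u).
    move=> h1 h2 h3 h4; rewrite -ltnNge; apply: contraLR h3; rewrite -!leqNgt => h5.
    by apply: leq_trans h4; rewrite mulnAC mulnC leq_mul2r; apply/orP; right; clear -h1 h2 h5; lia.
  by move=> h1 h2 h3 h4; have := arith _ _ _ _ _ b1 h1 h2 h3; rewrite h4.
move: fF; rewrite inE => /forallP fY.
move: fgood; rewrite in_setU negb_or => /andP[fb1 fb2].
have fund : #|undominated (im f)| * 2 ^ m <= 2 * #|N|.
  by move: fb1; rewrite !inE (_ : [forall k, f k \in Y]) /= -?leqNgt //; apply/forallP.
have s_gt0 : 0 < s by rewrite /s muln_gt0 /= (ltnW (ltnW m_gt0)).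
pose k0 : 'I_s := Ordinal s_gt0.
have Yconn : conn_in e Y by apply: N_robust.
have Ydeg z : z \in Y -> #|Y| < 3 * #|nbhd Y e z|.
  move=> zY; have := N_deg (subsetP YN z zY); have := card_nbhdI z YN.
  have : #|N :\: Y| <= #|U|.
    by apply: subset_leq_card; apply/subsetP=> w; rewrite !inE; case: (w \in N); rewrite ?andbT ?andbF //= negbK.
  clear -U20 Ycard N_gt0; lia.
(* All connections start at the same point [f k0], so their union is connected. *)
have /boolp.choice[Cf CfP] : forall k : 'I_s, exists C : {set V},
    [/\ C \subset Y, f k0 \in C, f k \in C, #|C| <= 6 & conn_in e C].
  by move=> k; apply: short_connection.
pose B := \bigcup_(k < s) Cf k.
have fB k : f k \in B by apply/bigcupP; exists k => //; have [] := CfP k.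
have BY : B \subset Y.
  by apply/bigcupsP=> k _; have [] := CfP k.
exists B.
  split.
  - exact: fintype.subset_trans BY YN.
  - by apply/set0Pn; exists (f k0).
  - move=> a b aB bB.
    have tof c : c \in B -> connect (rel_in e B) c (f k0).
      case/bigcupP=> k _ cC; have [_ k0C _ _ Cc] := CfP k.
      have := Cc c (f k0) cC k0C; apply: connect_sub => u w /and3P[uC wC uw].
      apply: connect1; rewrite /rel_in uw andbT; apply/andP; split; apply/bigcupP; by exists k.
    by apply: connect_trans (tof a aB) _; rewrite conn_in_sym; exact: tof.
  - apply: leq_trans (_ : \sum_(k < s) #|Cf k| <= _).
      rewrite /B; elim/big_rec2: _ => [|k n C _ h]; first by rewrite cards0.
      by apply: leq_trans (leq_card_setU _ _) _; rewrite leq_add2l.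
    apply: (@leq_trans (\sum_(k < s) 6)); first by apply: leq_sum => k _; have [] := CfP k.
    by rewrite sum_nat_const card_ord mulnC.
  - apply: leq_trans fund; rewrite leq_mul2r; apply/orP; right.
    apply: subset_leq_card; apply: undominatedS; apply/subsetP=> _ /imsetP[k _ ->]; exact: fB.
apply/allP=> C CBs.
have [CN _ _ _ _] := Bgood C CBs.
have : f \notin bad2 C.
  move: fb2; apply: contra => fC.
  by elim: (Bs) CBs => // D Ds IH; rewrite inE big_cons inE => /predU1P[<-|/IH ->]; rewrite ?fC ?orbT.
rewrite inE negb_forall => /existsP[k]; have fkN : f k \in N by exact: subsetP YN _ (fY k).
rewrite inE fkN negb_forall => /existsP[c]; rewrite negb_imply negbK => /andP[cC cf].
apply: (joinable_intro (x := f k) (y := c)) => //; last by rewrite es.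
move=> z /(subsetP BY); rewrite inE => /andP[zU _]; apply: contra zU => zC.
by rewrite /U; elim: (Bs) CBs => // D Ds IH; rewrite inE big_cons inE => /predU1P[<-|/IH ->]; rewrite ?zC ?orbT.
Qed.

Lemma greedy_family j : j <= t -> exists2 Bs, size Bs = j &
  {in Bs, forall B, good_branch B} /\ pairwise (joinable e) Bs.
Proof.
elim: j => [|j IH] jt; first by exists [::].
have [Bs sBs [Bg Bp]] := IH (ltnW jt).
have [|B Bgood Bj] := greedy_step _ Bg; first by rewrite sBs.
exists (B :: Bs); rewrite /= ?sBs // Bj Bp; split => // C; rewrite inE => /predU1P[->//|]; exact: Bg.
Qed.

End Greedy.

End DenseGraph.

(* The Kostochka-Thomason theorem up to constants. *)
Lemma dense_clique_minor (G M : graph) (m t k : nat) : is_minor M G -> 0 < #|M| -> 0 < t ->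
  2 < m -> 2 * t <= 2 ^ (2 * m * (m - 2)) -> 534 * m * t <= k ->
  2 * k * #|M| <= #|arcs M| -> is_minor (complete_graph t) G.
Proof.
move=> MG M0 t0 m2 tm km dens.
have k0 : 0 < k by apply: leq_trans km; rewrite !muln_gt0 t0 /= (ltnW (ltnW m2)).
have := @critical_minor G M k 0 1 k0 isT (leq0n _) [set: M] (@adj M) (@adj_sym M) (@adj_irrefl M)
  (is_minor_minor_on MG); rewrite arcs_on_setT cardsT addn0 => /(_ dens M0).
move=> [S [e [es ei mS S1 [lo up cn dg]]]]; rewrite !addn0 in lo up.
have arcs_le := arcs_on_le S ei.
have S2 : 1 < #|S|.
  rewrite ltn_neqAle S1 andbT; apply/eqP=> h; move: lo arcs_le; rewrite -h /=; lia.
have [v vS v2k] : exists2 v, v \in S & #|nbhd S e v| <= 2 * k.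
  by apply: min_degree_vertex; rewrite // mulSn; lia.
have kv := dg S2 v vS; pose N := nbhd S e v.
have NS : N \subset S by apply/subsetP=> z; rewrite inE => /andP[].
have Ndeg x : x \in N -> #|N| <= 2 * #|nbhd N e x|.
  rewrite inE => /andP[xS vx]; apply: leq_trans v2k _; rewrite leq_pmul2l //.
  apply: leq_trans (cn S2 v x vS xS vx) _; apply: subset_leq_card.
  by apply/subsetP=> y; rewrite !inE => /andP[/andP[-> ->] /andP[_ ->]].
have N0 : N != set0 by rewrite -card_gt0; apply: leq_ltn_trans kv.
have [N' [N'N N'big N'rob N'deg]] := robust_subset es N0 Ndeg.
(* Origin of 534: nine twentieths of it must be at least 240. *)
have big : 120 * (2 * m) * t <= #|N'| by move: kv; rewrite -/N; lia.
have [Bs sBs [Bg Bp]] := greedy_family es m2 tm big N'rob N'deg (leqnn t).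
rewrite -sBs; apply: (minor_on_clique es mS _ Bp) => B /Bg[BN B0 Bc _ _]; split => //.
exact: fintype.subset_trans BN (fintype.subset_trans N'N NS).
Qed.

(** * Orientations of five points *)

Local Open Scope ring_scope.

(* Brute force over the signs of the ten triples of five points. *)
Definition all_bool (f : bool -> bool) := f true && f false.

Lemma all_bool_elim f : all_bool f -> forall b, f b.
Proof. by case/andP=> ft ff []. Qed.

Lemma all_bool10_elim (F : bool -> bool -> bool -> bool -> bool -> bool -> bool -> bool ->
    bool -> bool -> bool) :
  all_bool (fun b0 => all_bool (fun b1 => all_bool (fun b2 => all_bool (fun b3 =>
  all_bool (fun b4 => all_bool (fun b5 => all_bool (fun b6 => all_bool (fun b7 =>
  all_bool (fun b8 => all_bool (fun b9 => F b0 b1 b2 b3 b4 b5 b6 b7 b8 b9)))))))))) ->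
  forall b0 b1 b2 b3 b4 b5 b6 b7 b8 b9, F b0 b1 b2 b3 b4 b5 b6 b7 b8 b9.
Proof.
move=> H b0 b1 b2 b3 b4 b5 b6 b7 b8 b9.
exact: (all_bool_elim (all_bool_elim (all_bool_elim (all_bool_elim (all_bool_elim
  (all_bool_elim (all_bool_elim (all_bool_elim (all_bool_elim (all_bool_elim H b0)
  b1) b2) b3) b4) b5) b6) b7) b8) b9).
Qed.

Section Orientation.
Variable R : realFieldType.
Implicit Types a b c d : R * R.

Definition det3 a b c : R := (b.1 - a.1) * (c.2 - a.2) - (b.2 - a.2) * (c.1 - a.1).

Definition orient a b c : bool := 0 < det3 a b c.

Definition crosses a b c d : bool :=
  (orient a b c != orient a b d) && (orient c d a != orient c d b).

Definition in_triangle x a b c : bool :=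
  (orient a b x == orient b c x) && (orient b c x == orient c a x).

Lemma det3_rot a b c : det3 b c a = det3 a b c.
Proof. by rewrite /det3; ring. Qed.

Lemma det3_swap a b c : det3 b a c = - det3 a b c.
Proof. by rewrite /det3; ring. Qed.

Lemma orient_rot a b c : orient b c a = orient a b c.
Proof. by rewrite /orient det3_rot. Qed.

Lemma orient_swap a b c : det3 a b c != 0 -> orient b a c = ~~ orient a b c.
Proof. by rewrite /orient (det3_swap a b) oppr_gt0; case: ltgtP. Qed.

(* The sign patterns of the ten triples of five points in general position are
   constrained by the affine dependence of four points and by the
   Grassmann-Plucker relations. *)
Definition affine_signs (bcd acd abd abc : bool) : bool :=
  ~~ [&& bcd == ~~ acd, bcd == abd & bcd == ~~ abc].

Definition plucker_signs (abc ade abd ace abe acd : bool) : bool :=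
  ~~ [&& (abc == ade) == ~~ (abd == ace) & (abc == ade) == (abe == acd)].

Lemma affine_signsP a b c d :
  det3 a b c != 0 -> det3 a b d != 0 -> det3 a c d != 0 -> det3 b c d != 0 ->
  affine_signs (orient b c d) (orient a c d) (orient a b d) (orient a b c).
Proof.
have : det3 b c d - det3 a c d + det3 a b d - det3 a b c = 0 by rewrite /det3; ring.
rewrite /affine_signs /orient.
move: (det3 a b c) (det3 a b d) (det3 a c d) (det3 b c d) => x y z w.
by case: (ltgtP 0 x) => // ?; case: (ltgtP 0 y) => // ?; case: (ltgtP 0 z) => // ?;
  case: (ltgtP 0 w) => //= ? *; lra.
Qed.

Lemma plucker_signsP a b c d e :
  det3 a b c != 0 -> det3 a d e != 0 -> det3 a b d != 0 -> det3 a c e != 0 ->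
  det3 a b e != 0 -> det3 a c d != 0 ->
  plucker_signs (orient a b c) (orient a d e) (orient a b d) (orient a c e)
    (orient a b e) (orient a c d).
Proof.
have : det3 a b c * det3 a d e - det3 a b d * det3 a c e + det3 a b e * det3 a c d = 0.
  by rewrite /det3; ring.
have sg (x y : R) : x != 0 -> y != 0 -> ((0 < x) == (0 < y)) = (0 < x * y).
  case: (ltgtP 0 x) => // x0 _; case: (ltgtP 0 y) => // y0 _; apply/esym.
  - by rewrite mulr_gt0.
  - by apply/negbTE; rewrite -leNgt; nra.
  - by apply/negbTE; rewrite -leNgt; nra.
  - by rewrite nmulr_lgt0.
move=> eq0 n1 n2 n3 n4 n5 n6; rewrite /plucker_signs /orient (sg _ _ n1 n2) (sg _ _ n3 n4) (sg _ _ n5 n6).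
move: (mulf_neq0 n1 n2) (mulf_neq0 n3 n4) (mulf_neq0 n5 n6) eq0.
move: (_ * _) (_ * _) (_ * _) => x y z.
by case: (ltgtP 0 x) => // ?; case: (ltgtP 0 y) => // ?; case: (ltgtP 0 z) => //= ? *; lra.
Qed.

Definition generic5 p0 p1 p2 p3 p4 : Prop :=
  [/\ [/\ det3 p0 p1 p2 != 0, det3 p0 p1 p3 != 0, det3 p0 p1 p4 != 0 & det3 p0 p2 p3 != 0],
      [/\ det3 p0 p2 p4 != 0, det3 p0 p3 p4 != 0 & det3 p1 p2 p3 != 0] &
      [/\ det3 p1 p2 p4 != 0, det3 p1 p3 p4 != 0 & det3 p2 p3 p4 != 0]].

Lemma orient_perm a b c : det3 a b c != 0 ->
  ((orient a c b = ~~ orient a b c) * (orient b a c = ~~ orient a b c) *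
   (orient b c a = orient a b c) * (orient c a b = orient a b c) *
   (orient c b a = ~~ orient a b c))%type.
Proof.
move=> h; have acb : orient a c b = ~~ orient a b c.
  by rewrite orient_rot orient_swap.
have cba : orient c b a = ~~ orient a b c by rewrite -acb -(orient_rot a c b).
split; [split; [split; [split|]|]|].
- exact: acb.
- exact: orient_swap.
- exact: orient_rot.
- by rewrite -(orient_rot c a b).
- exact: cba.
Qed.

(** The straight-line drawing of [K_5] has an odd number of crossings among its fifteen pairs of
    disjoint edges. The affine constraints of the five quadruples alone imply this for all sign
    patterns. *)
Lemma crosses_K5 p0 p1 p2 p3 p4 : generic5 p0 p1 p2 p3 p4 ->
  xorb (xorb (xorb (crosses p0 p1 p2 p3) (xorb (crosses p0 p2 p1 p3) (crosses p0 p3 p1 p2)))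
             (xorb (crosses p0 p1 p2 p4) (xorb (crosses p0 p2 p1 p4) (crosses p0 p4 p1 p2))))
  (xorb (xorb (xorb (crosses p0 p1 p3 p4) (xorb (crosses p0 p3 p1 p4) (crosses p0 p4 p1 p3)))
             (xorb (crosses p0 p2 p3 p4) (xorb (crosses p0 p3 p2 p4) (crosses p0 p4 p2 p3))))
     (xorb (crosses p1 p2 p3 p4) (xorb (crosses p1 p3 p2 p4) (crosses p1 p4 p2 p3)))) = true.
Proof.
move=> [[n1 n2 n3 n4] [n5 n6 n7] [n8 n9 n10]].
move: (affine_signsP n1 n2 n4 n7); apply/implyP; move: (affine_signsP n1 n3 n5 n8); apply/implyP.
move: (affine_signsP n2 n3 n6 n9); apply/implyP; move: (affine_signsP n4 n5 n6 n10); apply/implyP.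
move: (affine_signsP n7 n8 n9 n10); apply/implyP; rewrite /crosses !(orient_perm n1) !(orient_perm n2) !(orient_perm n3) !(orient_perm n4)
  !(orient_perm n5) !(orient_perm n6) !(orient_perm n7) !(orient_perm n8) !(orient_perm n9)
  !(orient_perm n10).
move: (orient p0 p1 p2) (orient p0 p1 p3) (orient p0 p1 p4) (orient p0 p2 p3) (orient p0 p2 p4)
 (orient p0 p3 p4) (orient p1 p2 p3) (orient p1 p2 p4) (orient p1 p3 p4) (orient p2 p3 p4).
by apply: all_bool10_elim; vm_compute.
Qed.

(* The boundary of a triangle is crossed an odd number of times by a segment
   exactly when one end is inside and the other one outside. *)
Lemma crosses_triangle a a' o b b' : generic5 a a' o b b' ->
  crosses a a' b b' = xorb (xorb (in_triangle a o b b') (in_triangle a' o b b'))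
                           (xorb (crosses a a' o b) (crosses a a' o b')).
Proof.
move=> [[n1 n2 n3 n4] [n5 n6 n7] [n8 n9 n10]].
apply/eqP; move: (affine_signsP n1 n2 n4 n7); apply/implyP.
move: (affine_signsP n1 n3 n5 n8); apply/implyP; move: (affine_signsP n2 n3 n6 n9); apply/implyP.
move: (affine_signsP n4 n5 n6 n10); apply/implyP; move: (affine_signsP n7 n8 n9 n10); apply/implyP.
move: (plucker_signsP n1 n6 n2 n5 n3 n4); apply/implyP.
have := @plucker_signsP a' a o b b'; rewrite 3!(det3_swap a) !oppr_eq0.
move=> /(_ n1 n9 n2 n8 n3 n7); apply/implyP.
rewrite /crosses /in_triangle !(orient_perm n1) !(orient_perm n2) !(orient_perm n3)
  !(orient_perm n4) !(orient_perm n5) !(orient_perm n6) !(orient_perm n7) !(orient_perm n8)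
  !(orient_perm n9).
move: (orient a a' o) (orient a a' b) (orient a a' b') (orient a o b) (orient a o b')
 (orient a b b') (orient a' o b) (orient a' o b') (orient a' b b') (orient o b b').
by apply: all_bool10_elim; vm_compute.
Qed.

Lemma crosses_rev a b c d :
  det3 a b c != 0 -> det3 a b d != 0 -> crosses b a c d = crosses a b c d.
Proof.
move=> n1 n2; rewrite /crosses (orient_swap n1) (orient_swap n2); congr (_ && _); last by rewrite eq_sym.
by case: orient; case: orient.
Qed.

Lemma crosses_sym a b c d : crosses c d a b = crosses a b c d.
Proof. by rewrite /crosses andbC. Qed.

(** The intersection point lies at parameter [s] on the segment [a b] and [t] on [c d], so
    [a - c = t (d - c) - s (b - a)] with both parameters in the unit interval. This converts a
    crossing back into a distance. *)
Lemma crosses_close a b c d :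
  det3 a b c != 0 -> det3 a b d != 0 -> det3 c d a != 0 -> det3 c d b != 0 ->
  crosses a b c d ->
  `|a.1 - c.1| <= `|b.1 - a.1| + `|d.1 - c.1| /\
  `|a.2 - c.2| <= `|b.2 - a.2| + `|d.2 - c.2|.
Proof.
move=> n1 n2 n3 n4 /andP[h1 h2].
pose s := det3 c d a / (det3 c d a - det3 c d b).
pose t := det3 a b c / (det3 a b c - det3 a b d).
have frac (x y : R) : x != 0 -> y != 0 -> (0 < x) != (0 < y) ->
    x - y != 0 /\ 0 <= x / (x - y) <= 1.
  move=> x0 y0 xy.
  have [[xp yn]|[xn yp]] : (0 < x /\ y < 0) \/ (x < 0 /\ 0 < y).
    by move: x0 y0 xy; case: (ltgtP 0 x) => //; case: (ltgtP 0 y) => //; auto.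
  - have p : 0 < x - y by lra.
    split; first by rewrite gt_eqF.
    by rewrite divr_ge0 ?ler_pdivrMr //; lra.
  - have p : x - y < 0 by lra.
    split; first by rewrite lt_eqF.
    have -> : x / (x - y) = (- x) / (y - x) by rewrite -[y - x]opprB invrN mulrNN.
    by rewrite divr_ge0 ?ler_pdivrMr //; lra.
have [s0 s1] := frac _ _ n3 n4 h2; have [t0 t1] := frac _ _ n1 n2 h1.
have den : det3 c d a - det3 c d b = - (det3 a b c - det3 a b d) by rewrite /det3; ring.
have sE : s = - det3 c d a / (det3 a b c - det3 a b d).
  by rewrite /s den invrN mulrN mulNr.
have comb (x u v : R) : x * (det3 a b c - det3 a b d) = det3 a b c * v + det3 c d a * u ->
    x = t * v - s * u.
  move=> h; apply: (mulIf t0); rewrite h sE /t; move: t0; set D := _ - _ => D0.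
  by field.
have e1 : a.1 - c.1 = t * (d.1 - c.1) - s * (b.1 - a.1).
  by apply: comb; rewrite /det3; ring.
have e2 : a.2 - c.2 = t * (d.2 - c.2) - s * (b.2 - a.2).
  by apply: comb; rewrite /det3; ring.
have bnd (u v : R) : `|t * v - s * u| <= `|u| + `|v|.
  apply: le_trans (ler_normB _ _) _; rewrite (normrM t) (normrM s) addrC.
  move/andP: s1 => [sp s1]; move/andP: t1 => [tp t1]; rewrite (ger0_norm (sp : 0 <= s)) (ger0_norm (tp : 0 <= t)).
  by apply: lerD; rewrite ler_piMl.
by rewrite e1 e2.
Qed.

End Orientation.

(** * Crossings of polylines *)

Section PathXor.
Variable T : Type.
Implicit Types (f g : T -> T -> bool) (x : T) (s : seq T).

Fixpoint path_xor f x s : bool :=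
  if s is y :: s' then xorb (f x y) (path_xor f y s') else false.

Lemma path_xor_cat f x s t :
  path_xor f x (s ++ t) = xorb (path_xor f x s) (path_xor f (last x s) t).
Proof.
elim: s x => [|y s IH] x /=; first by case: path_xor.
by rewrite IH; btauto.
Qed.

Lemma path_xor_telescope (g : T -> bool) x s :
  path_xor (fun a b => xorb (g a) (g b)) x s = xorb (g x) (g (last x s)).
Proof. by elim: s x => [|y s IH] x /=; [btauto|rewrite IH; btauto]. Qed.

Lemma path_xor_add f g x s :
  path_xor (fun a b => xorb (f a b) (g a b)) x s = xorb (path_xor f x s) (path_xor g x s).
Proof. by elim: s x => [|y s IH] x //=; rewrite IH; btauto. Qed.

Lemma eq_path_xor (r : rel T) f g x s : path r x s ->
  (forall a b, r a b -> f a b = g a b) -> path_xor f x s = path_xor g x s.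
Proof. by move=> + fg; elim: s x => [|y s IH] x //= /andP[/fg -> /IH ->]. Qed.

Lemma path_xor_false f x s : (forall a b, f a b = false) -> path_xor f x s = false.
Proof. by move=> f0; elim: s x => [|y s IH] x //=; rewrite IH f0. Qed.

End PathXor.

Lemma path_xor_true (T : Type) (r : rel T) f x s : path r x s -> path_xor f x s ->
  exists a b, r a b /\ f a b.
Proof.
elim: s x => [|y s IH] x //= /andP[rxy /IH{}IH].
by case E : (f x y) => //= _; exists x, y.
Qed.

Section Polylines.
Variables (R : realFieldType) (P : nat -> R * R) (n : nat).
Hypothesis generic : forall i j k, (i < n)%N -> (j < n)%N -> (k < n)%N ->
  i != j -> i != k -> j != k -> det3 (P i) (P j) (P k) != 0.

Local Notation cr i j k l := (crosses (P i) (P j) (P k) (P l)).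

Definition cross_parity x s y t : bool :=
  path_xor (fun a b => path_xor (fun c d => cr a b c d) y t) x s.

Lemma cross_parity_sym x s y t : cross_parity x s y t = cross_parity y t x s.
Proof.
rewrite /cross_parity; elim: s x => [|z s IH] x /=; first by rewrite path_xor_false.
by rewrite IH path_xor_add; congr xorb; elim: t y {IH} => //= u t IHt y; rewrite IHt crosses_sym.
Qed.

Definition steps_in (A : pred nat) : rel nat := fun a b => [&& A a, A b & a != b].

Variables (o : nat) (A B : pred nat).
Hypotheses (o_lt : (o < n)%N) (oA : ~~ A o) (oB : ~~ B o).
Hypotheses (A_lt : forall i, A i -> (i < n)%N) (B_lt : forall i, B i -> (i < n)%N).
Hypothesis AB : forall i, A i -> ~~ B i.

Let AneB a c : A a -> B c -> a != c.
Proof. by move=> Aa; apply: contraTneq => <-; exact: AB. Qed.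

Let Aneo a : A a -> a != o.
Proof. by move=> Aa; apply: contraTneq Aa => ->. Qed.

Let Bneo a : B a -> a != o.
Proof. by move=> Aa; apply: contraTneq Aa => ->. Qed.

(* By [crosses_triangle], the crossings of a segment with a closed polygon are
   counted by the winding parities of its two ends, which telescope along a
   second closed polygon. *)
Lemma cross_parity_closed x s y t :
  path (steps_in A) x s -> last x s = x -> path (steps_in B) y t -> last y t = y ->
  cross_parity x s y t = false.
Proof.
move=> xs lx yt ly.
(* Parity of the number of triangles, spanned by the apex [o] and the sides of the second polygon,
   that contain [P a]. *)
pose W a := path_xor (fun c d => in_triangle (P a) (P o) (P c) (P d)) y t.
rewrite /cross_parity (eq_path_xor (g := fun a b => xorb (W a) (W b)) xs).
  by rewrite path_xor_telescope lx; case: (W x).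
move=> a b /and3P[Aa Ab ab].
rewrite (eq_path_xor (g := fun c d =>
  xorb (xorb (in_triangle (P a) (P o) (P c) (P d)) (in_triangle (P b) (P o) (P c) (P d)))
       (xorb (cr a b o c) (cr a b o d))) yt).
  rewrite path_xor_add path_xor_add -/(W a) -/(W b) path_xor_telescope ly; btauto.
move=> c d /and3P[Bc Bd cd]; apply: crosses_triangle.
have [na nb nc nd] := And4 (A_lt Aa) (A_lt Ab) (B_lt Bc) (B_lt Bd).
have [ac ad bc bd] := And4 (AneB Aa Bc) (AneB Aa Bd) (AneB Ab Bc) (AneB Ab Bd).
have [ao bo co do_] := And4 (Aneo Aa) (Aneo Ab) (Bneo Bc) (Bneo Bd).
by split; split; apply: generic; rewrite // eq_sym.
Qed.

Let crA a b c d : steps_in A a b -> steps_in B c d -> cr b a c d = cr a b c d.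
Proof.
move=> /and3P[Aa Ab ab] /and3P[Bc Bd cd]; apply: crosses_rev;
by apply: generic; solve [exact: A_lt | exact: B_lt | exact: AneB | done].
Qed.

Let crB a b c d : steps_in A a b -> steps_in B c d -> cr a b d c = cr a b c d.
Proof.
move=> /and3P[Aa Ab ab] /and3P[Bc Bd cd]; rewrite -!(crosses_sym (P a)).
rewrite crosses_rev //; apply: generic;
by solve [exact: A_lt | exact: B_lt | done | rewrite eq_sym; exact: AneB].
Qed.

(** Each polyline is closed by its chord, and two closed polygons cross evenly. The parity thus
    equals that of the chords up to two corrections, each involving one polyline and the other
    chord. *)
Lemma cross_parity_straighten i s j k t l :
  path (steps_in A) i s -> last i s = j -> i != j -> A i ->
  path (steps_in B) k t -> last k t = l -> k != l -> B k ->
  cross_parity i s k t = xorb (cr i j k l)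
   (xorb (xorb (cross_parity i s k [:: l]) (cr i j k l))
         (xorb (cross_parity k t i [:: j]) (cr k l i j))).
Proof.
move=> is_ li ij Ai kt lk kl Bk.
have Aj : A j.
  move: is_ li ij; case: (lastP s) => [_ /= ->|s' z]; first by rewrite eqxx.
  by rewrite rcons_path last_rcons => /andP[_ /and3P[_ Az _]] <-.
have Bl : B l.
  move: kt lk kl; case: (lastP t) => [_ /= ->|t' z]; first by rewrite eqxx.
  by rewrite rcons_path last_rcons => /andP[_ /and3P[_ Bz _]] <-.
have ji : steps_in A j i by rewrite /steps_in Aj Ai eq_sym.
have lk' : steps_in B l k by rewrite /steps_in Bl Bk eq_sym.
have cs : path (steps_in A) i (s ++ [:: i]) by rewrite cat_path is_ li /= ji.
have ct : path (steps_in B) k (t ++ [:: k]) by rewrite cat_path kt lk /= lk'.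
have := cross_parity_closed cs _ ct; rewrite !last_cat => /(_ erefl erefl).
rewrite {1}/cross_parity path_xor_cat li /= -/(cross_parity i s k (t ++ [:: k])).
rewrite (cross_parity_sym i s) {1}/cross_parity path_xor_cat lk /=.
rewrite -/(cross_parity k t i s) path_xor_cat lk /=.
have ij' : steps_in A i j by rewrite /steps_in Ai Aj.
have kl' : steps_in B k l by rewrite /steps_in Bk Bl.
have -> : path_xor (fun c d => cr l k c d) i s = cross_parity i s k [:: l].
  rewrite cross_parity_sym; transitivity (path_xor (fun c d => cr k l c d) i s).
    by apply: (eq_path_xor is_) => a b ab; rewrite !(crosses_sym (P a)); exact: crB ab kl'.
  by rewrite /cross_parity /=; case: path_xor.
have -> : path_xor (fun c d => cr j i c d) k t = cross_parity k t i [:: j].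
  rewrite cross_parity_sym; transitivity (path_xor (fun c d => cr i j c d) k t).
    by apply: (eq_path_xor kt) => a b ab; exact: crA ij' ab.
  by rewrite /cross_parity /=; case: path_xor.
rewrite (crA ij' lk') (crB ij' kl') (crosses_sym (P i)) (cross_parity_sym i s k t).
move: (cross_parity k t i s) (cross_parity i s k [:: l]) (cross_parity k t i [:: j]) (cr i j k l).
by case; case; case; case.
Qed.

(** The polyline closed by its chord crosses the closed triangle [k l m] evenly, so the corrections
    cancel over its three sides. *)
Lemma cross_parity_triangle i s j k l m :
  path (steps_in A) i s -> last i s = j -> i != j -> A i ->
  B k -> B l -> B m -> k != l -> k != m -> l != m ->
  xorb (xorb (cross_parity i s k [:: l]) (cr i j k l))
   (xorb (xorb (cross_parity i s k [:: m]) (cr i j k m))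
         (xorb (cross_parity i s l [:: m]) (cr i j l m))) = false.
Proof.
move=> is_ li ij Ai Bk Bl Bm kl km lm.
have Aj : A j.
  move: is_ li ij; case: (lastP s) => [_ /= ->|s' z]; first by rewrite eqxx.
  by rewrite rcons_path last_rcons => /andP[_ /and3P[_ Az _]] <-.
have ji : steps_in A j i by rewrite /steps_in Aj Ai eq_sym.
have ij' : steps_in A i j by rewrite /steps_in Ai Aj.
have cs : path (steps_in A) i (s ++ [:: i]) by rewrite cat_path is_ li /= ji.
have kl' : steps_in B k l by rewrite /steps_in Bk Bl.
have km' : steps_in B k m by rewrite /steps_in Bk Bm.
have lm' : steps_in B l m by rewrite /steps_in Bl Bm.
have mk' : steps_in B m k by rewrite /steps_in Bk Bm eq_sym.
have ct : path (steps_in B) k [:: l; m; k] by rewrite /= kl' lm' mk'.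
have := cross_parity_closed cs _ ct; rewrite !last_cat => /(_ erefl erefl).
have seg u v : cross_parity i s u [:: v] = path_xor (fun a b => cr a b u v) i s.
  by apply: (eq_path_xor is_) => a b _ /=; case: crosses.
have mkE : path_xor (fun a b => cr a b m k) i s = path_xor (fun a b => cr a b k m) i s.
  by apply: (eq_path_xor is_) => a b ab; exact: crB ab km'.
rewrite !seg /cross_parity path_xor_cat li /= path_xor_add path_xor_add path_xor_add mkE.
rewrite (crA ij' kl') (crA ij' lm') (crA ij' mk') (crB ij' km').
rewrite (@path_xor_false nat (fun _ _ => false) i s) //.
move: (path_xor (fun a b => cr a b k l) i s) (path_xor (fun a b => cr a b k m) i s).
move: (path_xor (fun a b => cr a b l m) i s) (cr i j k l) (cr i j k m) (cr i j l m).
by do 6 case.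
Qed.

End Polylines.

(** * Polyline drawings of K_5 *)

Section PolylineK5.
Variables (R : realFieldType) (P : nat -> R * R) (n : nat).
Hypothesis generic : forall i j k, (i < n)%N -> (j < n)%N -> (k < n)%N ->
  i != j -> i != k -> j != k -> det3 (P i) (P j) (P k) != 0.
(* [poly i j] lists the indices of the polyline from the point [i] to the point
   [j], whose bends are taken from the class [inner i j]. *)
Variables (poly : nat -> nat -> seq nat) (inner : nat -> nat -> pred nat).
Hypothesis n_gt5 : (5 < n)%N.
Let cls i j : pred nat := fun x => [|| x == i, x == j | inner i j x].
Hypothesis poly_path : forall i j, (i < j < 5)%N -> path (steps_in (cls i j)) i (poly i j).
Hypothesis poly_last : forall i j, (i < j < 5)%N -> last i (poly i j) = j.
Hypothesis inner_range : forall i j x, inner i j x -> (5 < x < n)%N.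
Hypothesis inner_disj : forall i j k l x, inner i j x -> inner k l x -> (i, j) = (k, l).

Local Notation cr i j k l := (crosses (P i) (P j) (P k) (P l)).
Local Notation X i j k l := (cross_parity P i (poly i j) k (poly k l)).
Local Notation U i j k l :=
  (xorb (cross_parity P i (poly i j) k [:: l]) (cr i j k l)).

Let cls_lt i j x : (i < 5)%N -> (j < 5)%N -> cls i j x -> (x < n)%N.
Proof.
move=> i5 j5 /or3P[/eqP ->|/eqP ->|/inner_range/andP[_ //]].
- exact: ltn_trans i5 n_gt5.
- exact: ltn_trans j5 n_gt5.
Qed.

(** Index 5 is reserved for the auxiliary apex and lies on no polyline. *)
Let cls5 i j : (i < 5)%N -> (j < 5)%N -> ~~ cls i j 5%N.
Proof.
move=> i5 j5; apply/negP=> /or3P[/eqP e|/eqP e|/inner_range]; last by rewrite ltnn.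
- by rewrite -e in i5.
- by rewrite -e in j5.
Qed.

Let not_inner i j k : (k < 5)%N -> ~~ inner i j k.
Proof. by move=> k5; apply/negP=> /inner_range/andP[h _]; move: k5 h; lia. Qed.

Let straighten i j k l : (i < j < 5)%N -> (k < l < 5)%N -> uniq [:: i; j; k; l] ->
  X i j k l = xorb (cr i j k l) (xorb (U i j k l) (U k l i j)).
Proof.
move=> ij kl; have [/andP[ij' j5] /andP[kl' l5]] := (ij, kl).
have [i5 k5] : (i < 5)%N /\ (k < 5)%N by lia.
rewrite /= !inE !negb_or => /and3P[/and3P[nij nik nil] /andP[njk njl] /andP[nkl _]].
apply: (@cross_parity_straighten R P n generic 5 (cls i j) (cls k l)) => //.
- exact: cls5.
- exact: cls5.
- by move=> x; exact: cls_lt.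
- by move=> x; exact: cls_lt.
- move=> x /or3P[/eqP ->|/eqP ->|xij]; rewrite !negb_or.
  + by rewrite nik nil not_inner.
  + by rewrite njk njl not_inner.
  have /andP[x5 _] := inner_range xij; apply/and3P; split.
  + by apply/eqP=> e; move: x5 k5; rewrite e; lia.
  + by apply/eqP=> e; move: x5 l5; rewrite e; lia.
  + by apply/negP=> h; have e := inner_disj xij h; case: e nik => ->; rewrite eqxx.
- exact: poly_path.
- exact: poly_last.
- by rewrite /cls eqxx.
- exact: poly_path.
- exact: poly_last.
- by rewrite /cls eqxx.
Qed.

Let triangle i j k l m : (i < j < 5)%N -> (k < l)%N -> (l < m < 5)%N ->
  uniq [:: i; j; k; l; m] ->
  xorb (U i j k l) (xorb (U i j k m) (U i j l m)) = false.
Proof.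
move=> ij kl lm; have [/andP[ij' j5] /andP[lm' m5]] := (ij, lm).
have [i5 k5 l5] : [/\ (i < 5)%N, (k < 5)%N & (l < 5)%N] by split; lia.
rewrite /= !inE !negb_or.
move=> /and4P[/and4P[nij nik nil nim] /and3P[njk njl njm] /andP[nkl nkm] /andP[nlm _]].
pose B : pred nat := fun x => [|| x == k, x == l | x == m].
apply: (@cross_parity_triangle R P n generic 5 (cls i j) B) => //.
- exact: cls5.
- by rewrite /B !negb_or !neq_ltn k5 l5 m5 !orbT.
- by move=> x; exact: cls_lt.
- by move=> x /or3P[] /eqP ->; apply: ltn_trans n_gt5.
- move=> x xij; rewrite /B !negb_or; move: xij.
  case/or3P=> [/eqP ->|/eqP ->|/inner_range/andP[x5 _]].
  + by rewrite nik nil nim.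
  + by rewrite njk njl njm.
  + by apply/and3P; split; apply/eqP=> e; move: x5; rewrite e; lia.
- exact: poly_path.
- exact: poly_last.
- by rewrite /cls eqxx.
- by rewrite /B eqxx.
- by rewrite /B eqxx orbT.
- by rewrite /B eqxx !orbT.
Qed.

(** Add [straighten] over the fifteen disjoint pairs. For each edge the corrections run over the
    sides of the opposite triangle and cancel by [triangle]; the odd parity of the straight-line
    drawing remains. *)
Lemma polyline_K5 : exists i j k l,
  [/\ (i < j < 5)%N, (k < l < 5)%N, uniq [:: i; j; k; l] & X i j k l].
Proof.
apply: contrapT => noX.
have X0 i j k l : (i < j < 5)%N -> (k < l < 5)%N -> uniq [:: i; j; k; l] ->
    xorb (cr i j k l) (xorb (U i j k l) (U k l i j)) = false.
  move=> ij kl u; rewrite -straighten //; apply/negbTE/negP=> h; apply: noX.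
  by exists i, j, k, l.
have [p0 p1 p2 p3 p4] : [/\ (0 < n)%N, (1 < n)%N, (2 < n)%N, (3 < n)%N & (4 < n)%N].
  by split; apply: leq_trans n_gt5.
have g5 : generic5 (P 0%N) (P 1%N) (P 2%N) (P 3%N) (P 4%N).
  by split; split; apply: generic.
have := crosses_K5 g5.
have E (b c d : bool) : xorb b (xorb c d) = false -> b = xorb c d by case: b c d => [] [] [].
rewrite (E _ _ _ (X0 0 1 2 3 isT isT isT)%N) (E _ _ _ (X0 0 2 1 3 isT isT isT)%N)
 (E _ _ _ (X0 0 3 1 2 isT isT isT)%N)
 (E _ _ _ (X0 0 1 2 4 isT isT isT)%N) (E _ _ _ (X0 0 2 1 4 isT isT isT)%N)
 (E _ _ _ (X0 0 4 1 2 isT isT isT)%N)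
 (E _ _ _ (X0 0 1 3 4 isT isT isT)%N) (E _ _ _ (X0 0 3 1 4 isT isT isT)%N)
 (E _ _ _ (X0 0 4 1 3 isT isT isT)%N)
 (E _ _ _ (X0 0 2 3 4 isT isT isT)%N) (E _ _ _ (X0 0 3 2 4 isT isT isT)%N)
 (E _ _ _ (X0 0 4 2 3 isT isT isT)%N)
 (E _ _ _ (X0 1 2 3 4 isT isT isT)%N) (E _ _ _ (X0 1 3 2 4 isT isT isT)%N)
 (E _ _ _ (X0 1 4 2 3 isT isT isT)%N).
have T i j k l m ij kl lm u := E _ _ _ (@triangle i j k l m ij kl lm u).
rewrite (T 0 1 2 3 4 isT isT isT isT)%N (T 0 2 1 3 4 isT isT isT isT)%N
  (T 0 3 1 2 4 isT isT isT isT)%N (T 0 4 1 2 3 isT isT isT isT)%N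
  (T 1 2 0 3 4 isT isT isT isT)%N (T 1 3 0 2 4 isT isT isT isT)%N
  (T 1 4 0 2 3 isT isT isT isT)%N (T 2 3 0 1 4 isT isT isT isT)%N
  (T 2 4 0 1 3 isT isT isT isT)%N (T 3 4 0 1 2 isT isT isT isT)%N.
set b := (X in X = true -> _); suff -> : b = false by [].
by rewrite /b; btauto.
Qed.

End PolylineK5.

(** * Polygonal approximation of drawings *)

Definition perturb (R : realFieldType) (Q : nat -> R * R) (eps : R) (i : nat) : R * R :=
  ((Q i).1 + eps * i%:R, (Q i).2 + eps * i%:R ^+ 2).

(* Moving the points along a parabola, a determinant becomes a polynomial in
   [eps] whose leading coefficient is a Vandermonde determinant. *)
Lemma perturb_generic (R : realFieldType) (Q : nat -> R * R) (n : nat) (dl : R) : 0 < dl ->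
  exists2 eps, 0 < eps <= dl &
    forall i j k, (i < n)%N -> (j < n)%N -> (k < n)%N -> i != j -> i != k -> j != k ->
      det3 (perturb Q eps i) (perturb Q eps j) (perturb Q eps k) != 0.
Proof.
move=> dl0.
pose p (i j k : nat) : {poly R} :=
  (((Q j).1 - (Q i).1)%:P + (j%:R - i%:R)%:P * 'X) *
  (((Q k).2 - (Q i).2)%:P + (k%:R ^+ 2 - i%:R ^+ 2)%:P * 'X) -
  (((Q j).2 - (Q i).2)%:P + (j%:R ^+ 2 - i%:R ^+ 2)%:P * 'X) *
  (((Q k).1 - (Q i).1)%:P + (k%:R - i%:R)%:P * 'X).
have pE i j k eps : det3 (perturb Q eps i) (perturb Q eps j) (perturb Q eps k) = (p i j k).[eps].
  by rewrite /p /det3 /perturb !hornerE /=; ring.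
have p0 i j k : i != j -> i != k -> j != k -> p i j k != 0.
  move=> ij ik jk; have neq (a b : nat) : a != b -> b%:R - a%:R != 0 :> R.
    by move=> ab; rewrite subr_eq0 eqr_nat eq_sym.
  apply/eqP=> /(congr1 (fun q : {poly R} => q`_2)); rewrite coef0.
  pose A := (Q j).1 - (Q i).1; pose B := (Q k).2 - (Q i).2.
  pose C := (Q j).2 - (Q i).2; pose D := (Q k).1 - (Q i).1.
  have -> : p i j k = (A * B - C * D)%:P + (A * (k%:R ^+ 2 - i%:R ^+ 2) +
      (j%:R - i%:R) * B - C * (k%:R - i%:R) - (j%:R ^+ 2 - i%:R ^+ 2) * D)%:P * 'X
      + ((j%:R - i%:R) * (k%:R - i%:R) * (k%:R - j%:R))%:P * 'X^2.
    by rewrite /p -/A -/B -/C -/D !(polyCD, polyCN, polyCM); ring.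
  rewrite !coefD !coefCM coefC coefX coefXn /= mulr0 mulr1 !add0r.
  by apply/eqP; rewrite !mulf_neq0 // neq.
pose q : {poly R} := \prod_(t : 'I_n * 'I_n * 'I_n |
  [&& t.1.1 != t.1.2 :> nat, t.1.1 != t.2 :> nat & t.1.2 != t.2 :> nat]) p t.1.1 t.1.2 t.2.
have q0 : q != 0 by apply/prodf_neq0 => t /and3P[]; exact: p0.
(* Infinitely many candidates in the allowed range, more than [q] has roots. *)
pose e m : R := dl / m.+1%:R.
have e_inj : injective e.
  move=> a b /mulfI; rewrite gt_eqF // => /(_ isT) /invr_inj /eqP.
  by rewrite eqr_nat => /eqP[].
have [m] : exists m, ~~ root q (e m).
  apply: contrapT => h; pose rs := [seq e m | m <- iota 0 (size q)].
  have hu : uniq rs by rewrite map_inj_uniq ?iota_uniq.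
  have hr : all (root q) rs.
    by apply/allP=> _ /mapP[m _ ->]; apply/negPn/negP=> hm; apply: h; exists m.
  by have := max_poly_roots q0 hr hu; rewrite size_map size_iota ltnn.
rewrite /root horner_prod => qm; exists (e m).
  rewrite divr_gt0 ?ltr0n //= ler_pdivrMr ?ltr0n // ler_peMr ?ler1n //.
  exact: ltW.
move=> i j k i_n j_n k_n ij ik jk; rewrite pE.
move/prodf_neq0: qm => /(_ (Ordinal i_n, Ordinal j_n, Ordinal k_n)) /=; apply.
by rewrite ij ik jk.
Qed.

Section UnitInterval.
Variable R : realType.
Implicit Types (f g : R -> R * R) (t : R).

(** Compactness of the interval in induction form: near the supremum of the points with property
    [A], the local transfer first reaches the supremum and then passes it. *)
Lemma real_induction01 (A : R -> Prop) : A 0 ->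
  (forall t, 0 <= t <= 1 -> exists2 r, 0 < r &
     forall s s', 0 <= s <= 1 -> 0 <= s' <= 1 -> `|s - t| < r -> `|s' - t| < r -> A s -> A s') ->
  A 1.
Proof.
move=> A0 Aloc; pose T := [set t | 0 <= t <= 1 /\ A t]%classic.
have T0 : T 0 by split; rewrite ?lexx ?ler01.
have Tub : has_ubound T by exists 1 => t [/andP[]].
have sT : has_sup T by split; [exists 0|].
set m := sup T.
have m01 : 0 <= m <= 1.
  by rewrite ub_le_sup //= ge_sup //; [exists 0|move=> t [/andP[]]].
have [r r0 rA] := Aloc m m01.
have [t [t01 At] tm] := sup_adherent r0 sT.
have tm' : t <= m by apply: ub_le_sup.
have tr : `|t - m| < r by rewrite ltr_norml; rewrite -/m in tm; lra.
have [m1|m1] := ltP m 1; last first.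
  have mE : m = 1 by lra.
  by apply: (rA t 1) => //; rewrite ?ler01 ?lexx // mE subrr normr0.
pose s := Num.min 1 (m + r / 2).
have sm : m < s by rewrite lt_min m1 /=; lra.
have s1 : s <= 1 by rewrite ge_min lexx.
have s2 : s <= m + r / 2 by rewrite ge_min lexx orbT.
have : A s.
  apply: (rA t s) => //; first by lra.
  by rewrite ltr_norml; lra.
move=> As; have : s <= m by apply: ub_le_sup => //; split=> //; lra.
by lra.
Qed.

Lemma continuous01_eps f t (eta : R) : {within `[0, 1], continuous f}%classic ->
  0 <= t <= 1 -> 0 < eta ->
  exists2 r, 0 < r & forall s, 0 <= s <= 1 -> `|s - t| < r -> `|f s - f t| < eta.
Proof.
move=> /subspace_continuousP fc t01 eta0.
have /fc : `[0, 1]%classic t by rewrite /= in_itv.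
move=> /cvgrPdist_lt /(_ eta eta0); rewrite near_withinE /= => -[r r0 rh].
exists r => // s s01 st; rewrite distrC; apply: rh; rewrite /= ?in_itv //.
by rewrite distrC.
Qed.

Lemma uniform01 (Q : R -> R -> Prop) :
  (forall t a b, b <= a -> Q t a -> Q t b) ->
  (forall t, 0 <= t <= 1 -> exists r a, [/\ 0 < r, 0 < a &
     forall s, 0 <= s <= 1 -> `|s - t| < r -> Q s a]) ->
  exists2 a, 0 < a & forall t, 0 <= t <= 1 -> Q t a.
Proof.
move=> Qle Qloc; pose A t := exists2 a, 0 < a & forall s, 0 <= s <= t -> s <= 1 -> Q s a.
suff : A 1 by case=> a a0 h; exists a => // t /[dup] t01 /andP[t0 t1]; exact: h.
apply: real_induction01.
  have [r [a [r0 a0 h]]] := Qloc 0 ltac:(by rewrite lexx ler01).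
  exists a => // s s0 s1; have -> : s = 0 by lra.
  by apply: h; rewrite ?subrr ?normr0 ?lexx ?ler01.
move=> t t01; have [r [a [r0 a0 h]]] := Qloc t t01; exists r => // s s' s01 s'01 st s't.
case=> b b0 sb; exists (Num.min a b) => [|u u0 u1]; first by rewrite lt_min a0.
have [us|us] := lerP u s.
  by apply: Qle (sb u _ u1); [rewrite ge_min lexx orbT|lra].
apply: Qle (h u _ _); first by rewrite ge_min lexx.
  by lra.
by move: st s't; rewrite !ltr_norml; lra.
Qed.

Lemma curve_point_dist f (z : R * R) : {within `[0, 1], continuous f}%classic ->
  (forall s, 0 <= s <= 1 -> f s <> z) ->
  exists2 a, 0 < a & forall s, 0 <= s <= 1 -> a <= `|f s - z|.
Proof.
move=> fc fz; apply: uniform01 => [t a b ba|t t01]; first exact: le_trans.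
have d0 : 0 < `|f t - z| by rewrite normr_gt0 subr_eq0; apply/eqP; exact: fz.
have d2 : 0 < `|f t - z| / 2 by rewrite divr_gt0.
have [r r0 rh] := continuous01_eps fc t01 d2.
exists r, (`|f t - z| / 2); split => // s s01 /(rh s s01) st.
have := ler_distD (f s) (f t) z; rewrite [`|f t - f s|]distrC; lra.
Qed.

Lemma curves_dist f g :
  {within `[0, 1], continuous f}%classic -> {within `[0, 1], continuous g}%classic ->
  (forall s t, 0 <= s <= 1 -> 0 <= t <= 1 -> f s <> g t) ->
  exists2 a, 0 < a & forall s t, 0 <= s <= 1 -> 0 <= t <= 1 -> a <= `|f s - g t|.
Proof.
move=> fc gc fg.
have [a a0 h] : exists2 a, 0 < a & forall t, 0 <= t <= 1 ->
    forall s, 0 <= s <= 1 -> a <= `|f s - g t|.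
  apply: (@uniform01 (fun t a => forall s, 0 <= s <= 1 -> a <= `|f s - g t|)).
    by move=> t a b ba h s s01; exact: le_trans (h s s01).
  move=> t t01; have [s|a a0 ah] := curve_point_dist (z := g t) fc _.
    by move=> s01; exact: fg.
  have a2 : 0 < a / 2 by rewrite divr_gt0.
  have [r r0 rh] := continuous01_eps gc t01 a2.
  exists r, (a / 2); split=> // u u01 /(rh u u01) ut s s01.
  by have := ler_distD (g u) (f s) (g t); have := ah s s01; lra.
by exists a => // s t s01 t01; exact: h.
Qed.

Definition close (eta : R) : rel (R * R) := fun p q => `|p - q| < eta.

Lemma close_sym eta : symmetric (close eta).
Proof. by move=> p q; rewrite /close distrC. Qed.

Lemma curve_chain f eta : {within `[0, 1], continuous f}%classic -> 0 < eta ->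
  exists ts : seq R, [/\ all (fun t => 0 <= t <= 1) ts,
    path (close eta) (f 0) [seq f t | t <- ts] & last 0 ts = 1].
Proof.
move=> fc eta0; apply: (@real_induction01 (fun u => exists ts : seq R,
  [/\ all (fun t => 0 <= t <= 1) ts, path (close eta) (f 0) [seq f t | t <- ts] & last 0 ts = u])).
  by exists [::].
move=> t t01; have eta2 : 0 < eta / 2 by rewrite divr_gt0.
have [r r0 rh] := continuous01_eps fc t01 eta2.
exists r => // s s' s01 s'01 /(rh s s01) h /(rh s' s'01) h' [ts [ts01 tsp tsl]].
exists (rcons ts s'); rewrite all_rcons s'01 ts01 last_rcons map_rcons rcons_path tsp.
split=> //=; rewrite last_map tsl /close.
by apply: le_lt_trans (ler_distD (f t) _ _) _; rewrite [`|f t - f s'|]distrC; lra.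
Qed.

End UnitInterval.

Lemma finite_positive_bound (R : realFieldType) (T : finType) (Q : T -> R -> Prop) :
  (forall x a b, b <= a -> Q x a -> Q x b) ->
  (forall x, exists2 a, 0 < a & Q x a) -> exists2 a, 0 < a & forall x, Q x a.
Proof.
move=> Qle h.
suff [a a0 ha] : exists2 a, 0 < a & forall x, x \in enum T -> Q x a.
  by exists a => // x; apply: ha; rewrite mem_enum.
elim: (enum T) => [|x s [a a0 ha]]; first by exists 1.
have [b b0 hb] := h x; exists (Num.min a b) => [|y]; first by rewrite lt_min a0.
rewrite inE => /predU1P[->|/ha h']; first by apply: Qle hb; rewrite ge_min lexx orbT.
by apply: Qle h'; rewrite ge_min lexx.
Qed.

Lemma path_uniq_steps (A : pred nat) x s : all A (x :: s) -> uniq (x :: s) ->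
  path (steps_in A) x s.
Proof.
elim: s x => [|y s IH] x //=; rewrite inE negb_or.
move=> /and3P[Ax Ay As] /andP[/andP[xy xs] ys].
by rewrite /steps_in Ax Ay xy IH //= Ay.
Qed.

Section Drawing.
Variables (R : realType) (G : graph) (pt : G -> R * R) (arc : {set G} -> R -> R * R).
Hypothesis pt_inj : injective pt.
Hypothesis arc_curve : forall e, e \in edges G ->
  [/\ {within `[0, 1], continuous (arc e)}%classic,
      {in `[0, 1] &, injective (arc e)} &
      exists u v, [/\ e = [set u; v]%SET, arc e 0 = pt u & arc e 1 = pt v] ].
Hypothesis arc_vertex : forall e s w, e \in edges G -> s \in `]0, 1[ -> arc e s <> pt w.
Hypothesis arc_arc : forall e f s t, e \in edges G -> f \in edges G -> e != f ->
  s \in `]0, 1[ -> t \in `]0, 1[ -> arc e s <> arc f t.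

Definition on_curve (A : {set G}) (p : R * R) := exists e t,
  [/\ e \in edges G, e \subset A, 0 <= t <= 1 & p = arc e t].

Lemma arc_end e s : e \in edges G -> 0 <= s <= 1 ->
  (s \in `]0, 1[) \/ exists2 u, u \in e & arc e s = pt u.
Proof.
move=> eE /andP[s0 s1]; have [_ _ [u [v [ee e0 e1]]]] := arc_curve eE.
have [sp|sn|sE] := ltgtP 0 s; [|by lra|]; last first.
  by right; exists u; [rewrite ee !inE eqxx|rewrite -sE].
have [sl|sn|sE] := ltgtP s 1; [|by lra|]; last first.
  by right; exists v; [rewrite ee !inE eqxx orbT|rewrite sE].
by left; rewrite in_itv /= sp.
Qed.

Lemma disjoint_arcs e f s t : e \in edges G -> f \in edges G -> [disjoint e & f] ->
  0 <= s <= 1 -> 0 <= t <= 1 -> arc e s <> arc f t.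
Proof.
move=> eE fE ef s01 t01.
have [si|[u ue us]] := arc_end eE s01; have [ti|[v vf vt]] := arc_end fE t01.
- apply: arc_arc => //; apply/eqP=> h; move: ef; rewrite h -setI_eq0 finset.setIid => /eqP f0.
  by have [_ _ [u [v [fe _ _]]]] := arc_curve fE; have := in_set0 u; rewrite -f0 fe !inE eqxx.
- by rewrite vt; exact: arc_vertex.
- by rewrite us => h; exact: arc_vertex fE ti (esym h).
- by rewrite us vt => /pt_inj uv; have := disjointFr ef ue; rewrite uv vf.
Qed.

(** Edges inside disjoint vertex sets share no end, so their arcs are disjoint and at positive
    distance; there are finitely many pairs of edges. *)
Lemma disjoint_curves_dist : exists2 mu : R, 0 < mu &
  forall (A B : {set G}) p q, [disjoint A & B] -> on_curve A p -> on_curve B q -> mu <= `|p - q|.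
Proof.
have [mu mu0 h] : exists2 mu : R, 0 < mu & forall ef : {set G} * {set G},
   ef.1 \in edges G -> ef.2 \in edges G -> [disjoint ef.1 & ef.2] ->
   forall s t, 0 <= s <= 1 -> 0 <= t <= 1 -> mu <= `|arc ef.1 s - arc ef.2 t|.
  apply: finite_positive_bound.
    by move=> ef a b ba H e1 e2 d s t s01 t01; exact: le_trans (H e1 e2 d s t s01 t01).
  move=> [e f] /=; case: (boolP [&& e \in edges G, f \in edges G & [disjoint e & f]]).
    move=> /and3P[eE fE ef]; have [ec _ _] := arc_curve eE; have [fc _ _] := arc_curve fE.
    have [s t s01 t01|a a0 ha] := curves_dist ec fc _; first exact: disjoint_arcs.
    by exists a.
  by move=> n; exists 1 => // e1 e2 d; rewrite e1 e2 d in n.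
exists mu => // A B p q AB [e [s [eE eA s01 ->]]] [f [t [fE fB t01 ->]]].
apply: (h (e, f)) => //=; exact: disjointW eA fB AB.
Qed.

Lemma edge_in_edges (u v : G) : adj u v -> [set u; v] \in edges G.
Proof. by move=> uv; rewrite inE; apply/existsP; exists u; apply/existsP; exists v; rewrite uv eqxx. Qed.

Lemma step_polyline (u v : G) eta : adj u v -> 0 < eta -> exists s,
  [/\ path (close eta) (pt u) s, last (pt u) s = pt v &
      forall p, p \in pt u :: s -> on_curve [set u; v] p].
Proof.
move=> uv eta0; have eE := edge_in_edges uv.
have [ec _ [a [b [ee e0 e1]]]] := arc_curve eE.
have [ts [ts01 tsp tsl]] := curve_chain ec eta0.
set e := [set u; v] in eE ec ee e0 e1 tsp *.
have on t : 0 <= t <= 1 -> on_curve e (arc e t) by move=> t01; exists e, t.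
have l1 : last (arc e 0) [seq arc e t | t <- ts] = pt b by rewrite last_map tsl.
have onp p : p \in arc e 0 :: [seq arc e t | t <- ts] -> on_curve e p.
  rewrite inE => /predU1P[->|/mapP[t tt ->]]; apply: on; rewrite ?lexx ?ler01 //.
  exact: (allP ts01).
have nuv : u != v by apply/eqP=> h; move: uv; rewrite h adj_irrefl.
have [[ua vb]|[ub va]] : (u = a /\ v = b) \/ (u = b /\ v = a).
  have ha : a \in e by rewrite ee !inE eqxx.
  have hb : b \in e by rewrite ee !inE eqxx orbT.
  have hu : u \in [set a; b] by rewrite -ee !inE eqxx.
  have hv : v \in [set a; b] by rewrite -ee !inE eqxx orbT.
  move: ha hb hu hv; rewrite /e !inE => /orP[] /eqP -> /orP[] /eqP ->; auto.
    by rewrite orbb => _ /orP[] /eqP h; rewrite h eqxx in nuv.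
  by rewrite orbb => /eqP h; rewrite h eqxx in nuv.
- exists [seq arc e t | t <- ts]; rewrite ua -e0 vb; split=> //.
(* The arc may be parametrised from [v] to [u]; its chain is then reversed. *)
exists (rev (belast (arc e 0) [seq arc e t | t <- ts])); split.
- rewrite ub -l1 rev_path; rewrite (eq_path (e' := close eta)) //.
  by move=> p q; rewrite close_sym.
- rewrite va -e0 ub -l1; case: [seq _ | _ <- _] => //= p s.
  by rewrite rev_cons last_rcons.
- move=> p; rewrite ub -l1 => h; apply: onp.
  by move: h; rewrite inE mem_rev => h; rewrite lastI mem_rcons inE.
Qed.

Lemma walk_polyline (A : {set G}) (u : G) w eta : path adj u w -> all (mem A) (u :: w) ->
  w != [::] -> 0 < eta -> exists s,
  [/\ path (close eta) (pt u) s, last (pt u) s = pt (last u w) &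
      forall p, p \in pt u :: s -> on_curve A p].
Proof.
move=> + + + eta0; elim: w u => // v w IH u /= /andP[uv vw] /and3P[uA vA wA] _.
have [s [sp sl son]] := step_polyline uv eta0.
have sonA p : p \in pt u :: s -> on_curve A p.
  move=> /son[e [t [eE eS t01 ->]]]; exists e, t; split=> //.
  apply: fintype.subset_trans eS _; apply/subsetP=> x; rewrite !inE.
  by case/orP=> /eqP ->.
have [w0|wn] := eqVneq w [::].
  by exists s; rewrite w0 /=; split.
have [|s' [sp' sl' son']] := IH v vw _ wn; first by rewrite /= vA.
exists (s ++ s'); rewrite cat_path sp last_cat sl; split=> // p.
rewrite -cat_cons mem_cat => /orP[/sonA //|ps]; apply: son'.
by rewrite inE ps orbT.
Qed.

End Drawing.

(** * Planar graphs *)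

Lemma path_and (T : eqType) (r1 r2 : rel T) (p : pred T) x s :
  path r1 x s -> path r2 x s -> all p (x :: s) ->
  path (fun a b => [&& r1 a b, r2 a b & p a]) x s.
Proof.
elim: s x => [|y s IH] x //= /andP[a1 s1] /andP[a2 s2] /andP[px ps].
by rewrite a1 a2 px IH.
Qed.

Lemma branch_walk (G : graph) (A B : {set G}) (a b : G) : connected_in A -> connected_in B ->
  [disjoint A & B] -> a \in A -> b \in B ->
  (exists x y, [/\ x \in A, y \in B & adj x y]) ->
  exists w, [/\ path adj a w, last a w = b, all (mem (A :|: B)) (a :: w) & w != [::]].
Proof.
move=> cA cB AB aA bB [x [y [xA yB xy]]].
have csub (C : {set G}) u v : connect (rel_in (@adj G) C) u v -> u \in C -> exists w,
    [/\ path adj u w, last u w = v & all (mem C) (u :: w)].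
  move=> /connectP[w uw ->] uC; exists w.
  elim: w u uC uw => [|z w IH] u uC /=; first by rewrite uC.
  move=> /andP[/and3P[_ zC uz] /(IH z zC)[zw _ /=]]; rewrite uz uC zC => ->.
  by rewrite zw.
have [w1 [p1 l1 a1]] := csub A a x (cA a x aA xA) aA.
have [w2 [p2 l2 a2]] := csub B y b (cB y b yB bB) yB.
exists (w1 ++ y :: w2); split.
- by rewrite cat_path p1 l1 /= xy.
- by rewrite last_cat /= l2.
- rewrite -cat_cons all_cat; apply/andP; split; [move: a1|move: a2]; apply: sub_all => z /=;
  by rewrite inE => ->; rewrite ?orbT.
- by case: (w1).
Qed.

Section NoK5.
Variables (R : realType) (G : graph).

(* Index of the [k]-th inner point of the polyline from [i] to [j]: the residue
   modulo 25 of [index - 6] encodes [(i, j)]. *)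
Let idx (i j k : nat) : nat := (6 + (25 * k + (5 * i + j)))%N.
Let inner n i j : pred nat := fun x =>
  [&& (i < 5)%N, (j < 5)%N, (5 < x < n)%N & ((x - 6) %% 25 == 5 * i + j)%N].

Let idx_mod i j k : (i < 5)%N -> (j < 5)%N -> ((idx i j k - 6) %% 25)%N = (5 * i + j)%N.
Proof. by move=> i5 j5; rewrite /idx addKn mulnC modnMDl modn_small //; lia. Qed.

Let idx_div i j k : (i < 5)%N -> (j < 5)%N -> ((idx i j k - 6) %/ 25)%N = k.
Proof. by move=> i5 j5; rewrite /idx addKn mulnC divnMDl // divn_small ?addn0 //; lia. Qed.

(** The edge [i j] of [K_5] becomes a fine polyline along arcs inside [br i :|: br j]. By parity,
    two polylines of disjoint edges contain crossing segments; these are so short that their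
    starting points lie closer than [mu], although they sit on curves inside disjoint vertex
    sets. *)
Lemma planar_no_K5 : planar R G -> ~ is_minor (complete_graph 5) G.
Proof.
move=> [pt [arc [pt_inj arc_curve arc_vertex arc_arc]]] [branch [B0 Bc Bd Be]].
have [mu mu0 far] := disjoint_curves_dist pt_inj arc_curve arc_vertex arc_arc.
pose br (i : nat) := branch (inord i : 'I_5).
have inord_neq i j : (i < 5)%N -> (j < 5)%N -> i != j -> (inord i : 'I_5) != inord j.
  move=> i5 j5; apply: contra => /eqP/(congr1 val) /=.
  by rewrite /= !inordK // => ->.
have /boolp.choice[c cP] : forall i : nat, exists v, v \in br i.
  by move=> i; have /set0Pn := B0 (inord i).
(* The final estimate stays below [8 * eta]: two displacements by perturbation, and two crossing
   segments of length below [3 * eta] each. *)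
pose eta := mu / 10; have eta0 : 0 < eta by rewrite divr_gt0.
have poly_ex (ij : nat * nat) : exists s : seq (R * R), (ij.1 < ij.2 < 5)%N ->
    [/\ path (close eta) (pt (c ij.1)) s, last (pt (c ij.1)) s = pt (c ij.2) &
      forall p, p \in pt (c ij.1) :: s -> on_curve arc (br ij.1 :|: br ij.2) p].
  case: ij => i j /=; case: (boolP (i < j < 5)%N) => [/andP[ij j5]|_]; last by exists [::].
  have i5 : (i < 5)%N by exact: ltn_trans ij j5.
  have nij : (inord i : 'I_5) != inord j by apply: inord_neq => //; rewrite neq_ltn ij.
  have [w [aw lw wA wn]] := branch_walk (Bc (inord i)) (Bc (inord j)) (Bd _ _ nij)
      (cP i) (cP j) (Be _ _ nij).
  have [s [sp sl son]] := walk_polyline pt_inj arc_curve aw wA wn eta0.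
  by exists s => _; rewrite sl lw.
have /boolp.choice[S SP] := poly_ex.
have [M MP] : exists M, forall i j, (i < 5)%N -> (j < 5)%N -> (size (S (i, j)) <= M)%N.
  exists (\max_(ij : 'I_5 * 'I_5) size (S (val ij.1, val ij.2))) => i j i5 j5.
  exact: (@leq_bigmax _ (fun ij : 'I_5 * 'I_5 => size (S (val ij.1, val ij.2)))
    (Ordinal i5, Ordinal j5)).
(* Exceeds every [idx i j k] in use, since [5 * i + j < 25] and [k <= M]. *)
pose n := idx 5 0 M.
(* At the apex index 5 the truncated subtraction yields an arbitrary point; only its general
   position after perturbation matters. *)
pose Q (x : nat) : R * R := if (x < 5)%N then pt (c x) else
  nth 0 (S (((x - 6) %% 25) %/ 5, ((x - 6) %% 25) %% 5)%N) ((x - 6) %/ 25)%N.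
have Qidx i j k : (i < 5)%N -> (j < 5)%N -> Q (idx i j k) = nth 0 (S (i, j)) k.
  move=> i5 j5; rewrite /Q; case: ltnP => [|_]; first by rewrite /idx; lia.
  by rewrite idx_mod // idx_div // mulnC divnMDl // divn_small // addn0 modnMDl modn_small.
(* The last point of [S (i, j)] is the drawn centre of [br j], and it is represented by the index
   [j] itself. *)
pose poly i j := rcons [seq idx i j k | k <- iota 0 (size (S (i, j))).-1] j.
pose theta := eta / n.+1%:R ^+ 2.
have theta0 : 0 < theta by rewrite divr_gt0 // exprn_gt0 // ltr0n.
have [eps /andP[eps0 epst] gen] := perturb_generic Q n theta0.
have n5 : (5 < n)%N by rewrite /n /idx; lia.
have S_neq0 i j : (i < j < 5)%N -> (0 < size (S (i, j)))%N.
  move=> ij; rewrite lt0n size_eq0; apply/eqP=> S0.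
  have [_ + _] := SP (i, j) ij; rewrite S0 /= => /pt_inj h.
  have /andP[ij' j5] := ij; have i5 : (i < 5)%N by exact: ltn_trans ij' j5.
  have nij : (inord i : 'I_5) != inord j by apply: inord_neq => //; rewrite neq_ltn ij'.
  by have := disjointFr (Bd _ _ nij) (cP i); rewrite h cP.
have polyQ i j : (i < j < 5)%N -> [seq Q x | x <- poly i j] = S (i, j).
  move=> ij; have Sn := S_neq0 i j ij; have /andP[ij' j5] := ij.
  have i5 : (i < 5)%N by exact: ltn_trans ij' j5.
  have [_ Sl _] := SP (i, j) ij.
  rewrite /poly map_rcons -map_comp (eq_map (g := nth 0 (S (i, j)))); last first.
    by move=> k /=; rewrite Qidx.
  apply: (@eq_from_nth _ 0); first by rewrite size_rcons size_map size_iota prednK.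
  move=> k; rewrite size_rcons size_map size_iota ltnS => kS.
  rewrite nth_rcons size_map size_iota; case: ltngtP kS => // [kS _|-> _].
    by rewrite (nth_map 0%N) ?size_iota // nth_iota.
  rewrite /Q j5 nth_last; by case: (S (i, j)) Sl Sn => [|p s] //= ->.
have poly_in i j : (i < j < 5)%N ->
    all (fun x => [|| x == i, x == j | inner n i j x]) (i :: poly i j) /\ uniq (i :: poly i j).
  move=> ij; have /andP[ij' j5] := ij; have i5 : (i < 5)%N by exact: ltn_trans ij' j5.
  have MS := MP i j i5 j5.
  have notin k : (k < 5)%N -> k \notin [seq idx i j k | k <- iota 0 (size (S (i, j))).-1].
    by move=> k5; apply/mapP=> -[m _]; rewrite /idx; lia.
  split.
    rewrite /= eqxx all_rcons eqxx orbT /=; apply/allP=> _ /mapP[k + ->].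
    rewrite mem_iota add0n => /andP[_ kS]; rewrite /inner i5 j5 idx_mod // eqxx andbT.
    by apply/orP; right; apply/orP; right; rewrite /n /idx; lia.
  rewrite /= mem_rcons inE negb_or rcons_uniq !notin // andbT /=.
  rewrite neq_ltn ij' /= map_inj_uniq ?iota_uniq // => a b.
  by rewrite /idx; lia.
have [i [j [k [l [ij kl u]]]]] : exists i j k l, [/\ (i < j < 5)%N, (k < l < 5)%N,
    uniq [:: i; j; k; l] &
    cross_parity (perturb Q eps) i (poly i j) k (poly k l)].
  apply: (@polyline_K5 R (perturb Q eps) n gen poly (inner n) n5).
  - by move=> i j ij; have [a b] := poly_in i j ij; exact: path_uniq_steps.
  - by move=> i j ij; rewrite /poly last_rcons.
  - by move=> i j x /and4P[].
  - by move=> i j k l x /and4P[i5 j5 _ /eqP h1] /and4P[k5 l5 _ /eqP h2]; congr pair; lia.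
pose ok i j (x : nat) := `[< on_curve arc (br i :|: br j) (Q x) >].
pose r i j : rel nat := fun a b =>
  [&& steps_in (fun x => [|| x == i, x == j | inner n i j x]) a b,
      close eta (Q a) (Q b) & ok i j a].
have rP i' j' : (i' < j' < 5)%N -> path (r i' j') i' (poly i' j').
  move=> ij'; have [a b] := poly_in i' j' ij'; have [Sp _ Son] := SP (i', j') ij'.
  have /andP[ij'' j5] := ij'; have i5 : (i' < 5)%N by exact: ltn_trans ij'' j5.
  have Qi : Q i' = pt (c i') by rewrite /Q i5.
  apply: path_and; first exact: path_uniq_steps.
    by have := Sp; rewrite /= -Qi -(polyQ i' j' ij') path_map.
  apply/allP=> x xs; apply/asboolP; apply: Son => /=.
  by rewrite -Qi -(polyQ i' j' ij') -map_cons map_f.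
move=> cross; have [a [b [/and3P[/and3P[Aa Ab ab] cab oa]]]] := path_xor_true (rP i j ij) cross.
move=> cross'; have [c' [d [/and3P[/and3P[Cc Cd cd] ccd oc] crs]]] :=
  path_xor_true (rP k l kl) cross'.
have [/andP[ij' j5] /andP[kl' l5]] := (ij, kl).
have [i5 k5] : (i < 5)%N /\ (k < 5)%N by split; [exact: ltn_trans ij' j5|exact: ltn_trans kl' l5].
have dis : [disjoint br i :|: br j & br k :|: br l].
  move: u; rewrite /= !inE !negb_or => /and3P[/and3P[_ ik il] /andP[jk jl] _].
  rewrite -setI_eq0 setIUl !setIUr !setU_eq0 !setI_eq0.
  by rewrite !Bd ?inord_neq.
have lt_n i1 j1 x : (i1 < 5)%N -> (j1 < 5)%N ->
    [|| x == i1, x == j1 | inner n i1 j1 x] -> (x < n)%N.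
  move=> i15 j15 /or3P[/eqP ->|/eqP ->|/and4P[_ _ /andP[_ //] _]].
  - exact: ltn_trans i15 n5.
  - exact: ltn_trans j15 n5.
have neq x y : [|| x == i, x == j | inner n i j x] -> [|| y == k, y == l | inner n k l y] -> x != y.
  move=> hx hy; apply/eqP=> xy; rewrite -xy in hy; move: hx hy u; rewrite /inner /= !inE.
  clear -i5 j5 k5 l5 => hx hy; lia.
have dist_pert x : (x < n)%N -> `|(perturb Q eps x).1 - (Q x).1| <= eta /\
    `|(perturb Q eps x).2 - (Q x).2| <= eta.
  move=> xn; rewrite /perturb /= !(addrC (_ (Q x))) !addrK.
  have xn1 : x%:R <= n.+1%:R :> R by rewrite ler_nat ltnW // ltnS ltnW.
  have x0 : 0 <= x%:R :> R by [].
  have n1 : 1 <= n.+1%:R :> R by rewrite ler1n.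
  have eN : eps * n.+1%:R ^+ 2 <= eta.
    by rewrite -ler_pdivlMr // exprn_gt0 // ltr0n.
  have x2 : x%:R ^+ 2 <= n.+1%:R ^+ 2 :> R by rewrite lerXn2r ?nnegrE.
  have x1 : x%:R <= n.+1%:R ^+ 2 :> R.
    by apply: le_trans xn1 _; rewrite expr2 ler_peMr //; lra.
  have eps0' := ltW eps0.
  rewrite !ger0_norm ?mulr_ge0 ?exprn_ge0 //.
  by split; apply: le_trans eN; rewrite ler_pM2l.
have [an bn cn dn] : [/\ (a < n)%N, (b < n)%N, (c' < n)%N & (d < n)%N].
  by split; [exact: lt_n Aa|exact: lt_n Ab|exact: lt_n Cc|exact: lt_n Cd].
have := crosses_close (gen _ _ _ an bn cn ab (neq _ _ Aa Cc) (neq _ _ Ab Cc))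
  (gen _ _ _ an bn dn ab (neq _ _ Aa Cd) (neq _ _ Ab Cd)) _ _ crs.
case.
- by apply: gen => //; rewrite eq_sym neq.
- by apply: gen => //; rewrite eq_sym neq.
move=> c1 c2.
have := far _ _ _ _ dis (asboolP _ oa) (asboolP _ oc).
apply/negP; rewrite -ltNge.
have [a1 a2] := dist_pert a an; have [b1 b2] := dist_pert b bn.
have [cc1 cc2] := dist_pert c' cn; have [d1 d2] := dist_pert d dn.
have coord (p q : R * R) : `|p.1 - q.1| <= `|p - q| /\ `|p.2 - q.2| <= `|p - q|.
  by rewrite prod_normE /= !le_max !lexx orbT.
have [ab1 ab2] := coord (Q a) (Q b); have [cd1 cd2] := coord (Q c') (Q d).
rewrite prod_normE /= gt_max.
move: cab ccd; rewrite /close => cab ccd.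
have muE : mu = 10 * eta by rewrite /eta; lra.
have tri (x y x' y' z w z' w' : R) : `|x' - x| <= eta -> `|y' - y| <= eta -> `|z' - z| <= eta ->
  `|w' - w| <= eta -> `|x - y| < eta -> `|z - w| < eta -> `|x' - z'| <= `|y' - x'| + `|w' - z'| ->
  `|x - z| < mu.
  rewrite muE => h1 h2 h3 h4 h5 h6 h7.
  have e1 := ler_distD x' x z; have e2 := ler_distD z' x' z.
  have e3 := ler_distD y y' x'; have e4 := ler_distD x y x'.
  have e5 := ler_distD w w' z'; have e6 := ler_distD z w z'.
  rewrite (distrC x x') in e1; rewrite (distrC y x) (distrC x x') in e4.
  rewrite (distrC w z) (distrC z z') in e6.
  lra.
apply/andP; split.
  exact: (tri _ _ _ _ _ _ _ _ a1 b1 cc1 d1 (le_lt_trans ab1 cab) (le_lt_trans cd1 ccd) c1).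
exact: (tri _ _ _ _ _ _ _ _ a2 b2 cc2 d2 (le_lt_trans ab2 cab) (le_lt_trans cd2 ccd) c2).
Qed.

End NoK5.

(** * Absolute constants *)

Lemma avg_degree_le (R : realType) (M : graph) (d : R) : 0 <= d ->
  (0 < #|M|)%N -> (#|arcs M|)%:R <= d * #|M|%:R -> avg_degree R M <= d.
Proof. by move=> d0 M0; rewrite /avg_degree card_arcs natrM ler_pdivrMr ?ltr0n. Qed.

Lemma avg_degree_void (R : realType) (M : graph) : #|M| = 0%N -> avg_degree R M = 0.
Proof. by move=> M0; rewrite /avg_degree M0 invr0 mulr0. Qed.

Lemma ln2_bounds (R : realType) : 1 / 2 <= ln (2 : R) <= 1.
Proof.
have /andP[e1 e2] := expR1_bounds R.
have two0 : (0 : R) < 2 by rewrite ltr0n.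
rewrite -[in X in X && _]ler_expR -[in X in _ && X]ler_expR lnK ?posrE //.
apply/andP; split; last by apply: le_trans e1; lra.
have eE : expR (1 / 2 : R) ^+ 2 = expR 1.
  by rewrite expr2 -expRD; congr expR; field.
rewrite -(@ler_pXn2r _ 2) ?nnegrE ?expR_ge0 ?(ltW two0) // eE.
by apply: le_trans e2 _; rewrite expr2; lra.
Qed.

Lemma sqrt_ln_ge_half (R : realType) (t : nat) : (1 < t)%N -> 1 / 2 <= Num.sqrt (ln t%:R) :> R.
Proof.
move=> t1; have /andP[l2 _] := ln2_bounds R.
have h2 : (1 / 2 : R) <= ln t%:R.
  apply: le_trans l2 _; rewrite ler_ln ?posrE ?ltr0n ?(ltnW t1) //.
  by rewrite ler_nat.
have half0 : (0 : R) <= 1 / 2 by rewrite divr_ge0.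
rewrite -(@ler_pXn2r _ 2) ?nnegrE ?sqrtr_ge0 //.
rewrite sqr_sqrtr; last by apply: le_trans h2; lra.
by apply: le_trans h2; rewrite expr2; lra.
Qed.

(* Mader's bound with the asymptotically right order of magnitude: dense minors
   with [2 ^ (q * q)] about [t] force [q] to be of order [sqrt (ln t)]. *)
Lemma clique_free_degree (R : realType) : exists2 C : R, 1 <= C &
  forall (t : nat) (G M : graph), (1 < t)%N ->
  ~ is_minor (complete_graph t) G -> is_minor M G ->
  avg_degree R M <= C * t%:R * Num.sqrt (ln t%:R).
Proof.
have a0 : (0 < 534)%N by [].
move: 534%N a0 (@dense_clique_minor) => a a0 dense.
exists (16 * a%:R); first by have : (1 : R) <= a%:R by [rewrite ler1n]; lra.
move=> t G M t1 noK MG; set y := Num.sqrt _.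
have y2 : 1 / 2 <= y := sqrt_ln_ge_half R t1.
have y0 : 0 <= y := sqrtr_ge0 _.
have t0 : (0 : R) < t%:R by rewrite ltr0n ltnW.
have C0 : 0 <= 16 * a%:R * t%:R * y :> R by rewrite !mulr_ge0.
have [M0|M0] := posnP #|M|; first by rewrite avg_degree_void.
apply: avg_degree_le => //.
have : exists q, (t <= 2 ^ (q * q))%N.
  by exists t; apply: leq_trans (ltnW (ltn_expl t (leqnn 2))) _; rewrite leq_exp2l // leq_pmulr // ltnW.
(* Minimality of [q] gives [(q - 1) ^ 2 ln 2 <= ln t]; the clique lemma is then applied with
   [m = q + 2], as [2 m (m - 2) >= q ^ 2 + 1]. *)
move=> /ex_minnP[q tq qmin].
have q0 : (0 < q)%N by case: (q) tq => // h; move: t1; rewrite ltnNge h.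
have q2y : q%:R - 1 <= 2 * y.
  have tq' : (2 ^ (q.-1 * q.-1) < t)%N.
    by rewrite ltnNge; apply/negP=> /qmin; rewrite -{1}(prednK q0) ltnn.
  have /andP[l2 _] := ln2_bounds R.
  have ln_t : (q%:R - 1) ^+ 2 * ln (2 : R) <= y ^+ 2.
    rewrite sqr_sqrtr ?ln_ge0 ?ler1n ?(ltnW t1) //.
    have -> : (q%:R - 1) ^+ 2 = (q.-1 * q.-1)%:R :> R.
      by rewrite natrM expr2 -{1 2}(prednK q0) -natr1 addrK.
    rewrite mulr_natl -lnXn ?ltr0n // ler_ln ?posrE ?exprn_gt0 ?ltr0n ?(ltnW t1) //.
    by rewrite -natrX ler_nat ltnW.
  have q1 : (0 : R) <= q%:R - 1 by rewrite subr_ge0 ler1n.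
  have : (q%:R - 1) ^+ 2 * (1 / 2) <= (q%:R - 1) ^+ 2 * ln (2 : R) by rewrite ler_wpM2l // sqr_ge0.
  move=> h; rewrite leNgt; apply/negP=> lt.
  have : 2 * y * (2 * y) < (q%:R - 1) * (q%:R - 1) by rewrite ltr_pM // mulr_ge0.
  by have := mulr_ge0 y0 y0; move: h ln_t; rewrite !expr2; clear; lra.
have q8 : (q + 2)%:R <= 8 * y by rewrite natrD; lra.
have [h|/ltnW h] := leqP (2 * (a * (q + 2) * t) * #|M|) #|arcs M|.
  case: noK; apply: (dense _ _ _ _ _ MG M0 (ltnW t1) _ _ (leqnn _) h).
    by rewrite addn2 !ltnS.
  rewrite addnK.
  apply: (@leq_trans (2 * 2 ^ (q * q))); first by rewrite leq_mul2l.
  by rewrite -expnS leq_exp2l //; clear -q0; nia.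
apply: (@le_trans _ _ ((2 * (a * (q + 2) * t) * #|M|)%:R)); first by rewrite ler_nat.
rewrite natrM ler_wpM2r // !natrM.
have : (q + 2)%:R * t%:R <= 8 * y * t%:R by rewrite ler_wpM2r // ltW.
move=> h2; have := ler_wpM2l (ler0n R a) h2; move: ((q + 2)%:R) => z; clear; nra.
Qed.

Section AbsoluteConstant.
Variable R : realType.
Local Notation e := (expR (1 : R)).

(** Since [y <= t], the argument on the left is at most [11 e C (t x) ^ 2]. The additive constant is
    absorbed because [ln (t x) >= 1 / 2]. *)
Lemma log_bound (C y x : R) (t : nat) : 1 <= C -> 1 / 2 <= y -> y ^+ 2 = ln t%:R ->
  (1 < t)%N -> 1 <= x ->
  ln (11 * e * (C * t%:R * y) * x) <= (2 * ln (11 * e * C) + 2) * ln (t%:R * x).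
Proof.
move=> C1 y2 yE t1 x1; have /andP[e1 _] := expR1_bounds R.
have t2 : (2 : R) <= t%:R by rewrite ler_nat.
have eC1 : 1 <= 11 * e * C.
  have : 0 <= (C - 1) * (11 * e) by rewrite mulr_ge0 //; lra.
  by lra.
have l0 : 0 <= ln (11 * e * C) by rewrite ln_ge0.
have tx2 : 2 <= t%:R * x.
  have : 0 <= (t%:R - 2) * x by rewrite mulr_ge0 //; lra.
  by lra.
have L2 : 1 / 2 <= ln (t%:R * x).
  have /andP[l2 _] := ln2_bounds R; apply: le_trans l2 _.
  by rewrite ler_ln ?posrE //; lra.
have yt : y <= t%:R.
  have : ln (1 + (t%:R - 1)) <= t%:R - 1 :> R by apply: le_ln1Dx; lra.
  rewrite addrC subrK.
  by rewrite -yE expr2; nra.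
have pos0 : 0 < 11 * e * C by lra.
have pos1 : 0 < t%:R * x by lra.
have pos2 : 0 < C * t%:R * y by rewrite !mulr_gt0 //; lra.
have pos3 : 0 < 11 * e * (C * t%:R * y) * x by rewrite !mulr_gt0 ?expR_gt0 //; lra.
apply: (@le_trans _ _ (ln (11 * e * C * (t%:R * x) ^+ 2))).
  rewrite ler_ln ?posrE //; last by rewrite mulr_gt0 // exprn_gt0.
  rewrite (_ : 11 * e * (C * t%:R * y) * x = 11 * e * C * (t%:R * x * y)); last by ring.
  rewrite ler_pM2l // expr2 ler_pM2l //; apply: le_trans yt _.
  by rewrite ler_peMr //; lra.
rewrite lnM ?posrE ?exprn_gt0 // lnXn //.
have : 0 <= ln (11 * e * C) * (ln (t%:R * x) - 1 / 2) by rewrite mulr_ge0 //; lra.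
by move: (ln _) (ln _) => l L; lra.
Qed.

End AbsoluteConstant.

Theorem theorem1p3 (R : realType) :
  (forall (t : nat) (d : R) (G : graph),
     (1 <= t)%N -> 0 < d ->
     ((0 < #|G|)%N -> edges G = finset.set0 -> 1 <= d) ->
     ~ is_minor (complete_graph t) G ->
     (forall M : graph, is_minor M G -> avg_degree R M <= d) ->
     forall H : {set {set G}}, ball_hypergraph H ->
       (tau H)%:R <= 2 * expR 1 * (t%:R - 1) * d * (nu H)%:R
                     * ln (11 * expR 1 * d * (nu H)%:R))
  /\
  (exists2 c : R, 0 < c &
     forall (t : nat) (G : graph),
       (1 <= t)%N ->
       ~ is_minor (complete_graph t) G ->
       forall H : {set {set G}}, ball_hypergraph H ->
         (tau H)%:R <= c * t%:R ^+ 2 * Num.sqrt (ln t%:R) * (nu H)%:R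
                       * ln (t%:R * (nu H)%:R))
  /\
  (forall G : graph, planar R G ->
     forall H : {set {set G}}, ball_hypergraph H ->
       (tau H)%:R <= 48 * expR 1 * (nu H)%:R
                     * ln (66 * expR 1 * (nu H)%:R) :> R).
Proof.
have /andP[e1 _] := expR1_bounds R.
split; [|split].
- by move=> t d G _ _ d1 noK deg H; exact: ball_hypergraph_tau_le.
- have [C C1 deg] := clique_free_degree R.
  set K := 2 * ln (11 * expR 1 * C) + 2.
  have K0 : 0 < K.
    have : 0 <= (C - 1) * (11 * expR 1) by rewrite mulr_ge0 //; lra.
    move=> h; have : 0 <= ln (11 * expR 1 * C) by rewrite ln_ge0 //; lra.
    by rewrite /K; lra.
  have C0 : 0 < C by lra.
  exists (2 * expR 1 * C * K); first by rewrite !mulr_gt0 ?expR_gt0.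
  move=> t G t0 noK H Hball; set y := Num.sqrt _.
  have L0 : 0 <= ln (t%:R * (nu H)%:R) :> R.
    rewrite -natrM; case: (t * nu H)%N => [|n]; first by rewrite ln0.
    by rewrite ln_ge0 // ler1n.
  have RHS0 : 0 <= 2 * expR 1 * C * K * t%:R ^+ 2 * y * (nu H)%:R * ln (t%:R * (nu H)%:R).
    by rewrite !mulr_ge0 ?expR_ge0 ?exprn_ge0 ?sqrtr_ge0 // ltW.
  (* For [t <= 1] the graph has no vertex, hence no ball. *)
  have [t1|t1] := leqP t 1.
    rewrite tau_no_edge //; apply/eqP; apply: contra_notT noK => /set0Pn[b bH].
    by have [v _] := set0Pn _ (ball_neq0 Hball bH); exact: (K1_minor v).
  have y2 : 1 / 2 <= y := sqrt_ln_ge_half R t1.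
  have t2 : (2 : R) <= t%:R by rewrite ler_nat.
  have d1 : 1 <= C * t%:R * y.
    have h1 : 1 <= t%:R * y by have := mulr_ge0 (ltW C0); nra.
    by rewrite -mulrA; nra.
  have h := ball_hypergraph_tau_le (fun _ _ => d1) noK (fun M => deg t G M t1 noK) Hball.
  apply: le_trans h _.
  have [n0|n0] := posnP (nu H); first by rewrite n0 !(mulr0, mul0r).
  have x1 : (1 : R) <= (nu H)%:R by rewrite ler1n.
  have yE : y ^+ 2 = ln t%:R by rewrite sqr_sqrtr // ln_ge0 // ler1n.
  have A0 : 0 <= 2 * expR 1 * (C * t%:R * y) * (nu H)%:R by rewrite !mulr_ge0 ?expR_ge0 //; lra.
  have := log_bound C1 y2 yE t1 x1; rewrite -/K => hl.
  have KL0 := mulr_ge0 (ltW K0) L0.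
  have t10 : (0 : R) <= t%:R - 1 by lra.
  apply: (@le_trans _ _ (2 * expR 1 * (t%:R - 1) * (C * t%:R * y) * (nu H)%:R
     * (K * ln (t%:R * (nu H)%:R)))).
    rewrite ler_wpM2l // (_ : _ * _ * _ * _ * _ = 2 * expR 1 * (C * t%:R * y) * (nu H)%:R * (t%:R - 1)); last by ring.
    exact: mulr_ge0.
  rewrite -subr_ge0 (_ : _ - _ = 2 * expR 1 * (C * t%:R * y) * (nu H)%:R * (K * ln (t%:R * (nu H)%:R))); last by ring.
  exact: mulr_ge0.
- move=> G planarG H Hball; have noK := planar_no_K5 planarG.
  have six : (0 : R) <= 6 by [].
  have deg (M : graph) : is_minor M G -> avg_degree R M <= 6.
    move=> MG; have [M0|M0] := posnP #|M|; first by rewrite avg_degree_void.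
    apply: avg_degree_le => //; have := no_K5_minor_degree noK MG.
    by rewrite -(ler_nat R) natrM.
  have one_le : (1 : R) <= 6 by rewrite ler1n.
  have := ball_hypergraph_tau_le (fun _ _ => one_le) noK deg Hball.
  rewrite (_ : 2 * expR 1 * (5%:R - 1) * 6 = 48 * expR 1); last by ring.
  rewrite (_ : 11 * expR 1 * 6 = 66 * expR 1); last by ring.
  by [].
Qed.
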